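(* Let $1\le q<p<\infty$ and, for each $n\in\mathbb N$, let $\mathscr Z^{(n)}$ be a random vector uniformly distributed on $\mathbb B_p^n$ (distribution $\mathbf U_{n,p}$). Let $z>m_{p,q}$ be such that $z^*=(z^q,1)\in\mathcal J_p$. Then $$\mathbb P\left(n^{1/p-1/q}\|\mathscr Z^{(n)}\|_q>z\right)=\frac{1}{\sqrt{2\pi n}\,\gamma(z)}\,e^{-n\Lambda_p^*(z^* )}\,(1+o(1))\qquad(n\to\infty),$$ where $o(1)$ denotes a sequence tending to $0$ as $n\to\infty$ and $\gamma(z)>0$ is given by $$\gamma(z)^2=\det\mathfrak H_{z^*}\,\tau(z^* )_1^2\,\big(qz^q\tau(z^* )_1+1\big)^2\Big[\tfrac{z^{2q}q^2}{p^2}(\mathfrak H_{z^*}^{-1})_{11}+\tfrac{2z^qq}{p}(\mathfrak H_{z^*}^{-1})_{12}+(\mathfrak H_{z^*}^{-1})_{22}+\tau(z^* )_1\tfrac{z^qq(q-p)}{p^2}\Big].$$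
   Context: For $x\in\mathbb R^n$, $\|x\|_r=(\sum_i|x_i|^r)^{1/r}$ for $1\le r<\infty$; $\mathbb B_p^n=\{x:\|x\|_p\le1\}$ and $\mathbf U_{n,p}(\cdot)=\mathrm{vol}_n(\cdot)/\mathrm{vol}_n(\mathbb B_p^n)$. Let $f_p(x)=\frac{1}{2p^{1/p}\Gamma(1+1/p)}e^{-|x|^p/p}$, $M_p(r)=\int_{\mathbb R}|x|^rf_p(x)\,dx$, $m_{p,q}=M_p(q)^{1/q}$. For $\tau\in\mathbb R^2$, $\Lambda_p(\tau)=\log\int_{\mathbb R}e^{\tau_1|y|^q+\tau_2|y|^p}f_p(y)\,dy$, finite exactly on $\mathcal D_p=\mathbb R\times(-\infty,1/p)$; $\Lambda_p^*(x)=\sup_{\tau\in\mathbb R^2}(\langle x,\tau\rangle-\Lambda_p(\tau))$. $\mathcal J_p$ is the set of $x\in\mathbb R^2$ for which there exists $\tau(x)\in\mathcal D_p$ with $\nabla_\tau\Lambda_p(\tau(x))=x$ (such $\tau(x)$ is unique). For $x\in\mathcal J_p$, $\mathfrak H_x$ is the Hessian of $\Lambda_p$ at $\tau(x)$ (positive definite). For $z>0$, $z^*:=(z^q,1)$. *)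

(* Defs.v *)
From HB Require Import structures.
From mathcomp Require Import all_boot all_order all_algebra.
From mathcomp Require Import all_classical all_reals all_analysis.
Set Implicit Arguments. Unset Strict Implicit. Unset Printing Implicit Defensive.
Import Order.TTheory GRing.Theory Num.Theory.
Import numFieldNormedType.Exports.
Local Open Scope classical_set_scope.
Local Open Scope ring_scope.

Section Defs.
Variable R : realType.

Fixpoint iint (n : nat) : (n.-tuple R -> \bar R) -> \bar R :=
  match n return (n.-tuple R -> \bar R) -> \bar R with
  | 0 => fun g => g [tuple]
  | n'.+1 => fun g =>
      (\int[@lebesgue_measure R]_(x in [set: R])
          iint (fun t : n'.-tuple R => g [tuple of x :: t]))%E
  end.

Definition vol (n : nat) (A : set (n.-tuple R)) : \bar R :=
  iint (fun x => (\1_A x)%:E).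

Definition lnorm (n : nat) (r : R) (x : n.-tuple R) : R :=
  (\sum_(i < n) `|tnth x i| `^ r) `^ r^-1.

Definition lball (n : nat) (p : R) : set (n.-tuple R) :=
  [set x | lnorm p x <= 1].

Definition Unif (n : nat) (p : R) (A : set (n.-tuple R)) : R :=
  fine (vol (A `&` @lball n p)) / fine (vol (@lball n p)).

Definition Gamma (s : R) : R :=
  Rintegral (@lebesgue_measure R) `]0, +oo[ (fun t => t `^ (s - 1) * expR (- t)).

Definition f_p (p : R) (x : R) : R :=
  (2 * p `^ p^-1 * Gamma (1 + p^-1))^-1 * expR (- (`|x| `^ p / p)).

Definition M_p (p r : R) : R :=
  Rintegral (@lebesgue_measure R) [set: R] (fun x => `|x| `^ r * f_p p x).

Definition m_pq (p q : R) : R := M_p p q `^ q^-1.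

(* points of R^2 are row vectors 'rV[R]_2; coordinate 1 is index ord0,
   coordinate 2 is index 1 *)
Definition c1 (v : 'rV[R]_2) : R := v ord0 ord0.
Definition c2 (v : 'rV[R]_2) : R := v ord0 (lift ord0 ord0).

Definition Lambda_p (p q : R) (tau : 'rV[R]_2) : \bar R :=
  let I := (\int[@lebesgue_measure R]_(y in [set: R])
              (expR (c1 tau * `|y| `^ q + c2 tau * `|y| `^ p) * f_p p y)%:E)%E in
  if I == +oo%E then +oo%E else (ln (fine I))%:E.

Definition D_p (p : R) : set ('rV[R]_2) := [set tau | c2 tau < p^-1].

Definition LambdaStar (p q : R) (x : 'rV[R]_2) : \bar R :=
  ereal_sup [set ((c1 x * c1 tau + c2 x * c2 tau)%:E - Lambda_p p q tau)%E
            | tau in [set: 'rV[R]_2]].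

(* real-valued version of Lambda_p (its value on D_p, where it is finite) *)
Definition LamR (p q : R) (tau : 'rV[R]_2) : R := fine (Lambda_p p q tau).

Definition partial (i : 'I_2) (F : 'rV[R]_2 -> R) (tau : 'rV[R]_2) : R :=
  derive F tau (delta_mx ord0 i).

Definition grad (F : 'rV[R]_2 -> R) (tau : 'rV[R]_2) : 'rV[R]_2 :=
  \row_(i < 2) partial i F tau.

Definition hessian (F : 'rV[R]_2 -> R) (tau : 'rV[R]_2) : 'M[R]_2 :=
  \matrix_(i < 2, j < 2) partial i (partial j F) tau.

Definition J_p (p q : R) (x : 'rV[R]_2) : Prop :=
  exists2 tau, D_p p tau & grad (LamR p q) tau = x.

Definition zstar (q z : R) : 'rV[R]_2 :=
  \row_(i < 2) (if i == ord0 then z `^ q else 1).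

(* gamma(z), given tau = tau(z^star) and H = H_(z^star) *)
Definition gamma_z (p q z : R) (tau : 'rV[R]_2) : R :=
  let H := hessian (LamR p q) tau in
  let Hi := invmx H in
  let t1 := c1 tau in
  let zq := z `^ q in
  Num.sqrt (\det H * t1 ^+ 2 * (q * zq * t1 + 1) ^+ 2 *
    (zq ^+ 2 * q ^+ 2 / p ^+ 2 * Hi ord0 ord0
     + 2 * zq * q / p * Hi ord0 (lift ord0 ord0)
     + Hi (lift ord0 ord0) (lift ord0 ord0)
     + t1 * (zq * q * (q - p) / p ^+ 2))).

End Defs.

(* Main.v *)
Require Import Defs.
From HB Require Import structures.
From mathcomp Require Import all_boot all_order all_algebra.
From mathcomp Require Import all_classical all_reals all_analysis.
From mathcomp Require Import measurable_realfun ring lra.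
Import Order.TTheory GRing.Theory Num.Theory.
Import numFieldNormedType.Exports.
Local Open Scope classical_set_scope.
Local Open Scope ring_scope.

(**
  After scaling the balls by [n^(1/p)], a change of measure writes the tail
  probability as [exp (- n LambdaStar) * W n / V n], where [W n] is a mean over an
  i.i.d. sample of the Gibbs density proportional to [exp (t |y|^q - s |y|^p)],
  with [t = tau_1 > 0] and [s = 1/p - tau_2 > 0].  By the equation for [tau] the
  random walk with steps [(|y|^q - z^q, 1 - |y|^p)] is centered, and [W n] is the
  mean of an exponentially weighted quadrant indicator of its position.  [V n] is
  the one-dimensional analogue for [t = 0], [s = 1/p], and its square is a mean of
  the same kind for a product law.

  Both asymptotics come from a planar local limit theorem.  The step law has no
  density in the plane but is nonlattice, and the weighted indicator is squeezed
  between multiples of its convolutions with a product of Fejer kernels; as their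
  Fourier transforms have compact support, it suffices to control the
  characteristic function of the step law on compact sets.

  Finally, scaling [y] in the moments of the Gibbs weight gives linear relations
  between the Hessian and [(t, s)], and by these the bracket in [gamma] becomes
  simple enough to match the limit of [sqrt n * W n / V n].
*)

Set Implicit Arguments.
Unset Strict Implicit.
Unset Printing Implicit Defensive.

(** The steps lie on the curve [y -> (|y|^q - z^q, 1 - |y|^p)], so the plane sees no density, and
    the argument never asks for decay of the characteristic function at infinity. The weighted
    indicator is discontinuous and cannot be compared pointwise with its smoothing. The squeeze
    rests on a one-sided property instead: moving a point by [u] further into the quadrant costs at
    most a factor [exp (- g (u_1 + u_2))]. Centering the smoothing at [(-e, -e)] or at [(e, e)]
    turns this single inequality into a bound on either side. The assumption [z > m_pq] enters
    through [t > 0], which keeps the weight bounded on the quadrant. Squaring [V n] lets the planar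
    theorem serve the one-dimensional problem too: two independent copies of the walk form a planar
    walk with diagonal covariance. In [gamma], the scaling relations say that the Hessian maps
    [(- q t, p s)] to [(q z^q, p)]. The quadratic form of the inverse Hessian at [(q z^q, p)] is
    therefore explicit, the bracket equals [1/p], and [gamma = t s sqrt (p det H)]. *)

Lemma bounded_integrable d (T : measurableType d) (R : realType)
  (P : probability T R) (f : T -> R) (M : R) :
  measurable_fun setT f -> (forall x, `|f x| <= M) ->
  P.-integrable setT (EFin \o f).
Proof.
move=> mf bf; apply: (@measurable_bounded_integrable _ _ _ P f setT) => //.
  by apply: (le_lt_trans (probability_le1 P measurableT)); rewrite ltry.
by exists M; split; [exact: num_real|move=> x Mx y _; exact: le_trans (bf y) (ltW Mx)].
Qed.

Section integrable_real.
Context d (T : measurableType d) (R : realType) (mu : {measure set T -> \bar R}).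
Implicit Types (f g : T -> R) (k : R).

Lemma integrableRZl k f : mu.-integrable setT (EFin \o f) ->
  mu.-integrable setT (EFin \o (fun x => k * f x)).
Proof.
move=> fi; have := integrableZl measurableT k fi.
by apply: eq_integrable => // x _; rewrite /= EFinM.
Qed.

Lemma integrableRZr k f : mu.-integrable setT (EFin \o f) ->
  mu.-integrable setT (EFin \o (fun x => f x * k)).
Proof.
by move=> /(integrableRZl k); apply: eq_integrable => // x _; rewrite /= mulrC.
Qed.

Lemma integrableRD f g : mu.-integrable setT (EFin \o f) ->
  mu.-integrable setT (EFin \o g) ->
  mu.-integrable setT (EFin \o (fun x => f x + g x)).
Proof.
move=> fi gi; have := integrableD measurableT fi gi.
by apply: eq_integrable => // x _; rewrite /= EFinD.
Qed.

Lemma integrableRB f g : mu.-integrable setT (EFin \o f) ->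
  mu.-integrable setT (EFin \o g) ->
  mu.-integrable setT (EFin \o (fun x => f x - g x)).
Proof.
move=> fi gi; have := integrableB measurableT fi gi.
by apply: eq_integrable => // x _; rewrite /= EFinB.
Qed.

Lemma le_integrableR f g : measurable_fun setT f -> (forall x, `|f x| <= g x) ->
  mu.-integrable setT (EFin \o g) -> mu.-integrable setT (EFin \o f).
Proof.
move=> mf fg; apply: le_integrable => //; first exact/measurable_EFinP.
by move=> x _; rewrite /= lee_fin (le_trans (fg x))// ler_norm.
Qed.

End integrable_real.

Lemma EFin_Rintegral d (T : measurableType d) (R : realType)
  (mu : {measure set T -> \bar R}) (D : set T) (f : T -> R) :
  measurable D -> mu.-integrable D (EFin \o f) ->
  (\int[mu]_(x in D) (f x)%:E)%E = (\int[mu]_(x in D) f x)%:E.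
Proof. by move=> mD fi; rewrite /Rintegral fineK// integrable_fin_num. Qed.

(** * Measures given by a density *)

Section density.
Context d (T : measurableType d) (R : realType).
Variables (mu : {measure set T -> \bar R}) (g : T -> R).

(** The two proofs are arguments so that the measure structure, which depends on them, can be
    attached to the constant. *)
Definition density of (forall x, 0 <= g x) & measurable_fun setT g :=
  fun A : set T => (\int[mu]_(x in A) (g x)%:E)%E.

Hypothesis g0 : forall x, 0 <= g x.
Hypothesis mg : measurable_fun setT g.
Local Notation dg := (density g0 mg).

Let dg0 : dg set0 = 0%E.
Proof. by rewrite /density integral_set0. Qed.

Let dg_ge0 A : (0 <= dg A)%E.
Proof. by rewrite /density integral_ge0// => x _; rewrite lee_fin. Qed.

Let dg_sigma : semi_sigma_additive dg.
Proof.
move=> /= A mA tA mUA.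
rewrite /density/= ge0_integral_bigcup//=.
- apply: is_cvg_ereal_nneg_natsum_cond => n _ _.
  by apply: integral_ge0 => /= x ?; rewrite lee_fin.
- by apply/measurable_EFinP; apply: measurable_funTS.
- by move=> x _; rewrite lee_fin.
Qed.

HB.instance Definition _ := isMeasure.Build _ _ _ dg dg0 dg_ge0 dg_sigma.

Import HBNNSimple.

(** Both sides commute with increasing limits and with finite sums over the range of a simple
    function, which reduces the claim to indicators, where it is the definition of [density]. *)
Lemma ge0_integral_density (f : T -> \bar R) :
  measurable_fun setT f -> (forall x, 0 <= f x)%E ->
  (\int[dg]_x f x = \int[mu]_x (f x * (g x)%:E))%E.
Proof.
move=> mf f0.
pose f_ := nnsfun_approx measurableT mf.
have f0' : forall x, setT x -> (0 <= f x)%E by move=> x _.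
have mgE : measurable_fun setT (EFin \o g) by exact/measurable_EFinP.
have cf x : (f_ n x)%:E @[n --> \oo] --> f x by exact: cvg_nnsfun_approx.
transitivity (limn (fun n => \int[dg]_x (f_ n x)%:E)%E).
  rewrite -monotone_convergence//.
  - by apply: eq_integral => y _; apply/esym/cvg_lim => //; exact: cf.
  - by move=> n; exact/measurable_EFinP/measurable_funP.
  - by move=> n y _; rewrite lee_fin.
  - by move=> y _ m n mn; rewrite lee_fin; exact/lefP/nd_nnsfun_approx.
transitivity (limn (fun n => \int[mu]_x ((f_ n x)%:E * (g x)%:E))%E); last first.
  rewrite -monotone_convergence//.
  - apply: eq_integral => y _; apply/cvg_lim => //.
    by apply: cvgeZr => //; exact: cf.
  - by move=> n; apply: emeasurable_funM => //; exact/measurable_EFinP/measurable_funP.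
  - by move=> n y _; rewrite mule_ge0// lee_fin.
  - move=> y _ m n mn; apply: lee_wpmul2r; rewrite ?lee_fin//.
    by exact/lefP/nd_nnsfun_approx.
congr (limn _); apply/funext => n.
transitivity (\sum_(k \in range (f_ n))
    \int[dg]_x (k * \1_(f_ n @^-1` [set k]) x)%:E)%E.
  under eq_integral do rewrite fimfunE -fsumEFin//.
  rewrite ge0_integral_fsum//.
  - by move=> y; exact/measurable_EFinP/measurable_funM.
  - by move=> y x _; rewrite EFinM nnfun_muleindic_ge0.
transitivity (\sum_(k \in range (f_ n))
    \int[mu]_x ((k * \1_(f_ n @^-1` [set k]) x)%:E * (g x)%:E))%E; last first.
  rewrite -ge0_integral_fsum//.
  - apply: eq_integral => x _; rewrite [in RHS]fimfunE -fsumEFin//.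
    rewrite ge0_mule_fsuml// => y.
    by rewrite EFinM nnfun_muleindic_ge0.
  - move=> y; apply: emeasurable_funM => //.
    exact/measurable_EFinP/measurable_funM.
  - by move=> y x _; apply: mule_ge0; rewrite ?lee_fin// -lee_fin EFinM nnfun_muleindic_ge0.
apply: eq_fsbigr => r _; rewrite integralZl_indic_nnsfun// integral_indic//= setIT.
have [r0|r0] := ltP r 0.
  rewrite preimage_nnfun0// measure0 mule0.
  by rewrite integral0_eq// => x _; rewrite indic0 mulr0 mul0e.
under eq_integral do rewrite EFinM -muleA.
rewrite ge0_integralZl_EFin//.
- congr *%E.
  rewrite /density [LHS]integral_mkcond; apply: eq_integral => x _.
  by rewrite /patch indicE; case: ifPn; rewrite ?mul1e ?mul0e.
- by move=> x _; rewrite mule_ge0 ?lee_fin.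
- apply: emeasurable_funM => //; exact/measurable_EFinP.
Qed.

Lemma integral_density (f : T -> R) :
  measurable_fun setT f ->
  mu.-integrable setT (fun x => (f x * g x)%:E) ->
  (dg.-integrable setT (EFin \o f) /\
   \int[dg]_x (f x)%:E = \int[mu]_x (f x * g x)%:E)%E.
Proof.
move=> mf fi.
have mfE : measurable_fun setT (EFin \o f) by exact/measurable_EFinP.
split.
  apply/integrableP; split => //.
  rewrite ge0_integral_density//; last by exact: measurableT_comp.
  have /integrableP[_] := fi; congr (_ < _)%E.
  by apply: eq_integral => x _; rewrite /= normrM (ger0_norm (g0 x)) EFinM.
rewrite [LHS]integralE [RHS]integralE.
rewrite ge0_integral_density//; last exact: measurable_funepos.
rewrite ge0_integral_density//; last exact: measurable_funeneg.
congr (_ - _)%E; apply: eq_integral => x _; rewrite /= ?funeposE ?funenegE.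
- by rewrite -!EFin_max -EFinM maxr_pMl// mul0r.
- by rewrite -!EFinN -!EFin_max -EFinM maxr_pMl// mul0r mulNr.
Qed.

End density.

(** * Sums of independent pairs and their characteristic functions *)

Section sumlaw.
Context d (T : measurableType d) (R : realType) (P : probability T R).
Variables (X1 X2 : T -> R).
Hypotheses (mX1 : measurable_fun setT X1) (mX2 : measurable_fun setT X2).

Definition addX (z : (R * R) * T) : R * R := (z.1.1 + X1 z.2, z.1.2 + X2 z.2).

Lemma measurable_addX : measurable_fun setT addX.
Proof.
apply: measurable_fun_pair; apply: measurable_funD.
- by apply: measurableT_comp.
- by apply: measurableT_comp.
- by apply: measurableT_comp.
- by apply: measurableT_comp.
Qed.

HB.instance Definition _ := isMeasurableFun.Build _ _ _ _ addX measurable_addX.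

(** The law of a sum of [n] independent copies of [(X1, X2)], built one convolution at a time. No
    n-fold product space is formed, and the recursion is parallel to that of [iint]. *)
Fixpoint sumlaw (n : nat) : probability (R * R)%type R :=
  match n with
  | 0 => dirac ((0, 0) : R * R)
  | n'.+1 => distribution (sumlaw n' \x P)%E addX
  end.

End sumlaw.

Section char_power.
Context {R : realType}.
Variables (c s : R) (C S : nat -> R).
Hypotheses (C0 : C 0%N = 1) (S0 : S 0%N = 0).
Hypothesis Crec : forall n, C n.+1 = C n * c - S n * s.
Hypothesis Srec : forall n, S n.+1 = S n * c + C n * s.

(** The recursions are those of the real and imaginary parts of [(c + i s)^n], so this is
    multiplicativity of the squared modulus. *)
Lemma char_power_sqr n : C n ^+ 2 + S n ^+ 2 = (c ^+ 2 + s ^+ 2) ^+ n.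
Proof.
elim: n => [|n IH]; first by rewrite C0 S0 expr0; ring.
by rewrite Crec Srec [RHS]exprS -IH; ring.
Qed.

(** One more multiplication by [c + i s] enlarges the old error by at most [|c| + |s| <= 1 + |s|]
    and creates a new one of at most [|c - p| + |s|]; the bound sums these contributions. *)
Lemma char_power_dist (p : R) n : `|c| <= 1 -> 0 <= p -> p <= 1 ->
  `|C n - p ^+ n| + `|S n| <= n%:R * (`|c - p| + `|s|) * (1 + `|s|) ^+ n.
Proof.
move=> c1 p0 p1; elim: n => [|n IH].
  by rewrite C0 S0 expr0 subrr normr0 addr0 !mul0r.
set e := `|c - p| + `|s|.
have e0 : 0 <= e by rewrite addr_ge0.
set E := `|C n - p ^+ n| + `|S n|.
have E0 : 0 <= E by rewrite addr_ge0.
have pn0 : 0 <= p ^+ n by rewrite exprn_ge0.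
have pn1 : p ^+ n <= 1 by rewrite exprn_ile1.
have h1 : `|C n.+1 - p ^+ n.+1| <=
    `|C n - p ^+ n| * `|c| + p ^+ n * `|c - p| + `|S n| * `|s|.
  have -> : C n.+1 - p ^+ n.+1 =
    (C n - p ^+ n) * c + p ^+ n * (c - p) - S n * s by rewrite Crec exprS; ring.
  rewrite (le_trans (ler_normB _ _))// normrM lerD2r (le_trans (ler_normD _ _))//.
  by rewrite !normrM (ger0_norm pn0).
have h2 : `|S n.+1| <= `|S n| * `|c| + `|C n - p ^+ n| * `|s| + p ^+ n * `|s|.
  have -> : S n.+1 = S n * c + (C n - p ^+ n) * s + p ^+ n * s by rewrite Srec; ring.
  rewrite (le_trans (ler_normD _ _))// (normrM (p ^+ n)) (ger0_norm pn0) lerD2r.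
  by rewrite (le_trans (ler_normD _ _))// !normrM.
have h3 : `|C n.+1 - p ^+ n.+1| + `|S n.+1| <= (1 + `|s|) * E + e.
  apply: (le_trans (lerD h1 h2)).
  have : E * `|c| <= E by rewrite ler_piMr.
  have : p ^+ n * e <= e by rewrite ler_piMl.
  by rewrite /E /e; lra.
apply: (le_trans h3).
have s1 : 1 <= 1 + `|s| by rewrite lerDl.
have s11 : 1 <= (1 + `|s|) ^+ n.+1 by rewrite exprn_ege1.
have h4 : (1 + `|s|) * E <= n%:R * e * (1 + `|s|) ^+ n.+1.
  by rewrite exprS [leRHS]mulrCA ler_wpM2l// (le_trans _ s1).
have h5 : e <= e * (1 + `|s|) ^+ n.+1 by rewrite ler_peMr.
by rewrite -natr1; nra.
Qed.

End char_power.

Section sumlaw_theory.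
Context d (T : measurableType d) (R : realType) (P : probability T R).
Variables (X1 X2 : T -> R).
Hypotheses (mX1 : measurable_fun setT X1) (mX2 : measurable_fun setT X2).
Local Notation nu := (sumlaw P mX1 mX2).

Lemma ge0_integral_sumlaw0 (F : R * R -> \bar R) : measurable_fun setT F ->
  (\int[nu 0]_s F s = F (0%R, 0%R))%E.
Proof. by move=> mF; rewrite integral_dirac// diracT mul1e. Qed.

Lemma ge0_integral_sumlawS n (F : R * R -> \bar R) : measurable_fun setT F ->
  (forall s, 0 <= F s)%E ->
  (\int[nu n.+1]_s F s =
   \int[P]_y \int[nu n]_s F (s.1 + X1 y, s.2 + X2 y)%R)%E.
Proof.
move=> mF F0.
rewrite ge0_integral_distribution//.
have mFa : measurable_fun setT (F \o addX X1 X2).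
  by apply: measurableT_comp => //; exact: measurable_addX.
exact: (@fubini_tonelli2 _ _ _ _ _ (nu n) P _ mFa (fun x => F0 _)).
Qed.

(** Characteristic functions are carried as pairs of real integrals: [charC], [charS] for the n-step
    law, [char1C], [char1S] for a single step. *)
Definition charC n (u v : R) := (\int[nu n]_s cos (u * s.1 + v * s.2))%R.
Definition charS n (u v : R) := (\int[nu n]_s sin (u * s.1 + v * s.2))%R.
Definition char1C (u v : R) := (\int[P]_y cos (u * X1 y + v * X2 y))%R.
Definition char1S (u v : R) := (\int[P]_y sin (u * X1 y + v * X2 y))%R.

Let mlin u v : measurable_fun setT (fun s : R * R => u * s.1 + v * s.2).
Proof.
by apply: measurable_funD; apply: measurable_funM => //.
Qed.

Let mlinX u v : measurable_fun setT (fun y => u * X1 y + v * X2 y).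
Proof.
by apply: measurable_funD; apply: measurable_funM => //.
Qed.

Let mcos : measurable_fun setT (@cos R).
Proof. exact: continuous_measurable_fun (@continuous_cos R). Qed.
Let msin : measurable_fun setT (@sin R).
Proof. exact: continuous_measurable_fun (@continuous_sin R). Qed.

Lemma integrable_cos d' (T' : measurableType d') (Q : probability T' R) (f : T' -> R) :
  measurable_fun setT f -> Q.-integrable setT (EFin \o (fun x => cos (f x))).
Proof.
move=> mf; apply: (@bounded_integrable _ _ _ _ _ 1).
  exact: measurableT_comp.
by move=> x; rewrite ler_norml cos_geN1 cos_le1.
Qed.

Lemma integrable_sin d' (T' : measurableType d') (Q : probability T' R) (f : T' -> R) :
  measurable_fun setT f -> Q.-integrable setT (EFin \o (fun x => sin (f x))).
Proof.
move=> mf; apply: (@bounded_integrable _ _ _ _ _ 1).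
  exact: measurableT_comp.
by move=> x; rewrite ler_norml sin_geN1 sin_le1.
Qed.

Lemma char0 u v : charC 0 u v = 1 /\ charS 0 u v = 0.
Proof.
rewrite /charC /charS /Rintegral; split.
  rewrite integral_dirac//; last by apply/measurable_EFinP; exact: measurableT_comp.
  by rewrite diracT mul1e /= !mulr0 addr0 cos0.
rewrite integral_dirac//; last by apply/measurable_EFinP; exact: measurableT_comp.
by rewrite diracT mul1e /= !mulr0 addr0 sin0.
Qed.

Lemma Rintegral_cosD (a u v : R) :
  (\int[P]_y cos (a + (u * X1 y + v * X2 y)))%R =
  cos a * char1C u v - sin a * char1S u v.
Proof.
under eq_Rintegral do rewrite cosD.
rewrite RintegralB//.
- rewrite !RintegralZl//; [exact: integrable_sin|exact: integrable_cos].
- by apply: (integrableRZl (cos a)); exact: integrable_cos.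
- by apply: (integrableRZl (sin a)); exact: integrable_sin.
Qed.

Lemma Rintegral_sinD (a u v : R) :
  (\int[P]_y sin (a + (u * X1 y + v * X2 y)))%R =
  sin a * char1C u v + cos a * char1S u v.
Proof.
under eq_Rintegral do rewrite sinD.
rewrite RintegralD//.
- rewrite !RintegralZl//; [exact: integrable_sin|exact: integrable_cos].
- by apply: (integrableRZl (sin a)); exact: integrable_cos.
- by apply: (integrableRZl (cos a)); exact: integrable_sin.
Qed.

Lemma Rintegral_sumlawS n (f : R -> R) (u v : R) : measurable_fun setT f ->
  (forall x, `|f x| <= 1) ->
  (\int[nu n.+1]_s f (u * s.1 + v * s.2))%R =
  (\int[nu n]_s (\int[P]_y f ((u * s.1 + v * s.2) + (u * X1 y + v * X2 y))))%R.
Proof.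
move=> mf f1.
have mF : measurable_fun setT (fun s : R * R => (f (u * s.1 + v * s.2))%:E).
  by apply/measurable_EFinP; exact: measurableT_comp.
pose G := fun z : (R * R) * T => (f (u * (z.1.1 + X1 z.2) + v * (z.1.2 + X2 z.2)))%:E.
have mG : measurable_fun setT (fun z : (R * R) * T =>
    f (u * (z.1.1 + X1 z.2) + v * (z.1.2 + X2 z.2))).
  apply: measurableT_comp => //.
  by apply: measurable_funD; apply: measurable_funM => //;
    apply: measurable_funD; apply: measurableT_comp.
have iG : (nu n \x P)%E.-integrable setT G.
  exact: (@bounded_integrable _ _ _ _ _ 1).
rewrite /Rintegral; congr fine.
rewrite integral_distribution//.
rewrite -(integral12_prod_meas1 (f := G)) /=; last exact: iG.
apply: eq_integral => s _.
rewrite /fubini_F /= EFin_Rintegral//.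
  by congr EFin; apply: eq_Rintegral => y _; congr f; ring.
apply: (@bounded_integrable _ _ _ _ _ 1) => //.
by apply: measurableT_comp => //; apply: measurable_funD => //;
  apply: measurable_funM => //; apply: measurable_funD.
Qed.

Lemma charCS n u v :
  charC n.+1 u v = charC n u v * char1C u v - charS n u v * char1S u v.
Proof.
rewrite /charC Rintegral_sumlawS//; last first.
  by move=> x; rewrite ler_norml cos_geN1 cos_le1.
under eq_Rintegral do rewrite Rintegral_cosD.
rewrite RintegralB//.
- rewrite !RintegralZr//; [exact: integrable_sin|exact: integrable_cos].
- by apply: (integrableRZr (char1C u v)); exact: integrable_cos.
- by apply: (integrableRZr (char1S u v)); exact: integrable_sin.
Qed.

Lemma charSS n u v :
  charS n.+1 u v = charS n u v * char1C u v + charC n u v * char1S u v.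
Proof.
rewrite /charS Rintegral_sumlawS//; last first.
  by move=> x; rewrite ler_norml sin_geN1 sin_le1.
under eq_Rintegral do rewrite Rintegral_sinD.
rewrite RintegralD//.
- rewrite !RintegralZr//; [exact: integrable_cos|exact: integrable_sin].
- by apply: (integrableRZr (char1C u v)); exact: integrable_sin.
- by apply: (integrableRZr (char1S u v)); exact: integrable_cos.
Qed.

Lemma char_sqr n u v : charC n u v ^+ 2 + charS n u v ^+ 2 =
  (char1C u v ^+ 2 + char1S u v ^+ 2) ^+ n.
Proof.
have [c0 s0] := char0 u v.
exact: (char_power_sqr c0 s0 (fun n => charCS n u v) (fun n => charSS n u v)).
Qed.

Lemma char_dist n u v (p : R) : 0 <= p -> p <= 1 ->
  `|charC n u v - p ^+ n| + `|charS n u v| <=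
  n%:R * (`|char1C u v - p| + `|char1S u v|) * (1 + `|char1S u v|) ^+ n.
Proof.
move=> p0 p1; have [c0 s0] := char0 u v.
apply: (char_power_dist c0 s0 (fun n => charCS n u v) (fun n => charSS n u v)) => //.
have ic := integrable_cos P (mlinX u v).
apply: (le_trans (le_normr_Rintegral measurableT ic)).
rewrite -[leRHS](_ : (\int[P]_x cst 1 x)%R = 1); last first.
  by rewrite Rintegral_cst//= probability_setT mulr1.
apply: le_Rintegral => //; first exact: (integrable_norm ic).
- by apply: (@bounded_integrable _ _ _ _ _ 1) => // x; rewrite normr1.
- by move=> x _; rewrite ler_norml cos_geN1 cos_le1.
Qed.

End sumlaw_theory.

(** * Derivatives and Taylor bounds on the line *)

Section pointwise_derive.
Context {R : realType}.
Implicit Types (f g : R -> R) (x k df dg : R).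

(** Stated on functions written as [fun y => ...], these rules compose as terms, and [is_derive_eq]
    then leaves only an algebraic identity between the two forms of the derivative. *)
Lemma is_derive_funD f g x df dg : is_derive x 1 f df -> is_derive x 1 g dg ->
  is_derive x 1 (fun y => f y + g y) (df + dg).
Proof. exact: is_deriveD. Qed.

Lemma is_derive_funB f g x df dg : is_derive x 1 f df -> is_derive x 1 g dg ->
  is_derive x 1 (fun y => f y - g y) (df - dg).
Proof. exact: is_deriveB. Qed.

Lemma is_derive_funM f g x df dg : is_derive x 1 f df -> is_derive x 1 g dg ->
  is_derive x 1 (fun y => f y * g y) (df * g x + f x * dg).
Proof.
move=> hf hg; apply: (is_derive_eq (is_deriveM hf hg)).
by rewrite addrC /GRing.scale/= [g x * _]mulrC.
Qed.

Lemma is_derive_funX n x : is_derive x 1 (fun y : R => y ^+ n) (n%:R * x ^+ n.-1).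
Proof.
have -> : (fun y : R => y ^+ n) = (id : R -> R) ^+ n.
  by apply/funext => y; rewrite exprfctE.
apply: (is_derive_eq (is_deriveX n (is_derive_id x (1 : R)))).
by rewrite /GRing.scale/= mulr1.
Qed.

Lemma is_derive_funV f x df : f x != 0 -> is_derive x 1 f df ->
  is_derive x 1 (fun y => (f y)^-1) (- df / f x ^+ 2).
Proof.
move=> fx0 hf; have dV := @derivableV R R f x 1 fx0 (@ex_derive _ _ _ _ _ _ _ hf).
apply: DeriveDef; first exact: dV.
rewrite (deriveV fx0 (@ex_derive _ _ _ _ _ _ _ hf)) (@derive_val _ _ _ _ _ _ _ hf).
by rewrite /GRing.scale/= !mulNr mulrC.
Qed.

Lemma is_derive_fun_comp f g x df dg : is_derive (g x) 1 f df ->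
  is_derive x 1 g dg -> is_derive x 1 (fun y => f (g y)) (df * dg).
Proof.
by move=> hf hg; apply: (is_derive_eq (@is_derive1_comp R f g x df dg hf hg)).
Qed.

End pointwise_derive.

Section taylor.
Context {R : realType}.
Implicit Types x : R.

(** Mean value theorem. It is iterated below: starting from [cos <= 1], each Taylor bound is the
    sign of the derivative needed for the next one. *)
Lemma ge0_of_derive (f df : R -> R) : f 0 = 0 ->
  (forall x, is_derive x 1 f (df x)) -> (forall x, 0 <= x -> 0 <= df x) ->
  forall x, 0 <= x -> 0 <= f x.
Proof.
move=> f0 fd df0 x x0.
have [c + e] := @MVT_segment _ f df 0 x x0 (fun y _ => fd y)
  (derivable_within_continuous (fun y _ => @ex_derive _ _ _ _ _ _ _ (fd y))).
rewrite in_itv/= => /andP[c0 _]; move: e.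
by rewrite f0 !subr0 => ->; rewrite mulr_ge0// df0.
Qed.

Lemma sin_le_id x : 0 <= x -> 0 <= x - sin x.
Proof.
apply: (@ge0_of_derive (fun x => x - sin x) (fun x => 1 - cos x)).
- by rewrite sin0 subrr.
- by move=> y _; rewrite subr_ge0 cos_le1.
Qed.

Let is_derive_mono n k x : is_derive x 1 (fun y => y ^+ n * k) (n%:R * x ^+ n.-1 * k).
Proof.
refine (is_derive_eq (is_derive_funM (is_derive_funX n x) (is_derive_cst k x 1)) _).
by rewrite mulr0 addr0.
Qed.

Lemma cos_ge_quad x : 0 <= x -> 0 <= cos x - 1 + x ^+ 2 / 2.
Proof.
apply: (@ge0_of_derive (fun x => cos x - 1 + x ^+ 2 / 2) (fun x => x - sin x)).
- by rewrite cos0 expr0n/=; lra.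
- move=> y; refine (is_derive_eq
    (is_derive_funD (is_derive_funB _ _) (is_derive_mono _ _ y)) _).
  by rewrite /=; lra.
- exact: sin_le_id.
Qed.

Lemma sin_ge_cubic x : 0 <= x -> 0 <= sin x - x + x ^+ 3 / 6.
Proof.
apply: (@ge0_of_derive (fun x => sin x - x + x ^+ 3 / 6)
  (fun x => cos x - 1 + x ^+ 2 / 2)).
- by rewrite sin0 expr0n/=; lra.
- move=> y; refine (is_derive_eq
    (is_derive_funD (is_derive_funB _ _) (is_derive_mono _ _ y)) _).
  by rewrite /=; lra.
- exact: cos_ge_quad.
Qed.

Lemma cos_le_quartic x : 0 <= x -> 0 <= 1 - x ^+ 2 / 2 + x ^+ 4 / 24 - cos x.
Proof.
apply: (@ge0_of_derive (fun x => 1 - x ^+ 2 / 2 + x ^+ 4 / 24 - cos x)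
  (fun x => sin x - x + x ^+ 3 / 6)).
- by rewrite cos0 !expr0n/=; lra.
- move=> y; refine (is_derive_eq (is_derive_funB (is_derive_funD
    (is_derive_funB _ (is_derive_mono _ _ y)) (is_derive_mono _ _ y)) _) _).
  by rewrite /=; lra.
- exact: sin_ge_cubic.
Qed.

(** The remainder is stated with a cube because the steps are only assumed to have third moments.
    Below 1 the quartic bound is stronger than a cubic one; above 1 the crude [cos x <= 1] leaves
    [x^2 / 2], which is below [x^3]. *)
Lemma norm_cos_taylor x : `|cos x - (1 - x ^+ 2 / 2)| <= `|x| ^+ 3.
Proof.
have h (y : R) : 0 <= y -> `|cos y - (1 - y ^+ 2 / 2)| <= y ^+ 3.
  move=> y0; have h1 := cos_ge_quad y0; have h2 := cos_le_quartic y0.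
  have h3 := cos_le1 y.
  rewrite ger0_norm; last by lra.
  have [y1|/ltW y1] := leP y 1.
    have y3 : 0 <= y ^+ 3 by rewrite exprn_ge0.
    have : y ^+ 4 <= y ^+ 3 by rewrite exprS ler_piMl.
    lra.
  have y2 : 0 <= y ^+ 2 by rewrite exprn_ge0.
  have : y ^+ 2 <= y ^+ 3 by rewrite exprS ler_peMl.
  lra.
have [x0|x0] := leP 0 x; first by rewrite (ger0_norm x0) h.
by have := h (- x); rewrite cosN sqrrN (ltr0_norm x0); apply; lra.
Qed.

Lemma norm_sin_taylor x : `|sin x - x| <= `|x| ^+ 3.
Proof.
have h (y : R) : 0 <= y -> `|sin y - y| <= y ^+ 3.
  move=> y0; have h1 := sin_ge_cubic y0; have h2 := sin_le_id y0.
  have y3 : 0 <= y ^+ 3 by rewrite exprn_ge0.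
  by rewrite ler_norml; lra.
have [x0|x0] := leP 0 x; first by rewrite (ger0_norm x0) h.
have := h (- x); rewrite sinN (ltr0_norm x0) -opprD normrN; apply; lra.
Qed.

Lemma sin_lipschitz (x y : R) : `|sin x - sin y| <= `|x - y|.
Proof.
wlog xy : x y / x <= y.
  move=> H; have [/H//|/ltW/H] := leP x y.
  by rewrite distrC (distrC y).
have [c _] : exists2 c, c \in `[x, y] & sin y - sin x = cos c * (y - x).
  apply: (@MVT_segment R sin cos) => //.
  by apply: derivable_within_continuous => z _; exact: derivable_sin.
rewrite (distrC (sin x)) (distrC x) => ->; rewrite normrM ler_piMl// ler_norml.
by rewrite cos_geN1 cos_le1.
Qed.

Lemma cos_lipschitz (x y : R) : `|cos x - cos y| <= `|x - y|.
Proof.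
wlog xy : x y / x <= y.
  move=> H; have [/H//|/ltW/H] := leP x y.
  by rewrite distrC (distrC y).
have [c _] : exists2 c, c \in `[x, y] & cos y - cos x = (-%R \o sin) c * (y - x).
  apply: (@MVT_segment R cos (-%R \o sin)) => //.
  by apply: derivable_within_continuous => z _; exact: derivable_cos.
rewrite (distrC (cos x)) (distrC x) => ->; rewrite normrM ler_piMl// normrN ler_norml.
by rewrite sin_geN1 sin_le1.
Qed.

End taylor.

(** * The characteristic function of one step near the origin *)

Section char_estimates.
Context d (T : measurableType d) (R : realType) (P : probability T R).
Variables (X1 X2 : T -> R).
Hypotheses (mX1 : measurable_fun setT X1) (mX2 : measurable_fun setT X2).
Let N (y : T) : R := `|X1 y| + `|X2 y|.
Hypothesis iN3 : P.-integrable setT (EFin \o (fun y => N y ^+ 3)).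

Let mN : measurable_fun setT N.
Proof. by apply: measurable_funD; apply: measurableT_comp. Qed.

Let N0 y : 0 <= N y. Proof. by rewrite addr_ge0. Qed.

(** All lower moments come from the third one, since [N^k <= 1 + N^3] for [k <= 3]. *)
Lemma integrable_moment k (f : T -> R) : (k <= 3)%N -> measurable_fun setT f ->
  (forall y, `|f y| <= N y ^+ k) -> P.-integrable setT (EFin \o f).
Proof.
move=> k3 mf fN.
have i1 : P.-integrable setT (EFin \o (fun y : T => 1 + N y ^+ 3)).
  by apply: integrableRD => //; apply: (@bounded_integrable _ _ _ _ _ 1) => // x; rewrite normr1.
apply: le_integrableR i1 => // y; apply: (le_trans (fN y)).
have [N1|/ltW N1] := leP (N y) 1.
  by rewrite (@le_trans _ _ 1) ?exprn_ile1// lerDl exprn_ge0.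
by rewrite (@le_trans _ _ (N y ^+ 3)) ?lerDr// ler_weXn2l.
Qed.

Let le1 y : `|X1 y| <= N y. Proof. by rewrite lerDl. Qed.
Let le2 y : `|X2 y| <= N y. Proof. by rewrite lerDr. Qed.

Lemma integrable_X1 : P.-integrable setT (EFin \o X1).
Proof. by apply: (@integrable_moment 1). Qed.
Lemma integrable_X2 : P.-integrable setT (EFin \o X2).
Proof. by apply: (@integrable_moment 1). Qed.
Lemma integrable_X11 : P.-integrable setT (EFin \o (fun y => X1 y ^+ 2)).
Proof.
apply: (@integrable_moment 2) => //; first exact: measurable_funX.
by move=> y; rewrite normrX lerXn2r// nnegrE.
Qed.
Lemma integrable_X22 : P.-integrable setT (EFin \o (fun y => X2 y ^+ 2)).
Proof.
apply: (@integrable_moment 2) => //; first exact: measurable_funX.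
by move=> y; rewrite normrX lerXn2r// nnegrE.
Qed.
Lemma integrable_X12 : P.-integrable setT (EFin \o (fun y => X1 y * X2 y)).
Proof.
apply: (@integrable_moment 2) => //; first exact: measurable_funM.
by move=> y; rewrite normrM expr2 ler_pM.
Qed.

Let M := (\int[P]_y (N y ^+ 3))%R.
Let a := (\int[P]_y (X1 y ^+ 2))%R.
Let b := (\int[P]_y (X1 y * X2 y))%R.
Let c := (\int[P]_y (X2 y ^+ 2))%R.
Definition covform (u v : R) := a * u ^+ 2 + 2 * b * u * v + c * v ^+ 2.

Local Notation C := (char1C P X1 X2).
Local Notation S := (char1S P X1 X2).

Let mlin u v : measurable_fun setT (fun y => u * X1 y + v * X2 y).
Proof. by apply: measurable_funD; apply: measurable_funM => //. Qed.

Let lin_le u v y : `|u * X1 y + v * X2 y| <= (`|u| + `|v|) * N y.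
Proof.
rewrite (le_trans (ler_normD _ _))// !normrM mulrDl /N !mulrDr.
have := mulr_ge0 (normr_ge0 u) (normr_ge0 (X2 y)).
have := mulr_ge0 (normr_ge0 v) (normr_ge0 (X1 y)).
lra.
Qed.

Let lin3 u v y : `|u * X1 y + v * X2 y| ^+ 3 <= (`|u| + `|v|) ^+ 3 * N y ^+ 3.
Proof.
by rewrite -exprMn lerXn2r// ?nnegrE// mulr_ge0// addr_ge0.
Qed.

Lemma integrable_lin2 u v :
  P.-integrable setT (EFin \o (fun y => (u * X1 y + v * X2 y) ^+ 2)).
Proof.
have : P.-integrable setT (EFin \o (fun y => (u ^+ 2 * X1 y ^+ 2 +
    (2 * u * v) * (X1 y * X2 y)) + v ^+ 2 * X2 y ^+ 2)).
  apply: integrableRD; [apply: integrableRD|]; apply: integrableRZl.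
  - exact: integrable_X11.
  - exact: integrable_X12.
  - exact: integrable_X22.
by apply: eq_integrable => // y _; rewrite /=; congr EFin; ring.
Qed.

Lemma Rintegral_lin2 u v :
  (\int[P]_y (u * X1 y + v * X2 y) ^+ 2)%R = covform u v.
Proof.
have i11 := integrableRZl (u ^+ 2) integrable_X11.
have i12 := integrableRZl (2 * u * v) integrable_X12.
have i22 := integrableRZl (v ^+ 2) integrable_X22.
transitivity (\int[P]_y (u ^+ 2 * X1 y ^+ 2 +
    (2 * u * v) * (X1 y * X2 y) + v ^+ 2 * X2 y ^+ 2))%R.
  by apply: eq_Rintegral => y _; ring.
rewrite RintegralD//; last exact: (integrableRD i11 i12).
rewrite RintegralD//.
rewrite (RintegralZl _ _ integrable_X11)// (RintegralZl _ _ integrable_X12)//.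
by rewrite (RintegralZl _ _ integrable_X22)// /covform -/a -/b -/c; ring.
Qed.

Lemma norm_Rintegral_le (f g : T -> R) : measurable_fun setT f ->
  P.-integrable setT (EFin \o g) -> (forall y, `|f y| <= g y) ->
  `|\int[P]_y f y|%R <= (\int[P]_y g y)%R.
Proof.
move=> mf gi fg; have fi := le_integrableR mf fg gi.
rewrite (le_trans (le_normr_Rintegral measurableT fi))//.
by apply: le_Rintegral => //; exact: (integrable_norm fi).
Qed.

Lemma char1C_taylor u v :
  `|C u v - (1 - covform u v / 2)| <= (`|u| + `|v|) ^+ 3 * M.
Proof.
have i1 : P.-integrable setT (EFin \o (fun y : T => 1 : R)).
  by apply: (@bounded_integrable _ _ _ _ _ 1) => // x; rewrite normr1.
have ilin := integrableRZr 2^-1 (integrable_lin2 u v).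
have -> : C u v - (1 - covform u v / 2) = (\int[P]_y
   (cos (u * X1 y + v * X2 y) - (1 - (u * X1 y + v * X2 y) ^+ 2 / 2)))%R.
  rewrite RintegralB//; first last.
  - exact: integrableRB.
  - exact: integrable_cos.
  rewrite RintegralB// RintegralZr//; last exact: integrable_lin2.
  by rewrite Rintegral_lin2 Rintegral_cst//= probability_setT mulr1.
have -> : (`|u| + `|v|) ^+ 3 * M = (\int[P]_y ((`|u| + `|v|) ^+ 3 * N y ^+ 3))%R.
  by rewrite RintegralZl.
apply: norm_Rintegral_le.
- apply: measurable_funB; first by apply: measurableT_comp => //;
    exact: continuous_measurable_fun (@continuous_cos R).
  apply: measurable_funB => //; apply: measurable_funM => //.
  exact: measurable_funX.
- exact: integrableRZl.
- by move=> y; apply: (le_trans (norm_cos_taylor _)).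
Qed.

Hypothesis EX1 : (\int[P]_y X1 y)%R = 0.
Hypothesis EX2 : (\int[P]_y X2 y)%R = 0.

Lemma char1S_taylor u v : `|S u v| <= (`|u| + `|v|) ^+ 3 * M.
Proof.
have iu := integrableRZl u integrable_X1.
have iv := integrableRZl v integrable_X2.
have -> : S u v = (\int[P]_y
   (sin (u * X1 y + v * X2 y) - (u * X1 y + v * X2 y)))%R.
  rewrite RintegralB//; first last.
  - exact: integrableRD.
  - exact: integrable_sin.
  rewrite RintegralD// (RintegralZl _ _ integrable_X1)//.
  by rewrite (RintegralZl _ _ integrable_X2)// EX1 EX2 !mulr0 addr0 subr0.
have -> : (`|u| + `|v|) ^+ 3 * M = (\int[P]_y ((`|u| + `|v|) ^+ 3 * N y ^+ 3))%R.
  by rewrite RintegralZl.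
apply: norm_Rintegral_le.
- apply: measurable_funB => //; apply: measurableT_comp => //;
    exact: continuous_measurable_fun (@continuous_sin R).
- exact: integrableRZl.
- by move=> y; apply: (le_trans (norm_sin_taylor _)).
Qed.

Let m1 := (\int[P]_y N y)%R.

Let iN : P.-integrable setT (EFin \o N).
Proof. by apply: (@integrable_moment 1) => // y; rewrite ger0_norm. Qed.

Lemma char1C_lipschitz u v u' v' :
  `|C u v - C u' v'| <= (`|u - u'| + `|v - v'|) * m1.
Proof.
rewrite -RintegralB//; [|exact: integrable_cos|exact: integrable_cos].
rewrite -RintegralZl//.
have mcos := continuous_measurable_fun (@continuous_cos R).
apply: norm_Rintegral_le.
- by apply: measurable_funB; apply: measurableT_comp.
- exact: integrableRZl.
- move=> y; apply: (le_trans (cos_lipschitz _ _)).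
  by rewrite (_ : _ - _ = (u - u') * X1 y + (v - v') * X2 y)//; ring.
Qed.

Lemma char1S_lipschitz u v u' v' :
  `|S u v - S u' v'| <= (`|u - u'| + `|v - v'|) * m1.
Proof.
rewrite -RintegralB//; [|exact: integrable_sin|exact: integrable_sin].
rewrite -RintegralZl//.
have msin := continuous_measurable_fun (@continuous_sin R).
apply: norm_Rintegral_le.
- by apply: measurable_funB; apply: measurableT_comp.
- exact: integrableRZl.
- move=> y; apply: (le_trans (sin_lipschitz _ _)).
  by rewrite (_ : _ - _ = (u - u') * X1 y + (v - v') * X2 y)//; ring.
Qed.

End char_estimates.

(** * Gaussian decay on boxes and the central limit theorem *)

Section decay_prelim.
Context {R : realType}.

Lemma lipschitz2_continuous (f : R * R -> R) (m : R) :
  (forall z z', `|f z - f z'| <= (`|z.1 - z'.1| + `|z.2 - z'.2|) * m) ->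
  continuous f.
Proof.
move=> fm z; apply/subr_cvg0; apply: norm_cvg0.
apply: (@squeeze_cvgr _ _ _ _ (cst 0)
  (fun z' : R * R => (`|z'.1 - z.1| + `|z'.2 - z.2|) * m)).
- by apply: nearW => z'; rewrite normr_ge0/= fm.
- exact: cvg_cst.
- have : (`|z'.1 - z.1| + `|z'.2 - z.2|) * m @[z' --> z] -->
      (`|z.1 - z.1| + `|z.2 - z.2|) * m.
    apply: cvgM; last exact: cvg_cst.
    apply: cvgD; apply: cvg_norm; apply: cvgB; try exact: cvg_cst.
      exact: cvg_fst.
    exact: cvg_snd.
  by rewrite !subrr normr0 addr0 mul0r.
Qed.

Lemma expRN_le_quad (x : R) : 0 <= x -> expR (- x) <= 1 - x + x ^+ 2.
Proof.
move=> x0; rewrite -subr_ge0.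
have dE (y : R) : is_derive y 1 (fun y => expR (- y)) (- expR (- y)).
  refine (is_derive_eq (is_derive_fun_comp (is_derive_expR _) (is_deriveNid y 1)) _).
  by rewrite mulrN1.
apply: (@ge0_of_derive R (fun x => 1 - x + x ^+ 2 - expR (- x))
  (fun x => - 1 + x *+ 2 + expR (- x))) => //.
- by rewrite oppr0 expR0 expr0n/=; lra.
- move=> y; refine (is_derive_eq (is_derive_funB (is_derive_funD
    (is_derive_funB _ _) (is_derive_funX 2 y)) (dE y)) _).
  by rewrite /=; lra.
- by move=> y y0; have := expR_ge1Dx (- y); lra.
Qed.

Lemma norm_expRN_taylor (x : R) : 0 <= x -> `|expR (- x) - (1 - x)| <= x ^+ 2.
Proof.
move=> x0; have := expR_ge1Dx (- x); have := expRN_le_quad x0.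
by move=> h1 h2; rewrite ler_norml; have := sqr_ge0 x; lra.
Qed.

End decay_prelim.

Section decay.
Context d (T : measurableType d) (R : realType) (P : probability T R).
Variables (X1 X2 : T -> R).
Hypotheses (mX1 : measurable_fun setT X1) (mX2 : measurable_fun setT X2).
Hypothesis iN3 : P.-integrable setT (EFin \o (fun y => (`|X1 y| + `|X2 y|) ^+ 3)).
Hypothesis EX1 : (\int[P]_y X1 y)%R = 0.
Hypothesis EX2 : (\int[P]_y X2 y)%R = 0.
Let a := (\int[P]_y (X1 y ^+ 2))%R.
Let b := (\int[P]_y (X1 y * X2 y))%R.
Let c := (\int[P]_y (X2 y ^+ 2))%R.
Hypothesis det_gt0 : 0 < a * c - b ^+ 2.
Local Notation C := (char1C P X1 X2).
Local Notation S := (char1S P X1 X2).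
Hypothesis nonlattice : forall u v, (u, v) != (0, 0) -> C u v ^+ 2 + S u v ^+ 2 < 1.
Local Notation Q := (covform P X1 X2).
Let M := (\int[P]_y ((`|X1 y| + `|X2 y|) ^+ 3))%R.

Let a0 : 0 <= a. Proof. by apply: Rintegral_ge0 => y _; rewrite sqr_ge0. Qed.
Let c0 : 0 <= c. Proof. by apply: Rintegral_ge0 => y _; rewrite sqr_ge0. Qed.
Let M0 : 0 <= M.
Proof. by apply: Rintegral_ge0 => y _; rewrite exprn_ge0// addr_ge0. Qed.

Lemma trace_gt0 : 0 < a + c.
Proof.
rewrite lt_neqAle addr_ge0// andbT eq_sym paddr_eq0//; apply/negP => /andP[/eqP az _].
by move: det_gt0; rewrite az mul0r sub0r oppr_gt0 ltNge sqr_ge0.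
Qed.

(** Determinant over trace bounds the smaller eigenvalue from below: [trace * Q - det * (u^2 + v^2)]
    is the squared norm of the covariance matrix applied to [(u, v)]. *)
Lemma covform_lower : {k : R | 0 < k & forall u v, k * (u ^+ 2 + v ^+ 2) <= Q u v}.
Proof.
exists ((a * c - b ^+ 2) / (a + c)); first by rewrite divr_gt0// trace_gt0.
move=> u v; rewrite mulrAC ler_pdivrMr ?trace_gt0// /covform -/a -/b -/c.
rewrite -subr_ge0 [leRHS](_ : _ = (a * u + b * v) ^+ 2 + (b * u + c * v) ^+ 2).
  by rewrite addr_ge0// sqr_ge0.
by ring.
Qed.

Lemma covform_upper u v : Q u v <= (a + 2 * `|b| + c) * (`|u| + `|v|) ^+ 2.
Proof.
rewrite /covform -/a -/b -/c.
have h1 : u ^+ 2 <= (`|u| + `|v|) ^+ 2.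
  by rewrite -real_normK ?num_real// lerXn2r ?nnegrE ?addr_ge0 ?lerDl.
have h2 : v ^+ 2 <= (`|u| + `|v|) ^+ 2.
  by rewrite -(real_normK (num_real v)) lerXn2r ?nnegrE ?addr_ge0 ?lerDr.
have h3 : b * (u * v) <= `|b| * (`|u| + `|v|) ^+ 2.
  rewrite (le_trans (ler_norm _))// normrM ler_wpM2l//.
  rewrite normrM expr2 ler_pM ?lerDl ?lerDr//.
have h4 := ler_wpM2l a0 h1; have h5 := ler_wpM2l c0 h2.
by nra.
Qed.

Lemma covform_ge0 u v : 0 <= Q u v.
Proof.
have [k k0 /(_ u v)] := covform_lower; apply: le_trans.
by rewrite (mulr_ge0 (ltW k0))// addr_ge0// sqr_ge0.
Qed.

Let sqr_l1 (u v : R) : (`|u| + `|v|) ^+ 2 <= 2 * (u ^+ 2 + v ^+ 2).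
Proof.
rewrite -(real_normK (num_real u)) -(real_normK (num_real v)).
by have := sqr_ge0 (`|u| - `|v|); nra.
Qed.

(** The quadratic term of the expansion dominates the cubic remainders. With [C] in [[0, 1]] and
    [|S| <= 1], the squared modulus is at most [C + |S| <= 1 - k rho / 4], where
    [rho = u^2 + v^2]. *)
Lemma decay_near0 : exists dl k : R, [/\ 0 < dl, 0 < k &
  forall u v, `|u| + `|v| <= dl ->
    C u v ^+ 2 + S u v ^+ 2 <= expR (- (k * (u ^+ 2 + v ^+ 2)))].
Proof.
have [k k0 Qk] := covform_lower.
pose A := a + 2 * `|b| + c.
have A0 : 0 <= A by rewrite /A !addr_ge0// mulr_ge0.
(* The bound by 1 gives [r^2 <= dl], the second term yields [C >= 0] and [|S| <= 1], and the third
   makes the cubic remainder at most [k rho / 8]. *)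
pose dl := Num.min (1 : R) (Num.min (A + M + 1)^-1 (k / (16 * (M + 1)))).
have M1 : 0 < M + 1 by rewrite ltr_wpDl.
have AM1 : 0 < A + M + 1 by rewrite ltr_wpDl// addr_ge0.
have dl0 : 0 < dl.
  rewrite /dl !lt_min ltr01 invr_gt0 AM1/= divr_gt0// mulr_gt0//.
have dl1 : dl <= 1 by rewrite /dl ge_min lexx.
have dl2 : dl * (A + M + 1) <= 1.
  by rewrite -ler_pdivlMr// div1r /dl !ge_min lexx orbT.
have dl3 : 16 * (dl * M) <= k.
  have : dl * (16 * (M + 1)) <= k.
    by rewrite -ler_pdivlMr ?mulr_gt0// /dl !ge_min lexx !orbT.
  by nra.
exists dl, (k / 4); split=> //; first by rewrite divr_gt0.
move=> u v rdl.
have hC := char1C_taylor mX1 mX2 iN3 u v.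
have hS := char1S_taylor mX1 mX2 iN3 EX1 EX2 u v.
have hQ := Qk u v; have hQ2 := covform_upper u v; have hr := sqr_l1 u v.
rewrite -/M in hC hS; rewrite -/A in hQ2.
set r := `|u| + `|v| in rdl hC hS hQ2 hr.
have r0 : 0 <= r by rewrite addr_ge0.
set rho := u ^+ 2 + v ^+ 2 in hQ hr *.
have rho0 : 0 <= rho by rewrite addr_ge0// sqr_ge0.
have r2dl : r ^+ 2 <= dl by rewrite expr2 (le_trans (ler_pM r0 r0 rdl rdl))// ler_piMr// ltW.
have r3 : r ^+ 3 * M <= dl * r ^+ 2 * M.
  by rewrite ler_wpM2r// exprS ler_wpM2r// exprn_ge0.
have r3' : dl * r ^+ 2 * M <= k * rho / 8.
  have : (dl * M) * r ^+ 2 <= (dl * M) * (2 * rho).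
    by rewrite ler_wpM2l// mulr_ge0// ltW.
  have : 16 * (dl * M) * rho <= k * rho by rewrite ler_wpM2r.
  by rewrite mulrAC; lra.
have r3'' : dl * r ^+ 2 * M <= dl * M.
  rewrite mulrAC ler_piMr ?mulr_ge0 ?(ltW dl0)//.
  by rewrite (le_trans r2dl).
have Adl : A * r ^+ 2 <= A * dl by rewrite ler_wpM2l.
have Cn : 0 <= C u v.
  by move: hC; rewrite ler_norml => /andP[h _]; nra.
have Cle : C u v <= 1 - 3 / 8 * (k * rho).
  by move: hC; rewrite ler_norml => /andP[_ h]; lra.
have krho : 0 <= k * rho by rewrite mulr_ge0// ltW.
have C2 : C u v ^+ 2 <= C u v by rewrite expr2 ler_piMr//; lra.
have S1 : `|S u v| <= 1.
  apply: (le_trans hS); apply: (le_trans r3); apply: (le_trans r3'').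
  by nra.
have S2 : S u v ^+ 2 <= `|S u v|.
  by rewrite -real_normK ?num_real// expr2 ler_piMr.
have := expR_ge1Dx (- (k / 4 * rho)); lra.
Qed.

Lemma char_sqr_continuous :
  continuous (fun z : R * R => C z.1 z.2 ^+ 2 + S z.1 z.2 ^+ 2).
Proof.
have cC : continuous (fun z : R * R => C z.1 z.2).
  apply: (@lipschitz2_continuous _ _ (\int[P]_y (`|X1 y| + `|X2 y|))) => z z'.
  exact: char1C_lipschitz.
have cS : continuous (fun z : R * R => S z.1 z.2).
  apply: (@lipschitz2_continuous _ _ (\int[P]_y (`|X1 y| + `|X2 y|))) => z z'.
  exact: char1S_lipschitz.
move=> z; under eq_fun do rewrite !expr2.
by apply: cvgD; apply: cvgM; [exact: cC|exact: cC|exact: cS|exact: cS].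
Qed.

(** Near the origin the expansion decides. The rest of the box is compact, so continuity and
    [nonlattice] keep the squared modulus below some [m < 1] there, and a slow enough Gaussian still
    lies above [m]. *)
Lemma decay_box (l : R) : 0 < l -> exists2 k : R, 0 < k &
  forall u v, `|u| <= l -> `|v| <= l ->
    C u v ^+ 2 + S u v ^+ 2 <= expR (- (k * (u ^+ 2 + v ^+ 2))).
Proof.
move=> l0; have [dl [k [dl0 k0 hnear]]] := decay_near0.
pose K : set (R * R) := (`[-l, l] `*` `[-l, l]) `&` [set z | dl <= `|z.1| + `|z.2|].
have cK : compact K.
  apply: compact_closedI.
    by apply: compact_setX; exact: segment_compact.
  have cn : continuous (fun z : R * R => `|z.1| + `|z.2|).
    by move=> z; apply: cvgD; apply: cvg_norm; [exact: cvg_fst|exact: cvg_snd].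
  exact: (@closed_comp _ _ _ [set x | dl <= x] (fun z _ => cn z) (@closed_ge _ dl)).
have [K0|/set0P K0] := eqVneq K set0.
  exists k => // u v ul vl; apply: hnear; rewrite leNgt; apply/negP => h.
  suff : K (u, v) by rewrite K0.
  split; last exact: ltW.
  by split; rewrite /= in_itv/= -ler_norml.
have [z0 z0K hz0] := compact_EVT_max K0 cK (continuous_subspaceT char_sqr_continuous).
set m := C z0.1 z0.2 ^+ 2 + S z0.1 z0.2 ^+ 2 in hz0.
have m1 : m < 1.
  apply: nonlattice; move: z0K; rewrite inE => -[_ /= h].
  apply/eqP => -[z1 z2]; move: h; rewrite z1 z2 normr0 addr0.
  by rewrite leNgt dl0.
(* On the box [u^2 + v^2 <= 2 l^2], so this rate gives [1 - k2 (u^2 + v^2) >= m]. *)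
pose k2 := Num.min k ((1 - m) / (2 * l ^+ 2)).
have l2 : 0 < 2 * l ^+ 2 by rewrite mulr_gt0// exprn_gt0.
have k20 : 0 < k2 by rewrite lt_min k0/= divr_gt0// subr_gt0.
exists k2 => // u v ul vl.
have rho0 : 0 <= u ^+ 2 + v ^+ 2 by rewrite addr_ge0// sqr_ge0.
have [uv|uv] := leP (`|u| + `|v|) dl.
  apply: (le_trans (hnear u v uv)); rewrite ler_expR lerN2 ler_wpM2r//.
  by rewrite /k2 ge_min lexx.
have : K (u, v).
  split; last exact: ltW.
  by split; rewrite /= in_itv/= -ler_norml.
move=> /mem_set/hz0 /= => h; apply: (le_trans h).
apply: le_trans (expR_ge1Dx _); rewrite lerBrDr -lerBrDl.
have hl (x : R) : `|x| <= l -> x ^+ 2 <= l ^+ 2.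
  by move=> xl; rewrite -real_normK ?num_real// lerXn2r ?nnegrE// ltW.
apply: (@le_trans _ _ (k2 * (2 * l ^+ 2))).
  by rewrite ler_wpM2l ?(ltW k20)// mulr_natl mulr2n lerD ?hl.
by rewrite -ler_pdivlMr// /k2 ge_min lexx orbT.
Qed.

Local Notation nuC := (charC P mX1 mX2).
Local Notation nuS := (charS P mX1 mX2).

Lemma char_norm_le (l : R) : 0 < l -> exists2 k : R, 0 < k &
  forall n u v, `|u| <= l -> `|v| <= l ->
    `|nuC n u v| <= expR (- (k * (u ^+ 2 + v ^+ 2))) ^+ n /\
    `|nuS n u v| <= expR (- (k * (u ^+ 2 + v ^+ 2))) ^+ n.
Proof.
(* The rate [k] belongs to the squared modulus, hence the half. *)
move=> /decay_box[k k0 hk]; exists (k / 2); first by rewrite divr_gt0.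
move=> n u v ul vl.
have := char_sqr P mX1 mX2 n u v.
have := hk u v ul vl.
set E := expR _; set w := _ + _ ^+ 2 => wE hn.
have EE : E = expR (- (k / 2 * (u ^+ 2 + v ^+ 2))) ^+ 2.
  by rewrite -expRM_natr; congr expR; lra.
have w0 : 0 <= w by rewrite addr_ge0// sqr_ge0.
have wn : w ^+ n <= (expR (- (k / 2 * (u ^+ 2 + v ^+ 2))) ^+ n) ^+ 2.
  by rewrite exprAC -EE lerXn2r// nnegrE// expR_ge0.
rewrite -hn in wn.
have ab (x y t : R) : 0 <= t -> x ^+ 2 + y ^+ 2 <= t ^+ 2 -> `|x| <= t.
  move=> t0 h; rewrite -ler_sqr ?nnegrE// real_normK ?num_real//.
  by rewrite (le_trans _ h)// lerDl sqr_ge0.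
split; first by apply: ab wn; rewrite exprn_ge0 ?expR_ge0.
by apply: (ab _ (nuC n u v)); rewrite ?exprn_ge0 ?expR_ge0// addrC.
Qed.

(** With [x = n^(-1/2)], the reference factor [p = exp (- Q x^2 / 2)] has its n-th power equal to
    the limit exactly. A single factor differs from [p] by a multiple of [x^3], and [n x^3 = x]. *)
Lemma char_dist_rate u v : exists D : R, forall n x, (0 < n)%N ->
  x = (Num.sqrt n%:R)^-1 ->
  `|nuC n (u * x) (v * x) - expR (- (Q u v / 2))| + `|nuS n (u * x) (v * x)|
  <= x * D.
Proof.
pose B := (`|u| + `|v|) ^+ 3 * M.
have B0 : 0 <= B by rewrite mulr_ge0// exprn_ge0// addr_ge0.
pose D := 2 * B + (Q u v / 2) ^+ 2.
have D0 : 0 <= D by rewrite addr_ge0// ?sqr_ge0// mulr_ge0.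
exists (D * expR D) => n x n0 xE.
have sn0 : 0 < Num.sqrt (n%:R : R) by rewrite sqrtr_gt0 ltr0n.
have x0 : 0 < x by rewrite xE invr_gt0.
have x1 : x <= 1.
  by rewrite xE invf_le1// -[leLHS]sqrtr1 ler_wsqrtr// ler1n.
have nx2 : n%:R * x ^+ 2 = 1.
  by rewrite xE exprVn sqr_sqrtr ?ler0n// divff// pnatr_eq0 -lt0n.
have xx (w : R) : `|w * x| = `|w| * x by rewrite normrM (gtr0_norm x0).
have Qx : Q (u * x) (v * x) = Q u v * x ^+ 2 by rewrite /covform; ring.
pose p := expR (- (Q u v / 2 * x ^+ 2)).
have Q0 := covform_ge0 u v.
have qx0 : 0 <= Q u v / 2 * x ^+ 2 by rewrite mulr_ge0 ?divr_ge0// sqr_ge0.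
have p1 : p <= 1 by rewrite expR_le1 oppr_le0.
have pn : p ^+ n = expR (- (Q u v / 2)).
  rewrite -expRM_natr.
  have -> : - (Q u v / 2 * x ^+ 2) * n%:R = - (Q u v / 2 * (n%:R * x ^+ 2)) by ring.
  by rewrite nx2 mulr1.
have := char_dist P mX1 mX2 n (u * x) (v * x) (expR_ge0 _) p1.
rewrite -/p pn => h; apply: (le_trans h).
have hC := char1C_taylor mX1 mX2 iN3 (u * x) (v * x).
have hS := char1S_taylor mX1 mX2 iN3 EX1 EX2 (u * x) (v * x).
have rx : (`|u * x| + `|v * x|) ^+ 3 * M = B * x ^+ 3.
  by rewrite !xx /B; ring.
rewrite -/M rx Qx in hC; rewrite -/M rx in hS.
have hp := norm_expRN_taylor qx0; rewrite -/p in hp.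
have x43 : (Q u v / 2 * x ^+ 2) ^+ 2 <= (Q u v / 2) ^+ 2 * x ^+ 3.
  rewrite exprMn ler_wpM2l ?sqr_ge0// -exprM.
  by rewrite (_ : (2 * 2 = 4)%N)// exprS ler_piMl// exprn_ge0// ltW.
have hCp : `|C (u * x) (v * x) - p| <= B * x ^+ 3 + (Q u v / 2) ^+ 2 * x ^+ 3.
  have -> : C (u * x) (v * x) - p = (C (u * x) (v * x) - (1 - Q u v * x ^+ 2 / 2))
     - (p - (1 - Q u v / 2 * x ^+ 2)) by ring.
  by rewrite (le_trans (ler_normB _ _))// lerD// (le_trans hp).
have x3 : 0 <= x ^+ 3 by rewrite exprn_ge0// ltW.
set Sx := `|S (u * x) (v * x)| in hS *.
have nx3 : n%:R * x ^+ 3 = x by rewrite exprS mulrCA nx2 mulr1.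
have e1 : n%:R * (`|C (u * x) (v * x) - p| + Sx) <= x * D.
  have -> : x * D = n%:R * (x ^+ 3 * D) by rewrite mulrA nx3.
  by rewrite ler_wpM2l// ?ler0n// /D; lra.
(* [(1 + Sx)^n <= exp (n Sx)], and [n Sx <= B x <= B <= D] because [x <= 1]. *)
have e2 : (1 + Sx) ^+ n <= expR D.
  have S0 : 0 <= 1 + Sx by rewrite addr_ge0// /Sx.
  apply: (@le_trans _ _ (expR Sx ^+ n)).
    by rewrite lerXn2r ?nnegrE ?expR_ge0// expR_ge1Dx.
  rewrite -expRM_natl ler_expR.
  apply: (@le_trans _ _ (n%:R * (B * x ^+ 3))); first by rewrite ler_wpM2l// ler0n.
  rewrite mulrCA nx3 (@le_trans _ _ B)// ?ler_piMr//.
  by rewrite /D; have := sqr_ge0 (Q u v / 2); lra.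
rewrite mulrA; apply: ler_pM => //.
- by rewrite mulr_ge0// ?ler0n// addr_ge0// /Sx.
- by rewrite exprn_ge0// addr_ge0// /Sx.
Qed.

Lemma cvg_invsqrtn : (Num.sqrt (n%:R : R))^-1 @[n --> \oo] --> 0.
Proof.
apply/cvgrPdist_le => e e0; near=> n.
have n0 : (0 < n)%N by near: n; exact: nbhs_infty_gt.
rewrite sub0r normrN ger0_norm ?invr_ge0 ?sqrtr_ge0//.
rewrite invf_ple ?posrE ?sqrtr_gt0 ?ltr0n//.
have e20 : 0 <= e^-1 by rewrite invr_ge0 ltW.
rewrite -[leLHS](ger0_norm e20) -sqrtr_sqr ler_sqrt ?ler0n//.
by near: n; exact: nbhs_infty_ger.
Unshelve. all: by end_near. Qed.

Lemma cvg_charC u v :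
  nuC n (u * (Num.sqrt n%:R)^-1) (v * (Num.sqrt n%:R)^-1) @[n --> \oo] -->
  expR (- (Q u v / 2)).
Proof.
have [D hD] := char_dist_rate u v.
apply/subr_cvg0; apply: norm_cvg0.
apply: (@squeeze_cvgr _ _ _ _ (cst 0) (fun n => (Num.sqrt (n%:R : R))^-1 * D)).
- near=> n; rewrite normr_ge0/=.
  have n0 : (0 < n)%N by near: n; exact: nbhs_infty_gt.
  by apply: le_trans (hD n _ n0 erefl); rewrite lerDl.
- exact: cvg_cst.
- by rewrite -(mul0r D); apply: cvgMl; exact: cvg_invsqrtn.
Unshelve. all: by end_near. Qed.

Lemma cvg_charS u v :
  nuS n (u * (Num.sqrt n%:R)^-1) (v * (Num.sqrt n%:R)^-1) @[n --> \oo] --> 0.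
Proof.
have [D hD] := char_dist_rate u v.
apply: norm_cvg0.
apply: (@squeeze_cvgr _ _ _ _ (cst 0) (fun n => (Num.sqrt (n%:R : R))^-1 * D)).
- near=> n; rewrite normr_ge0/=.
  have n0 : (0 < n)%N by near: n; exact: nbhs_infty_gt.
  by apply: le_trans (hD n _ n0 erefl); rewrite lerDr.
- exact: cvg_cst.
- by rewrite -(mul0r D); apply: cvgMl; exact: cvg_invsqrtn.
Unshelve. all: by end_near. Qed.

End decay.

(** * The Fejer kernel *)

Section lebesgue_affine.
Context {R : realType}.
Local Notation mu := (@lebesgue_measure R).
Local Open Scope ereal_scope.

(** The image of Lebesgue measure under the affine map, multiplied by [a], agrees with Lebesgue
    measure on half-open intervals, hence everywhere. *)
Lemma ge0_integral_affine (a b : R) (f : R -> \bar R) : (0 < a)%R ->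
  measurable_fun setT f -> (forall x, 0 <= f x) ->
  a%:E * \int[mu]_x f (a * x + b)%R = \int[mu]_x f x.
Proof.
move=> a0 mf f0.
pose phi : measurableTypeR R -> measurableTypeR R := fun x => (a * x + b)%R.
have mphi : measurable_fun setT phi.
  by apply: measurable_funD => //; exact: measurable_funM.
pose nu := mscale (NngNum (ltW a0)) (pushforward mu phi).
have nuE (A : set (measurableTypeR R)) : measurable A -> mu A = nu mphi A.
  apply: (@lebesgue_measure_unique R (nu mphi)) => _ [[u v]] _ <-.
  rewrite /nu /mscale /pushforward /=.
  rewrite [X in _ = _ * mu X](_ : _ = [set` `](u - b) / a, (v - b) / a]]%R); last first.
    apply/seteqP; split => x; rewrite /phi /= !in_itv/=
      ltr_pdivrMr// ler_pdivlMr// ltrBlDr lerBrDr [(x * a)%R]mulrC//.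
  rewrite !lebesgue_measure_itv/= !lte_fin ltr_pM2r ?invr_gt0// ltrD2r.
  case: ifPn => _; last by rewrite mule0.
  rewrite -!EFinB -EFinM; congr EFin; field; exact: lt0r_neq0.
transitivity (\int[nu mphi]_x f x); last first.
  by apply: eq_measure_integral => //= A mA _; rewrite nuE.
rewrite ge0_integral_mscale//.
by rewrite ge0_integral_pushforward.
Qed.

Lemma ge0_integral_opp (f : R -> \bar R) :
  measurable_fun setT f -> (forall x, 0 <= f x) ->
  \int[mu]_x f (- x)%R = \int[mu]_x f x.
Proof.
move=> mf f0.
transitivity (\int[pushforward mu (-%R : _ -> measurableTypeR R)]_x f x).
  by rewrite ge0_integral_pushforward.
by apply: eq_measure_integral => //= A mA _; rewrite lebesgue_measureN.
Qed.

Lemma integral_opp (f : R -> R) : mu.-integrable setT (EFin \o f) ->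
  (\int[mu]_x f (- x) = \int[mu]_x f x)%R.
Proof.
move=> fi; rewrite /Rintegral; congr fine.
have mf : measurable_fun setT (EFin \o f) by case/integrableP: fi.
rewrite integralE [RHS]integralE; congr (_ - _).
- rewrite -[RHS]ge0_integral_opp//; last exact: measurable_funepos.
  by apply: eq_integral => x _; rewrite !funeposE.
- rewrite -[RHS]ge0_integral_opp//; last exact: measurable_funeneg.
  by apply: eq_integral => x _; rewrite !funenegE.
Qed.

Lemma ge0_integral_sub (c : R) (f : R -> \bar R) :
  measurable_fun setT f -> (forall x, 0 <= f x) ->
  \int[mu]_x f (c - x)%R = \int[mu]_x f x.
Proof.
move=> mf f0.
have mg : measurable_fun setT (fun x : R => f (c + x)%R).
  by apply: measurableT_comp => //; exact: measurable_funD.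
rewrite (ge0_integral_opp mg)//.
rewrite -[RHS](@ge0_integral_affine 1 c)// mul1e.
by apply: eq_integral => x _; rewrite mul1r addrC.
Qed.

Lemma ge0_integral_even (f : R -> \bar R) :
  measurable_fun setT f -> (forall x, 0 <= f x) -> (forall x, f (- x)%R = f x) ->
  \int[mu]_x f x = 2%:E * \int[mu]_(x in `]0%R, +oo[) f x.
Proof.
move=> mf f0 fe.
rewrite -(setUv `]-oo, 0%R]%classic) ge0_integral_setU//=; last 3 first.
- exact: measurableC.
- by rewrite setUv.
- exact/disj_setPCl.
rewrite setCitvl -(_ : \int[mu]_(r in `[0%R, +oo[) f r =
  \int[mu]_(x in `]-oo, 0%R]) f x); last first.
  by rewrite ge0_integration_by_substitution0//; apply: eq_integral => x _; rewrite fe.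
rewrite -integral_itv_obnd_cbnd; last exact: measurable_funTS.
by rewrite mule_natl mule2n.
Qed.

End lebesgue_affine.

Section fejer.
Context {R : realType}.
Variable l : R.
Hypothesis l0 : 0 < l.
Local Notation mu := (@lebesgue_measure R).

(** The triangle function on [[-l, l]]. Its Fourier transform [fejer] is nonnegative and integrable,
    so it can act as a smoothing weight. No factor normalizes it: its total mass is [2 pi]. *)
Definition fejer_hat (xi : R) : R := Num.max 0 (1 - `|xi| / l).
Definition fejer (x : R) : R := (\int[mu]_xi (fejer_hat xi * cos (xi * x)))%R.

Lemma fejer_hat_ge0 xi : 0 <= fejer_hat xi.
Proof. by rewrite le_max lexx. Qed.

Lemma fejer_hat_le1 xi : fejer_hat xi <= 1.
Proof. by rewrite ge_max ler01/= gerBl divr_ge0// ltW. Qed.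

Lemma fejer_hat_out xi : l < `|xi| -> fejer_hat xi = 0.
Proof.
move=> h; apply/max_idPl; rewrite subr_le0 ler_pdivlMr// mul1r; exact: ltW.
Qed.

Lemma fejer_hatN xi : fejer_hat (- xi) = fejer_hat xi.
Proof. by rewrite /fejer_hat normrN. Qed.

Lemma measurable_fejer_hat : measurable_fun setT fejer_hat.
Proof.
apply: measurable_maxr => //; apply: measurable_funB => //.
by apply: measurable_funM => //; exact: measurableT_comp.
Qed.

Lemma continuous_fejer_hat0 (u : nat -> R) : u n @[n --> \oo] --> 0 ->
  fejer_hat (u n) @[n --> \oo] --> (1 : R).
Proof.
move=> u0.
have : (1 : R) - `|u n| / l @[n --> \oo] --> (1 : R) - `|(0 : R)| / l.
  apply: cvgB; first exact: cvg_cst.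
  by apply: cvgM; [exact: cvg_norm|exact: cvg_cst].
rewrite normr0 mul0r subr0 => h.
apply: (@squeeze_cvgr _ _ _ _ (fun n => 1 - `|u n| / l) (cst 1)) => //.
- by apply: nearW => n; rewrite fejer_hat_le1 andbT le_max lexx orbT.
- exact: cvg_cst.
Qed.

Lemma integrable_fejer_hat : mu.-integrable setT (EFin \o fejer_hat).
Proof.
have : mu.-integrable setT (EFin \o (\1_(`[-l, l]%classic) : R -> R)).
  exact: integrable_indic_itv.
apply: le_integrableR; first exact: measurable_fejer_hat.
move=> x; rewrite ger0_norm ?fejer_hat_ge0// indicE.
have [xl|xl] := leP `|x| l.
  rewrite mem_set ?fejer_hat_le1//= in_itv/= -ler_norml//.
by rewrite fejer_hat_out.
Qed.

Lemma integrable_fejer_hatM (f : R -> R) : measurable_fun setT f ->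
  (forall x, `|f x| <= 1) -> mu.-integrable setT (EFin \o (fun x => fejer_hat x * f x)).
Proof.
move=> mf f1; apply: le_integrableR integrable_fejer_hat.
  by apply: measurable_funM => //; exact: measurable_fejer_hat.
move=> x; rewrite normrM (ger0_norm (fejer_hat_ge0 _)) ler_piMr//.
exact: fejer_hat_ge0.
Qed.

Let mcos : measurable_fun setT (@cos R).
Proof. exact: continuous_measurable_fun (@continuous_cos R). Qed.
Let msin : measurable_fun setT (@sin R).
Proof. exact: continuous_measurable_fun (@continuous_sin R). Qed.

Lemma fejer_sin0 x : (\int[mu]_xi (fejer_hat xi * sin (xi * x)))%R = 0.
Proof.
have fi : mu.-integrable setT (EFin \o (fun xi => fejer_hat xi * sin (xi * x))).
  apply: integrable_fejer_hatM; last by move=> y; exact: sin_max.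
  by apply: measurableT_comp => //; exact: measurable_funM.
have := integral_opp fi.
under eq_Rintegral do rewrite fejer_hatN mulNr sinN mulrN -mulN1r.
rewrite RintegralZl// mulN1r => /eqP.
by rewrite eq_sym -addr_eq0 -mulr2n mulrn_eq0/= => /eqP.
Qed.

Lemma fejerN x : fejer (- x) = fejer x.
Proof. by apply: eq_Rintegral => xi _; rewrite mulrN cosN. Qed.

(** The sign [s] treats the two slopes of the triangle at once; the right-hand side is the increment
    of an antiderivative found by parts. *)
Lemma fejer_half (s x : R) : x != 0 -> s ^+ 2 = 1 ->
  forall a b, a < b -> {in `[a, b], forall xi, fejer_hat xi = 1 - s * xi / l} ->
  (\int[mu]_(xi in `[a, b]) (fejer_hat xi * cos (xi * x)))%R =
  ((1 - s * b / l) * sin (b * x) / x - s * cos (b * x) / (l * x ^+ 2)) -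
  ((1 - s * a / l) * sin (a * x) / x - s * cos (a * x) / (l * x ^+ 2)).
Proof.
move=> x0 s1 a b ab kE.
pose F (xi : R) := (1 - s * xi / l) * (sin (xi * x) / x) - s * cos (xi * x) / (l * x ^+ 2).
pose f (xi : R) := (1 - s * xi / l) * cos (xi * x).
have dF (y : R) : is_derive y 1 F (f y).
  have dm : is_derive y 1 (fun xi : R => xi * x) x.
    refine (is_derive_eq (is_derive_funM (is_derive_id y 1) (is_derive_cst x y 1)) _).
    by rewrite mul1r mulr0 addr0.
  have ds := @is_derive_fun_comp R sin _ y _ _ (is_derive_sin (y * x)) dm.
  have dc := @is_derive_fun_comp R cos _ y _ _ (is_derive_cos (y * x)) dm.
  have dl : is_derive y 1 (fun xi : R => 1 - s * xi / l) (- (s / l)).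
    refine (is_derive_eq (is_derive_funB (is_derive_cst (1 : R) y 1) (is_derive_funM
      (is_derive_funM (is_derive_cst s y 1) (is_derive_id y 1)) (is_derive_cst l^-1 y 1))) _).
    by rewrite /cst; ring.
  refine (is_derive_eq (is_derive_funB (is_derive_funM dl
     (is_derive_funM ds (is_derive_cst x^-1 y 1))) (is_derive_funM
     (is_derive_funM (is_derive_cst s y 1) dc) (is_derive_cst (l * x ^+ 2)^-1 y 1))) _).
  by rewrite /cst /f; field; rewrite x0 gt_eqF.
have cf : continuous f.
  move=> y; apply: cvgM.
    apply: cvgB; first exact: cvg_cst.
    by apply: cvgM; [apply: cvgM; [exact: cvg_cst|exact: cvg_id]|exact: cvg_cst].
  apply: continuous_comp; last exact: continuous_cos.
  by apply: cvgM; [exact: cvg_id|exact: cvg_cst].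
have cF : continuous F.
  by move=> y; apply/differentiable_continuous/derivable1_diffP/ex_derive.
rewrite (_ : (\int[mu]_(xi in `[a, b]) _)%R = (\int[mu]_(xi in `[a, b]) f xi)%R); last first.
  by apply: eq_Rintegral => xi; rewrite inE => /kE ->.
rewrite /Rintegral (@continuous_FTC2 R f F a b)//=.
- by rewrite /F !mulrA.
- exact: continuous_subspaceT.
- split.
  + by move=> y _; exact: ex_derive.
  + by apply: cvg_at_right_filter; exact: cF.
  + by apply: cvg_at_left_filter; exact: cF.
- by move=> y _; rewrite derive1E; exact: derive_val.
Qed.

Lemma fejerE x : x != 0 -> fejer x = 2 * (1 - cos (l * x)) / (l * x ^+ 2).
Proof.
move=> x0.
have fi : mu.-integrable setT (EFin \o (fun xi => fejer_hat xi * cos (xi * x))).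
  apply: integrable_fejer_hatM; last by move=> y; exact: cos_max.
  by apply: measurableT_comp => //; exact: measurable_funM.
have -> : fejer x = (\int[mu]_(xi in `[(- l)%R, l]) (fejer_hat xi * cos (xi * x)))%R.
  rewrite [RHS]Rintegral_mkcond; apply: eq_Rintegral => xi _.
  rewrite /patch; case: ifPn => //; rewrite notin_setE/= in_itv/= -ler_norml.
  by move=> /negP; rewrite -ltNge => /fejer_hat_out ->; rewrite mul0r.
have Nl0 : - l < 0 by rewrite oppr_lt0.
rewrite (@itv_bndbnd_setU _ _ _ (BRight (0 : R))) ?bnd_simp ?ltW//.
rewrite Rintegral_setU//; first last.
- rewrite disj_set2E; apply/eqP; rewrite -subset0 => y []/=.
  by rewrite !in_itv/= => /andP[_ y0] /andP[]; rewrite ltNge y0.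
- by apply: integrableS fi => //; exact: measurableU.
rewrite Rintegral_itv_obnd_cbnd; last first.
  by apply: integrableS fi.
rewrite (@fejer_half (-1))//; [|by rewrite sqrrN expr1n|]; last first.
  move=> y; rewrite in_itv/= => /andP[ly y0]; rewrite /fejer_hat (ler0_norm y0) mulN1r.
  by apply/max_idPr; rewrite subr_ge0 ler_pdivrMr// mul1r lerNl.
rewrite (@fejer_half 1)//; [|by rewrite expr1n|]; last first.
  move=> y; rewrite in_itv/= => /andP[y0 yl]; rewrite /fejer_hat (ger0_norm y0) mul1r.
  by apply/max_idPr; rewrite subr_ge0 ler_pdivrMr// mul1r.
rewrite mul0r sin0 cos0 (mulNr l x) sinN cosN.
by field; rewrite x0 gt_eqF.
Qed.

Lemma fejer_ge0 x : 0 <= fejer x.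
Proof.
have [->|x0] := eqVneq x 0.
  apply: Rintegral_ge0 => y _; rewrite mulr0 cos0 mulr1; exact: fejer_hat_ge0.
by rewrite fejerE// divr_ge0 ?(mulr_ge0 (ltW l0)) ?sqr_ge0// mulr_ge0// subr_ge0 cos_le1.
Qed.

Lemma measurable_fejer : measurable_fun setT fejer.
Proof.
rewrite (_ : fejer = fun x => if x == 0 then fejer 0 else
   2 * (1 - cos (l * x)) * (l * x ^+ 2)^-1); last first.
  by apply/funext => x; case: eqVneq => [->//|]; exact: fejerE.
apply: measurable_fun_ifT => //.
- by apply: measurable_fun_eqr.
- apply: measurable_funM.
    apply: measurable_funM => //; apply: measurable_funB => //.
    by apply: measurableT_comp => //; exact: measurable_funM.
  (* On nonnegative reals the inverse is the power of exponent [-1], whose measurability is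
     known. *)
  rewrite (_ : (fun x => _) = (@powR R ^~ (-1)) \o (fun x => l * x ^+ 2)).
    apply: measurableT_comp; first exact: measurable_powR.
    by apply: measurable_funM => //; exact: measurable_funX.
  by apply/funext => x /=; rewrite powR_inv1// (mulr_ge0 (ltW l0))// sqr_ge0.
Qed.

Lemma fejer_le x : x != 0 -> fejer x <= 4 / l * (x ^+ 2)^-1.
Proof.
move=> x0; rewrite fejerE// invfM mulrA ler_wpM2r ?invr_ge0 ?sqr_ge0//.
rewrite ler_wpM2r ?invr_ge0 ?(ltW l0)//.
by have := cos_geN1 (l * x); lra.
Qed.

Lemma cvg_expRN_lin (c : R) : 0 < c -> expR (- (t * c)) @[t --> +oo] --> 0.
Proof.
move=> c0.
have h : t * c @[t --> +oo] --> +oo by apply: gt0_cvgMly => //; exact: cvg_id.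
exact: (cvg_comp _ _ h (@cvgr_expR R)).
Qed.

Lemma integral_texp x : 0 < x ->
  (\int[mu]_(t in `[0%R, +oo[) (t * expR (- (t * x)))%:E = ((x ^+ 2)^-1)%:E)%E.
Proof.
move=> x0.
pose F t := - ((t / x + (x ^+ 2)^-1) * expR (- (t * x))).
have dF (y : R) : is_derive y 1 F (y * expR (- (y * x))).
  have dm : is_derive y 1 (fun t : R => - (t * x)) (- x).
    refine (is_derive_eq (is_deriveN (is_derive_funM (is_derive_id y 1) (is_derive_cst x y 1))) _).
    by rewrite mul1r mulr0 addr0.
  have de := @is_derive_fun_comp R expR _ y _ _ (is_derive_expR _) dm.
  refine (is_derive_eq (is_deriveN (is_derive_funM (is_derive_funD
    (is_derive_funM (is_derive_id y 1) (is_derive_cst x^-1 y 1))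
    (is_derive_cst (x ^+ 2)^-1 y 1)) de)) _).
  by rewrite /cst; field; rewrite gt_eqF.
have cF : continuous F.
  by move=> y; apply/differentiable_continuous/derivable1_diffP/ex_derive.
have cf : continuous (fun t : R => t * expR (- (t * x))).
  move=> y; apply: cvgM; first exact: cvg_id.
  apply: continuous_comp; last exact: continuous_expR.
  by apply: cvgN; apply: cvgM; [exact: cvg_id|exact: cvg_cst].
rewrite (@ge0_continuous_FTC2y R _ F 0 0).
- by rewrite /F !mul0r oppr0 expR0 mulr1 -EFinB; congr EFin; ring.
- by move=> y y0; rewrite mulr_ge0// expR_ge0.
- exact: continuous_subspaceT.
(* Half of the exponential absorbs the linear factor, by [t x / 2 <= exp (t x / 2)]. *)
- have h1 : (2 / x ^+ 2) * expR (- (t * (x / 2))) + (x ^+ 2)^-1 * expR (- (t * x))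
      @[t --> +oo] --> (2 / x ^+ 2) * 0 + (x ^+ 2)^-1 * 0.
    apply: cvgD; apply: cvgMr; apply: cvg_expRN_lin => //.
    by rewrite divr_gt0.
  rewrite !mulr0 addr0 in h1.
  rewrite -oppr0; apply: cvgN.
  apply: (@squeeze_cvgr _ _ _ _ (cst 0) _ _ _ _ _ h1); last exact: cvg_cst.
  near=> t.
  have t0 : 0 < t by near: t; exact: nbhs_pinfty_gt.
  rewrite mulr_ge0 ?expR_ge0 ?addr_ge0 ?divr_ge0 ?invr_ge0 ?sqr_ge0 ?(ltW t0) ?(ltW x0)//=.
  rewrite mulrDl lerD2r.
  have -> : expR (- (t * x)) = expR (- (t * (x / 2))) * expR (- (t * (x / 2))).
    by rewrite -expRD; congr expR; lra.
  rewrite [leLHS]mulrA ler_wpM2r ?expR_ge0//.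
  rewrite expRN ler_pdivrMr ?expR_gt0//.
  have := expR_ge1Dx (t * (x / 2)) => h.
  apply: (@le_trans _ _ (2 / x ^+ 2 * (t * (x / 2)))).
    by rewrite le_eqVlt; apply/orP; left; apply/eqP; field; rewrite gt_eqF.
  by rewrite ler_wpM2l ?divr_ge0 ?sqr_ge0//; lra.
- by move=> y _; exact: ex_derive.
- by apply: cvg_at_right_filter; exact: cF.
- by move=> y _; rewrite derive1E; exact: derive_val.
Unshelve. all: by end_near. Qed.

(** The Laplace transform of [1 - cos (l x)], times [t]. It is the inner integral in the other order
    when the mass of the kernel is computed, and what it leaves in [t] integrates to an
    arctangent. *)
Lemma integral_1mcos t : 0 < t ->
  (\int[mu]_(x in `[0%R, +oo[) ((1 - cos (l * x)) * (t * expR (- (t * x))))%:E =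
   (l ^+ 2 / (t ^+ 2 + l ^+ 2))%:E)%E.
Proof.
move=> t0.
have tl : 0 < t ^+ 2 + l ^+ 2 by rewrite addr_gt0// exprn_gt0.
pose F x := ((t * (t ^+ 2 + l ^+ 2)^-1) * (t * cos (l * x) - l * sin (l * x)) - 1) *
            expR (- (t * x)).
pose f x := (1 - cos (l * x)) * (t * expR (- (t * x))).
have dF (y : R) : is_derive y 1 F (f y).
  have dm (a : R) : is_derive y 1 (fun x : R => a * x) a.
    refine (is_derive_eq (is_derive_funM (is_derive_cst a y 1) (is_derive_id y 1)) _).
    by rewrite mul0r add0r mulr1.
  have de := @is_derive_fun_comp R expR _ y _ _ (is_derive_expR (- (t * y))) (is_deriveN (dm t)).
  have ds := @is_derive_fun_comp R sin _ y _ _ (is_derive_sin (l * y)) (dm l).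
  have dc := @is_derive_fun_comp R cos _ y _ _ (is_derive_cos (l * y)) (dm l).
  refine (is_derive_eq (is_derive_funM (is_derive_funB (is_derive_funM
    (is_derive_cst (t * (t ^+ 2 + l ^+ 2)^-1) y 1) (is_derive_funB
      (is_derive_funM (is_derive_cst t y 1) dc)
      (is_derive_funM (is_derive_cst l y 1) ds))) (is_derive_cst (1 : R) y 1)) de) _).
  by rewrite /cst /f; field; rewrite gt_eqF.
have cF : continuous F.
  by move=> y; apply/differentiable_continuous/derivable1_diffP/ex_derive.
have clin (a : R) : continuous (fun x => a * x).
  by move=> y; apply: cvgM; [exact: cvg_cst|exact: cvg_id].
have cf : continuous f.
  move=> y; apply: cvgM.
    apply: cvgB; first exact: cvg_cst.
    by apply: continuous_comp; [exact: clin|exact: continuous_cos].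
  apply: cvgM; first exact: cvg_cst.
  apply: continuous_comp; last exact: continuous_expR.
  by apply: cvgN; exact: clin.
rewrite (@ge0_continuous_FTC2y R f F 0 0).
- rewrite /F !mulr0 cos0 sin0 oppr0 expR0 !mulr1 mulr0 subr0 -EFinB; congr EFin.
  by field; rewrite gt_eqF.
- move=> y y0; rewrite /f mulr_ge0// ?subr_ge0 ?cos_le1// mulr_ge0 ?expR_ge0//.
  exact: ltW.
- exact: continuous_subspaceT.
- apply: norm_cvg0.
  pose B := t / (t ^+ 2 + l ^+ 2) * (t + l) + 1.
  have h1 : B * expR (- (x * t)) @[x --> +oo] --> B * 0.
    by apply: cvgMr; exact: cvg_expRN_lin.
  rewrite mulr0 in h1.
  apply: (@squeeze_cvgr _ _ _ _ (cst 0) _ _ _ _ _ h1); last exact: cvg_cst.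
  apply: nearW => x; rewrite normr_ge0/= normrM (ger0_norm (expR_ge0 _)) [t * x]mulrC.
  rewrite ler_wpM2r ?expR_ge0//.
  rewrite (le_trans (ler_normB _ _))// normr1 lerD2r normrM.
  have k0 : 0 <= t / (t ^+ 2 + l ^+ 2) by rewrite divr_ge0// ltW.
  rewrite (ger0_norm k0) ler_wpM2l// (le_trans (ler_normB _ _))// !normrM.
  rewrite (gtr0_norm t0) (gtr0_norm l0) lerD// ler_piMr ?cos_max ?sin_max ?(ltW t0) ?(ltW l0)//.
- by move=> y _; exact: ex_derive.
- by apply: cvg_at_right_filter; exact: cF.
- by move=> y _; rewrite derive1E; exact: derive_val.
Qed.

Lemma integral_cauchy :
  (\int[mu]_(t in `[0%R, +oo[) (l ^+ 2 / (t ^+ 2 + l ^+ 2))%:E = (l * (pi / 2))%:E)%E.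
Proof.
pose F t := l * atan (t / l).
pose f t := l ^+ 2 / (t ^+ 2 + l ^+ 2).
have tl (t : R) : t ^+ 2 + l ^+ 2 != 0.
  by rewrite gt_eqF// ltr_wpDl ?sqr_ge0// exprn_gt0.
have dF (y : R) : is_derive y 1 F (f y).
  have dm : is_derive y 1 (fun t : R => t / l) l^-1.
    refine (is_derive_eq (is_derive_funM (is_derive_id y 1) (is_derive_cst l^-1 y 1)) _).
    by rewrite mul1r mulr0 addr0.
  have da := @is_derive_fun_comp R atan _ y _ _ (is_derive1_atan (y / l)) dm.
  refine (is_derive_eq (is_derive_funM (is_derive_cst l y 1) da) _).
  rewrite /cst /f mul0r add0r.
  have -> : 1 + (y / l) ^+ 2 = (y ^+ 2 + l ^+ 2) / l ^+ 2 by field; rewrite gt_eqF.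
  by field; rewrite tl gt_eqF.
have cF : continuous F.
  by move=> y; apply/differentiable_continuous/derivable1_diffP/ex_derive.
have cf : continuous f.
  move=> y; apply: cvgM; first exact: cvg_cst.
  apply: cvgV; first exact: tl.
  apply: cvgD; last exact: cvg_cst.
  exact: exprn_continuous.
rewrite (@ge0_continuous_FTC2y R f F 0 (l * (pi / 2))).
- by rewrite /F mul0r atan0 mulr0 sube0.
- by move=> y y0; rewrite /f divr_ge0 ?sqr_ge0// addr_ge0// sqr_ge0.
- exact: continuous_subspaceT.
- apply: cvgMr.
  have h : t / l @[t --> +oo] --> +oo.
    by apply: gt0_cvgMly; [rewrite invr_gt0|exact: cvg_id].
  exact: (cvg_comp _ _ h (@cvgy_atan R)).
- by move=> y _; exact: ex_derive.
- by apply: cvg_at_right_filter; exact: cF.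
- by move=> y _; rewrite derive1E; exact: derive_val.
Qed.

(* Tonelli applied to [x^-2 = \int_0^oo t exp (- t x) dt]. *)
Lemma integral_fejer_half :
  (\int[mu]_(x in `]0%R, +oo[) (fejer x)%:E = pi%:E)%E.
Proof.
pose f (z : R * R) : R := (\1_(`]0, +oo[%classic) z.1 * \1_(`]0, +oo[%classic) z.2) *
   ((1 - cos (l * z.1)) * (z.2 * expR (- (z.2 * z.1)))).
have mf : measurable_fun setT (EFin \o f).
  apply/measurable_EFinP; apply: measurable_funM.
    apply: measurable_funM; apply: measurableT_comp => //; exact: measurable_indic.
  apply: measurable_funM.
    apply: measurable_funB => //; apply: measurableT_comp => //.
    exact: measurable_funM.
  apply: measurable_funM => //; apply: measurableT_comp => //.
  apply: measurableT_comp => //; exact: measurable_funM.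
have f0 z : (0 <= (EFin \o f) z)%E.
  rewrite /= lee_fin /f !indicE.
  have [_|_] := boolP (z.1 \in `]0, +oo[%classic); last by rewrite !mul0r.
  have [|_] := boolP (z.2 \in `]0, +oo[%classic); last by rewrite mulr0 mul0r.
  rewrite inE/= in_itv/= andbT => z20.
  by rewrite !mul1r mulr_ge0 ?subr_ge0 ?cos_le1// mulr_ge0 ?expR_ge0// ltW.
have h1 x : (\int[mu]_t (f (x, t))%:E =
    ((fun x => (l / 2 * fejer x)%:E) \_ `]0%R, +oo[) x)%E.
  rewrite /patch; case: ifPn => x0; last first.
    rewrite [RHS](_ : _ = 0%E)// integral0_eq// => t _.
    by rewrite /f /= indicE (negbTE x0) !mul0r.
  have x0' : 0 < x by move: x0; rewrite inE/= in_itv/= andbT.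
  transitivity (\int[mu]_(t in `]0%R, +oo[) ((1 - cos (l * x))%:E * (t * expR (- (t * x)))%:E))%E.
    rewrite [RHS]integral_mkcond; apply: eq_integral => t _.
    rewrite /f /= indicE x0 mul1r /patch indicE; case: ifPn => _; last by rewrite mul0r.
    by rewrite mul1r EFinM.
  rewrite ge0_integralZl_EFin//.
  - rewrite integral_itv_obnd_cbnd; last first.
      apply/measurable_EFinP; apply: measurable_funM => //.
      apply: measurableT_comp => //; apply: measurable_funN.
      exact: measurable_funM.
    rewrite integral_texp// fejerE ?gt_eqF// -EFinM; congr EFin.
    by field; rewrite !gt_eqF.
  - by move=> t; rewrite /= in_itv/= andbT => t0; rewrite lee_fin mulr_ge0 ?expR_ge0// ltW.
  - apply/measurable_EFinP; apply: measurable_funM => //.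
    apply: measurableT_comp => //; apply: measurable_funN.
    exact: measurable_funM.
have h2 t : (\int[mu]_x (f (x, t))%:E =
    ((fun t => (l ^+ 2 / (t ^+ 2 + l ^+ 2))%:E) \_ `]0%R, +oo[) t)%E.
  rewrite /patch; case: ifPn => t0; last first.
    rewrite [RHS](_ : _ = 0%E)// integral0_eq// => x _.
    by rewrite /f /= [X in _ * X * _]indicE (negbTE t0) mulr0 mul0r.
  have t0' : 0 < t by move: t0; rewrite inE/= in_itv/= andbT.
  rewrite -(integral_1mcos t0') -integral_itv_obnd_cbnd; last first.
    apply/measurable_EFinP; apply: measurable_funM.
      by apply: measurable_funB => //; apply: measurableT_comp => //; exact: measurable_funM.
    apply: measurable_funM => //; apply: measurableT_comp => //; apply: measurable_funN.
    exact: measurable_funM.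
  rewrite [RHS]integral_mkcond; apply: eq_integral => x _.
  rewrite /f /= [X in _ * X * _]indicE t0 mulr1 /patch indicE.
  by case: ifPn => _; rewrite ?mul1r ?mul0r.
have := @fubini_tonelli _ _ _ _ _ mu mu (EFin \o f) mf f0.
under eq_integral do rewrite h1.
under [in X in _ = X -> _]eq_integral do rewrite h2.
rewrite -!integral_mkcond.
rewrite [X in _ = X -> _]integral_itv_obnd_cbnd; last first.
  apply/measurable_EFinP; apply: measurable_funM => //.
  apply: measurable_funTS; apply: continuous_measurable_fun => y.
  apply: cvgV; first by rewrite gt_eqF// ltr_wpDl ?sqr_ge0// exprn_gt0.
  by apply: cvgD; [exact: exprn_continuous|exact: cvg_cst].
rewrite integral_cauchy.
under eq_integral do rewrite EFinM.
rewrite ge0_integralZl_EFin//; last 3 first.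
- by move=> x _; rewrite lee_fin fejer_ge0.
- by apply/measurable_EFinP/measurable_funTS; exact: measurable_fejer.
- by rewrite divr_ge0// ltW.
move=> h.
have l2 : l / 2 != 0 by rewrite mulf_neq0 ?gt_eqF// invr_gt0.
have := congr1 (fun x => ((l / 2)^-1)%:E * x)%E h.
rewrite muleA -!EFinM mulVf// mul1e => ->; congr EFin.
by field; rewrite gt_eqF.
Qed.

Lemma integral_fejer : (\int[mu]_x (fejer x)%:E = (2 * pi)%:E)%E.
Proof.
rewrite ge0_integral_even.
- by rewrite integral_fejer_half -EFinM.
- by apply/measurable_EFinP; exact: measurable_fejer.
- by move=> x; rewrite lee_fin fejer_ge0.
- by move=> x; rewrite fejerN.
Qed.

Lemma integral_inv_sqr (e : R) : 0 < e ->
  (\int[mu]_(x in `[e, +oo[) ((x ^+ 2)^-1)%:E = e^-1%:E)%E.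
Proof.
move=> e0.
pose F (x : R) := - x^-1.
have dF (y : R) : e <= y -> is_derive y 1 F (y ^+ 2)^-1.
  move=> ey; have y0 : y != 0 by rewrite gt_eqF// (lt_le_trans e0).
  refine (is_derive_eq (is_deriveN (@is_derive_funV R id y 1 y0 (is_derive_id y 1))) _).
  by rewrite mulN1r opprK.
have cf (y : R) : e <= y -> {for y, continuous (fun x : R => (x ^+ 2)^-1)}.
  move=> ey; apply: cvgV; last exact: exprn_continuous.
  by rewrite expf_neq0// gt_eqF// (lt_le_trans e0).
rewrite (@ge0_continuous_FTC2y R _ F e 0).
- by rewrite /F EFinN oppeK add0e.
- by move=> y y0; rewrite invr_ge0 sqr_ge0.
- apply/continuous_within_itvcyP; split.
    by move=> x; rewrite in_itv/= andbT => /ltW ex; exact: cf.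
  by apply: cvg_at_right_filter; exact: cf.
- rewrite -oppr0; apply: cvgN.
  apply/cvgrPdist_le => d d0; near=> x.
  have x0 : 0 < x by near: x; exact: nbhs_pinfty_gt.
  rewrite sub0r normrN gtr0_norm ?invr_gt0// invf_ple ?posrE//.
- by move=> y /ltW /dF ?; exact: ex_derive.
- apply: cvg_at_right_filter.
  by apply/differentiable_continuous/derivable1_diffP; have ? := dF e (lexx e); exact: ex_derive.
- move=> y; rewrite in_itv/= andbT => /ltW /dF ?.
  by rewrite derive1E; exact: derive_val.
Unshelve. all: by end_near. Qed.

(** The kernel is at most [4 / (l x^2)], so each tail beyond [e] has mass at most [4 / (l e)]. The
    kernel concentrates in the window once [l e] is large. *)
Lemma integral_fejer_window (e : R) : 0 < e ->
  ((2 * pi - 8 / (l * e))%:E <= \int[mu]_(x in `[(- e)%R, e]) (fejer x)%:E)%E.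
Proof.
move=> e0.
have mF (D : set R) : measurable_fun D (EFin \o fejer).
  by apply/measurable_EFinP; apply: measurable_funTS; exact: measurable_fejer.
have F0 x : (0 <= (fejer x)%:E)%E by rewrite lee_fin fejer_ge0.
pose g : R -> \bar R := (fun x => (fejer x)%:E) \_ `[(- e)%R, e].
have -> : (\int[mu]_(x in `[(- e)%R, e]) (fejer x)%:E =
    2%:E * \int[mu]_(x in `]0%R, e]) (fejer x)%:E)%E.
  rewrite integral_mkcond ge0_integral_even.
  - congr *%E; rewrite -/g.
    rewrite [LHS]integral_mkcond [RHS]integral_mkcond.
    apply: eq_integral => x _; rewrite /g /patch !mem_setE !in_itv/= andbT.
    case: (ltP 0 x) => x0 //=.
    by rewrite (le_trans _ (ltW x0))// lerNl oppr0 ltW.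
  - apply/measurable_restrict => //; exact: measurable_funTS (mF setT).
  - by move=> x; rewrite /patch; case: ifP.
  - move=> x; rewrite /patch !mem_setE !in_itv/= fejerN lerNl opprK lerNl.
    by rewrite andbC.
have := integral_fejer_half.
rewrite (@itv_bndbnd_setU _ _ _ (BRight e)) ?bnd_simp ?(ltW e0)//.
rewrite ge0_integral_setU//; last 2 first.
- exact: mF.
- rewrite disj_set2E; apply/eqP; rewrite -subset0 => y []/=.
  by rewrite !in_itv/= => /andP[_ y0] /andP[]; rewrite ltNge y0.
have tail : (\int[mu]_(x in `]e, +oo[) (fejer x)%:E <= (4 / (l * e))%:E)%E.
  apply: (@le_trans _ _ (\int[mu]_(x in `]e, +oo[) ((4 / l)%:E * ((x ^+ 2)^-1)%:E))%E).
    apply: ge0_le_integral => //.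
    - exact: mF.
    - apply/measurable_EFinP; apply: measurable_funM => //.
      apply: open_continuous_measurable_fun => // x; rewrite inE/= in_itv/= andbT => ex.
      apply: cvgV; last exact: exprn_continuous.
      by rewrite expf_neq0// gt_eqF// (lt_trans e0).
    - move=> x; rewrite /= in_itv/= andbT => ex; rewrite -EFinM lee_fin.
      by apply: fejer_le; rewrite gt_eqF// (lt_trans e0).
  have mi : measurable_fun `]e, +oo[ (fun x : R => ((x ^+ 2)^-1)%:E).
    apply/measurable_EFinP; apply: open_continuous_measurable_fun => // x.
    rewrite inE/= in_itv/= andbT => ex.
    apply: cvgV; last exact: exprn_continuous.
    by rewrite expf_neq0// gt_eqF// (lt_trans e0).
  rewrite ge0_integralZl_EFin//; last 2 first.
  - by move=> x _; rewrite lee_fin invr_ge0 sqr_ge0.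
  - by rewrite divr_ge0// ltW.
  rewrite integral_itv_obnd_cbnd// integral_inv_sqr// -EFinM invfM mulrA lee_fin.
  by rewrite lexx.
have tf : (\int[mu]_(x in `]e, +oo[) (fejer x)%:E)%E \is a fin_num.
  by rewrite ge0_fin_numE ?integral_ge0// (le_lt_trans tail)// ltry.
rewrite -(fineK tf) lee_fin in tail.
rewrite -(fineK tf).
set A := (X in (X + _)%E = _ -> _).
rewrite -[X in (_ <= _ * X)%E]/A.
case: A => [r||]//= [h]; rewrite -EFinM lee_fin.
have -> : 8 / (l * e) = 2 * (4 / (l * e)) by rewrite mulrA; congr (_ / _); lra.
by lra.
Qed.

End fejer.

(** * Lebesgue measure and Gaussian integrals in the plane *)

Section plane_measure.
Variable R : realType.
Local Notation mu := (@lebesgue_measure R).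

(* The library only makes the product of two subprobabilities a sigma-finite
   measure, hence this separate constant. *)
Definition plane : set (measurableTypeR R * measurableTypeR R)%type -> \bar R :=
  (mu \x mu)%E.

Let plane0 : plane set0 = 0%E.
Proof. exact: (measure0 (mu \x mu)%E). Qed.

Let plane_ge0 A : (0 <= plane A)%E.
Proof. exact: (measure_ge0 (mu \x mu)%E). Qed.

Let plane_additive : semi_sigma_additive plane.
Proof. exact: (@measure_semi_sigma_additive _ _ _ (mu \x mu)%E). Qed.

HB.instance Definition _ := isMeasure.Build _ (measurableTypeR R * measurableTypeR R)%type R plane
  plane0 plane_ge0 plane_additive.

Let plane_sigma_finite : sigma_finite setT plane.
Proof.
pose I n := `[- n%:R, n%:R]%classic : set R.
exists (fun n => I n `*` I n).
  apply/esym; rewrite -subTset => -[x y] _.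
  exists (Num.bound (`|x| + `|y|)) => //.
  have h : `|x| + `|y| < (Num.bound (`|x| + `|y|))%:R by exact: archi_boundP.
  have hx := normr_ge0 x; have hy := normr_ge0 y.
  by split; rewrite /I/= in_itv/= -ler_norml; lra.
move=> n; split; first by apply: measurableX; exact: measurable_itv.
rewrite /plane product_measure1E; [|exact: measurable_itv|exact: measurable_itv].
have IE : (mu (I n) < +oo)%E.
  by rewrite /I lebesgue_measure_itv/=; case: ifP => _ //; rewrite -?EFinD ?ltry.
by apply: lte_mul_pinfty; rewrite ?ge0_fin_numE// measure_ge0.
Qed.

HB.instance Definition _ := Measure_isSigmaFinite.Build _ _ _ plane
  plane_sigma_finite.

End plane_measure.

Section plane.
Context {R : realType}.
Local Notation mu := (@lebesgue_measure R).
Local Notation leb2 := (@plane R).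

Local Open Scope ereal_scope.

Lemma ge0_integral_leb2 (f : R * R -> \bar R) : measurable_fun setT f ->
  (forall z, 0 <= f z) ->
  \int[leb2]_z f z = \int[mu]_u \int[mu]_v f (u, v).
Proof.
by move=> mf f0; have := @fubini_tonelli1 _ _ _ _ _ mu mu f mf f0.
Qed.

Lemma ge0_integral_leb2_sym (f : R * R -> \bar R) : measurable_fun setT f ->
  (forall z, 0 <= f z) ->
  \int[leb2]_z f z = \int[mu]_v \int[mu]_u f (u, v).
Proof.
by move=> mf f0; have := @fubini_tonelli2 _ _ _ _ _ mu mu f mf f0.
Qed.

Lemma ge0_integral_leb2M (f g : R -> R) :
  measurable_fun setT f -> measurable_fun setT g ->
  (forall x, (0 <= f x)%R) -> (forall x, (0 <= g x)%R) ->
  \int[leb2]_z (f z.1 * g z.2)%:E = (\int[mu]_u (f u)%:E) * (\int[mu]_v (g v)%:E).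
Proof.
move=> mf mg f0 g0.
rewrite ge0_integral_leb2//=.
- under eq_integral => u _.
    under eq_integral do rewrite EFinM.
    rewrite ge0_integralZl_EFin//; last 2 first.
    + by move=> x _; rewrite lee_fin.
    + exact/measurable_EFinP.
    over.
  rewrite ge0_integralZr//.
  + exact/measurable_EFinP.
  + by move=> x _; rewrite lee_fin.
  + by apply: integral_ge0 => x _; rewrite lee_fin.
- apply/measurable_EFinP; apply: measurable_funM; exact: measurableT_comp.
- by move=> z; rewrite lee_fin mulr_ge0.
Qed.

Lemma ge0_integral_scale2 (x : R) (f : R * R -> \bar R) : (0 < x)%R ->
  measurable_fun setT f -> (forall z, 0 <= f z) ->
  (x ^+ 2)%:E * \int[leb2]_z f (x * z.1, x * z.2)%R = \int[leb2]_z f z.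
Proof.
move=> x0 mf f0.
have mm : measurable_fun setT (fun z : R * R => (x * z.1, x * z.2)%R).
  by apply: measurable_fun_pair; apply: measurable_funM.
have mfx : measurable_fun setT (fun z : R * R => f (x * z.1, x * z.2)%R).
  exact: measurableT_comp.
rewrite (ge0_integral_leb2 mfx (fun z => f0 _)) (ge0_integral_leb2 mf f0) /=.
rewrite expr2 EFinM -muleA.
have mG : measurable_fun setT (fun u : R => \int[mu]_v f (u, v)).
  by apply: (@measurable_fun_fubini_tonelli_F _ _ _ _ _ mu f).
rewrite -(ge0_integral_affine 0 x0 mG); last by move=> y; exact: integral_ge0.
congr *%E.
have -> : \int[mu]_u \int[mu]_v f (x * u, x * v)%R =
    \int[mu]_u ((x^-1)%:E * \int[mu]_v f (x * u + 0, v)%R).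
  apply: eq_integral => u _; rewrite addr0.
  have mfu : measurable_fun setT (fun v : R => f (x * u, v)%R).
    by apply: measurableT_comp => //; exact: measurable_pair1.
  rewrite -(ge0_integral_affine 0 x0 mfu)// muleA -EFinM mulVf ?gt_eqF// mul1e.
  by apply: eq_integral => v _; rewrite addr0.
rewrite ge0_integralZl_EFin; first by rewrite muleA -EFinM divff ?gt_eqF// mul1e.
- by [].
- by move=> u _; apply: integral_ge0.
- by apply: (measurableT_comp mG); apply: measurable_funD.
- by rewrite invr_ge0 ltW.
Qed.

Lemma ge0_integral_sub2 (c : R * R) (f : R * R -> \bar R) :
  measurable_fun setT f -> (forall z, 0 <= f z) ->
  \int[leb2]_z f (c.1 - z.1, c.2 - z.2)%R = \int[leb2]_z f z.
Proof.
move=> mf f0.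
have mm : measurable_fun setT (fun z : R * R => (c.1 - z.1, c.2 - z.2)%R).
  by apply: measurable_fun_pair; apply: measurable_funB.
have mfx : measurable_fun setT (fun z : R * R => f (c.1 - z.1, c.2 - z.2)%R).
  exact: measurableT_comp.
rewrite (ge0_integral_leb2 mfx (fun z => f0 _)) (ge0_integral_leb2 mf f0) /=.
have mG : measurable_fun setT (fun u : R => \int[mu]_v f (u, v)).
  by apply: (@measurable_fun_fubini_tonelli_F _ _ _ _ _ mu f).
rewrite -(ge0_integral_sub c.1 mG); last by move=> y; exact: integral_ge0.
apply: eq_integral => u _.
have mfu : measurable_fun setT (fun v : R => f (c.1 - u, v)%R).
  by apply: measurableT_comp => //; exact: measurable_pair1.
by rewrite -(ge0_integral_sub c.2 mfu).
Qed.

Lemma Rintegral_scale2 (x : R) (f : R * R -> R) : (0 < x)%R ->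
  leb2.-integrable setT (EFin \o f) ->
  (x ^+ 2 * \int[leb2]_z f (x * z.1, x * z.2) = \int[leb2]_z f z)%R.
Proof.
move=> x0 fi.
have mf : measurable_fun setT (EFin \o f) by case/integrableP: fi.
have mm : measurable_fun setT (fun z : R * R => (x * z.1, x * z.2)%R).
  by apply: measurable_fun_pair; apply: measurable_funM.
have fxi : leb2.-integrable setT (EFin \o (fun z => f (x * z.1, x * z.2)%R)).
  apply/integrableP; split; first exact: (measurableT_comp mf mm).
  have /integrableP[_] := fi.
  have mn : measurable_fun setT (fun z => `|(f z)%:E|) by exact: measurableT_comp.
  rewrite -(ge0_integral_scale2 x0 mn)//.
  set A := \int[_]_ _ _; set B := (X in _ -> X < _).
  have -> : B = A by [].
  have A0 : 0 <= A by apply: integral_ge0.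
  by case: A @B A0 => [r| |] //= _; rewrite ?ltry// gt0_muley// lte_fin exprn_gt0.
have x2 : (0 < x ^+ 2)%R by rewrite exprn_gt0.
apply: EFin_inj; rewrite EFinM -!EFin_Rintegral//.
rewrite integralE [RHS]integralE muleBr//; last first.
  apply: fin_num_adde_defr.
  exact: integrable_pos_fin_num.
congr (_ - _).
- rewrite -[RHS](ge0_integral_scale2 x0); [|exact: measurable_funepos|by []].
  by congr *%E; apply: eq_integral => z _; rewrite !funeposE.
- rewrite -[RHS](ge0_integral_scale2 x0); [|exact: measurable_funeneg|by []].
  by congr *%E; apply: eq_integral => z _; rewrite !funenegE.
Qed.

End plane.

Section gauss2.
Context {R : realType}.
Local Notation mu := (@lebesgue_measure R).
Local Notation leb2 := (@plane R).
Local Open Scope ereal_scope.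

Lemma integral_gauss_affine (s m : R) : (0 < s)%R ->
  \int[mu]_x (expR (- (s * (x + m) ^+ 2 / 2)))%:E = (Num.sqrt pi / Num.sqrt (s / 2))%:E.
Proof.
move=> s0.
have k0 : (0 < Num.sqrt (s / 2))%R by rewrite sqrtr_gt0 divr_gt0.
have mg : measurable_fun setT (fun x : R => (gauss_fun x)%:E).
  by apply/measurable_EFinP; exact: measurable_gauss_fun.
have := ge0_integral_affine (Num.sqrt (s / 2) * m) k0 mg.
rewrite integralT_gauss => /(_ (fun x => gauss_fun_ge0 x)) h.
have e : (fun x : R => (gauss_fun (Num.sqrt (s / 2) * x + Num.sqrt (s / 2) * m)%R)%:E) =
   (fun x : R => (expR (- (s * (x + m) ^+ 2 / 2)))%:E).
  apply/funext => x; congr EFin; rewrite /gauss_fun -mulrDr exprMn sqr_sqrtr.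
    by congr expR; ring.
  by rewrite divr_ge0// ltW.
rewrite e in h.
rewrite EFinM muleC -h muleA -EFinM mulVf ?mul1e//; exact: lt0r_neq0.
Qed.

(** Completing the square in the first variable leaves the Schur complement [d = (a c - b^2) / a] as
    coefficient in the second, hence a product of two one-dimensional Gaussian integrals. *)
Lemma integral_gauss2 (a b c : R) : (0 < a)%R -> (0 < a * c - b ^+ 2)%R ->
  \int[leb2]_z (expR (- ((a * z.1 ^+ 2 + 2 * b * z.1 * z.2 + c * z.2 ^+ 2) / 2)))%:E =
  (2 * pi / Num.sqrt (a * c - b ^+ 2))%:E.
Proof.
move=> a0 d0.
have mf : measurable_fun setT (fun z : R * R =>
    (expR (- ((a * z.1 ^+ 2 + 2 * b * z.1 * z.2 + c * z.2 ^+ 2) / 2)))%:E).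
  apply/measurable_EFinP; apply: measurableT_comp => //; apply: measurableT_comp => //.
  apply: measurable_funM => //.
  apply: measurable_funD; first apply: measurable_funD; apply: measurable_funM => //.
  - exact: measurable_funX.
  - by apply: measurable_funM.
  - exact: measurable_funX.
have f0 (z : R * R) : 0 <= (expR (- ((a * z.1 ^+ 2 + 2 * b * z.1 * z.2 + c * z.2 ^+ 2) / 2)))%:E.
  by rewrite lee_fin expR_ge0.
rewrite (ge0_integral_leb2_sym mf f0) /=.
have an0 : (a != 0)%R by rewrite gt_eqF.
pose d := ((a * c - b ^+ 2) / a)%R.
have d1 : (0 < d)%R by rewrite divr_gt0.
have inner (v : R) : \int[mu]_u (expR (- ((a * u ^+ 2 + 2 * b * u * v + c * v ^+ 2) / 2)))%:E =
    (Num.sqrt pi / Num.sqrt (a / 2))%:E * (expR (- (d * (v + 0) ^+ 2 / 2)))%:E.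
  rewrite -(integral_gauss_affine (b * v / a) a0) muleC.
  rewrite -ge0_integralZl_EFin//.
  - apply: eq_integral => u _; rewrite -EFinM -expRD; congr EFin; congr expR.
    by rewrite /d; field.
  - apply/measurable_EFinP; apply: measurableT_comp => //; apply: measurableT_comp => //.
    apply: measurable_funM => //; apply: measurable_funM => //.
    by apply: measurable_funX; exact: measurable_funD.
under eq_integral do rewrite inner.
rewrite ge0_integralZl_EFin//.
- rewrite integral_gauss_affine// -EFinM; congr EFin.
  rewrite mulrACA -expr2 sqr_sqrtr ?pi_ge0// -invfM -sqrtrM ?divr_ge0 ?(ltW a0)//.
  have -> : (a / 2 * (d / 2) = (a * c - b ^+ 2) / 2 ^+ 2)%R by rewrite /d; field.
  rewrite sqrtrM ?(ltW d0)// sqrtrV ?exprn_ge0// sqrtr_sqr ger0_norm//.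
  have s0 : (Num.sqrt (a * c - b ^+ 2) != 0)%R by rewrite gt_eqF// sqrtr_gt0.
  by field.
- apply/measurable_EFinP; apply: measurableT_comp => //; apply: measurableT_comp => //.
  apply: measurable_funM => //; apply: measurable_funM => //.
  by apply: measurable_funX; exact: measurable_funD.
Qed.

Lemma integrable_gauss2 (k : R) : (0 < k)%R ->
  leb2.-integrable setT (EFin \o (fun z : R * R => expR (- (k * (z.1 ^+ 2 + z.2 ^+ 2))))).
Proof.
move=> k0.
have mg : measurable_fun setT (fun z : R * R => expR (- (k * (z.1 ^+ 2 + z.2 ^+ 2)))).
  apply: measurableT_comp => //; apply: measurableT_comp => //.
  by apply: measurable_funM => //; apply: measurable_funD; exact: measurable_funX.
apply/integrableP; split; first exact/measurable_EFinP.
(* The diagonal form with both coefficients [2 k]. *)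
rewrite (_ : \int[_]_ _ _ = (2 * pi / Num.sqrt ((2 * k) * (2 * k) - 0 ^+ 2))%:E); last first.
  rewrite -integral_gauss2; [|by rewrite mulr_gt0|]; last first.
    by rewrite expr0n subr0 mulr_gt0// mulr_gt0.
  apply: eq_integral => z _; rewrite /= ger0_norm ?expR_ge0//; congr EFin.
  by congr expR; field.
exact: ltry.
Qed.

End gauss2.

(** * The planar kernel and the smoothed law of the walk *)

Section kernel2.
Context {R : realType}.
Local Notation mu := (@lebesgue_measure R).
Local Notation leb2 := (@plane R).
Variable l : R.
Hypothesis l0 : 0 < l.

Definition fejer_hat2 (z : R * R) : R := fejer_hat l z.1 * fejer_hat l z.2.
Definition fejer2 (x : R * R) : R := fejer l x.1 * fejer l x.2.

Lemma fejer_hat2_ge0 z : 0 <= fejer_hat2 z.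
Proof. by rewrite mulr_ge0// fejer_hat_ge0. Qed.

Lemma fejer_hat2_le1 z : fejer_hat2 z <= 1.
Proof.
by rewrite mulr_ile1// ?fejer_hat_ge0// fejer_hat_le1.
Qed.

Lemma fejer_hat2_out z : ~~ ((`|z.1| <= l) && (`|z.2| <= l)) -> fejer_hat2 z = 0.
Proof.
rewrite negb_and -!ltNge /fejer_hat2 => /orP[/(fejer_hat_out l0) ->|/(fejer_hat_out l0) ->].
  by rewrite mul0r.
by rewrite mulr0.
Qed.

Lemma fejer2_ge0 x : 0 <= fejer2 x.
Proof. by rewrite mulr_ge0// fejer_ge0. Qed.

Lemma measurable_fejer_hat2 : measurable_fun setT fejer_hat2.
Proof.
by apply: measurable_funM; apply: measurableT_comp => //; exact: measurable_fejer_hat.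
Qed.

Lemma measurable_fejer2 : measurable_fun setT fejer2.
Proof.
by apply: measurable_funM; apply: measurableT_comp => //; exact: measurable_fejer.
Qed.

Lemma integral_fejer2 : (\int[leb2]_z (fejer2 z)%:E = ((2 * pi) ^+ 2)%:E)%E.
Proof.
rewrite ge0_integral_leb2M; [|exact: measurable_fejer|exact: measurable_fejer|
  by move=> x; exact: fejer_ge0|by move=> x; exact: fejer_ge0].
by rewrite integral_fejer// -EFinM expr2.
Qed.

Lemma integrable_fejer_hat2 : leb2.-integrable setT (EFin \o fejer_hat2).
Proof.
apply/integrableP; split; first by apply/measurable_EFinP; exact: measurable_fejer_hat2.
under eq_integral do rewrite /= ger0_norm ?fejer_hat2_ge0//.
rewrite ge0_integral_leb2M; [|exact: measurable_fejer_hat|exact: measurable_fejer_hat|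
  by move=> x; exact: fejer_hat_ge0|by move=> x; exact: fejer_hat_ge0].
rewrite EFin_Rintegral ?ltry//; exact: integrable_fejer_hat.
Qed.

Lemma integrable_fejer_hat2M (f : R * R -> R) (M : R) : measurable_fun setT f ->
  (forall x, `|f x| <= M) ->
  leb2.-integrable setT (EFin \o (fun z => fejer_hat2 z * f z)).
Proof.
move=> mf f1; apply: le_integrableR (integrableRZl M integrable_fejer_hat2).
  by apply: measurable_funM => //; exact: measurable_fejer_hat2.
move=> x; rewrite normrM (ger0_norm (fejer_hat2_ge0 _)) mulrC ler_wpM2r//.
exact: fejer_hat2_ge0.
Qed.

Let mcos : measurable_fun setT (@cos R).
Proof. exact: continuous_measurable_fun (@continuous_cos R). Qed.
Let msin : measurable_fun setT (@sin R).
Proof. exact: continuous_measurable_fun (@continuous_sin R). Qed.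

(** Expanding the cosine of the sum, the product of sines drops out because the triangle is even;
    the product of cosines factors. *)
Lemma fejer2_fourier x : fejer2 x =
  (\int[leb2]_z (fejer_hat2 z * cos (z.1 * x.1 + z.2 * x.2)))%R.
Proof.
pose f (z : R * R) := (fejer_hat2 z * cos (z.1 * x.1 + z.2 * x.2))%:E.
have fi : leb2.-integrable setT f.
  apply: (@integrable_fejer_hat2M _ 1); last by move=> z; exact: cos_max.
  apply: measurableT_comp => //; apply: measurable_funD; exact: measurable_funM.
have ik y : mu.-integrable setT (EFin \o (fun v => fejer_hat l v * cos (v * y))).
  apply: integrable_fejer_hatM => //; last by move=> z; exact: cos_max.
  by apply: measurableT_comp => //; exact: measurable_funM.
have iS y : mu.-integrable setT (EFin \o (fun v => fejer_hat l v * sin (v * y))).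
  apply: integrable_fejer_hatM => //; last by move=> z; exact: sin_max.
  by apply: measurableT_comp => //; exact: measurable_funM.
rewrite /Rintegral -(@integral12_prod_meas1 _ _ _ _ _ mu mu f fi) /fubini_F /f /=.
have inner u : (\int[mu]_v (fejer_hat2 (u, v) * cos (u * x.1 + v * x.2))%:E =
    ((fejer_hat l u * cos (u * x.1)) * fejer l x.2)%:E)%E.
  transitivity (\int[mu]_v ((fejer_hat l u * cos (u * x.1)) * (fejer_hat l v * cos (v * x.2)) -
      (fejer_hat l u * sin (u * x.1)) * (fejer_hat l v * sin (v * x.2)))%:E)%E.
    by apply: eq_integral => v _; rewrite cosD /fejer_hat2/=; congr EFin; ring.
  rewrite EFin_Rintegral//; last first.
    by apply: integrableRB; apply: integrableRZl.
  rewrite RintegralB//; [|exact: integrableRZl|exact: integrableRZl].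
  by rewrite !RintegralZl// fejer_sin0// mulr0 subr0.
under eq_integral do rewrite inner.
rewrite EFin_Rintegral//; last exact: integrableRZr.
by rewrite RintegralZr.
Qed.

End kernel2.

Lemma cvg_comp_S {R : realType} (u : nat -> R) (x : R) :
  u n @[n --> \oo] --> x -> u n.+1 @[n --> \oo] --> x.
Proof. by rewrite -cvg_shiftS. Qed.

Section smoothed.
Context d (T : measurableType d) (R : realType) (P : probability T R).
Variables (X1 X2 : T -> R).
Hypotheses (mX1 : measurable_fun setT X1) (mX2 : measurable_fun setT X2).
Hypothesis iN3 : P.-integrable setT (EFin \o (fun y => (`|X1 y| + `|X2 y|) ^+ 3)).
Hypothesis EX1 : (\int[P]_y X1 y)%R = 0.
Hypothesis EX2 : (\int[P]_y X2 y)%R = 0.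
Let a := (\int[P]_y (X1 y ^+ 2))%R.
Let b := (\int[P]_y (X1 y * X2 y))%R.
Let c := (\int[P]_y (X2 y ^+ 2))%R.
Hypothesis det_gt0 : 0 < a * c - b ^+ 2.
Local Notation C := (char1C P X1 X2).
Local Notation S := (char1S P X1 X2).
Hypothesis nonlattice : forall u v, (u, v) != (0, 0) -> C u v ^+ 2 + S u v ^+ 2 < 1.
Local Notation Q := (covform P X1 X2).
Local Notation nu := (sumlaw P mX1 mX2).
Local Notation nuC := (charC P mX1 mX2).
Local Notation nuS := (charS P mX1 mX2).
Local Notation mu := (@lebesgue_measure R).
Local Notation leb2 := (@plane R).
Variable l : R.
Hypothesis l0 : 0 < l.

Let mcos : measurable_fun setT (@cos R).
Proof. exact: continuous_measurable_fun (@continuous_cos R). Qed.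
Let msin : measurable_fun setT (@sin R).
Proof. exact: continuous_measurable_fun (@continuous_sin R). Qed.

Lemma measurable_char1 : measurable_fun setT (fun z : R * R => C z.1 z.2) /\
  measurable_fun setT (fun z : R * R => S z.1 z.2).
Proof.
have mph : measurable_fun setT (fun w : (R * R) * T => w.1.1 * X1 w.2 + w.1.2 * X2 w.2).
  apply: measurable_funD; apply: measurable_funM; exact: measurableT_comp.
have key (f : R -> R) : measurable_fun setT f -> (forall x, `|f x| <= 1) ->
    measurable_fun setT (fun z : R * R => (\int[P]_y f (z.1 * X1 y + z.2 * X2 y))%R).
  move=> mf f1.
  have int1 z : P.-integrable setT (EFin \o (fun y => f (z.1 * X1 y + z.2 * X2 y))).
    apply: (@bounded_integrable _ _ _ _ _ 1) => //; apply: measurableT_comp => //.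
    by apply: measurable_funD; apply: measurable_funM.
  (* Adding 1 makes the integrand nonnegative, so that Tonelli gives measurability in the
     parameter. *)
  have h : measurable_fun setT (fun z : R * R => (\int[P]_y (1 + f (z.1 * X1 y + z.2 * X2 y))%:E)%E).
    have mF : measurable_fun setT (fun w : (R * R) * T =>
        (1 + f (w.1.1 * X1 w.2 + w.1.2 * X2 w.2))%:E).
      apply/measurable_EFinP; apply: measurable_funD => //.
      exact: measurableT_comp.
    apply: (@measurable_fun_fubini_tonelli_F _ _ _ _ _ P _ mF) => w.
    by rewrite lee_fin -lerBlDl sub0r; have := f1 (w.1.1 * X1 w.2 + w.1.2 * X2 w.2);
      rewrite ler_norml => /andP[].
  have -> : (fun z : R * R => (\int[P]_y f (z.1 * X1 y + z.2 * X2 y))%R) =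
     (fun z : R * R => fine (\int[P]_y (1 + f (z.1 * X1 y + z.2 * X2 y))%:E)%E - 1).
    apply/funext => z; rewrite EFin_Rintegral//; last first.
      apply: integrableRD => //.
      by apply: (@bounded_integrable _ _ _ _ _ 1) => // x; rewrite normr1.
    rewrite RintegralD//; last first.
      by apply: (@bounded_integrable _ _ _ _ _ 1) => // x; rewrite normr1.
    by rewrite Rintegral_cst//= probability_setT mulr1/= addrAC subrr add0r.
  apply: measurable_funB => //.
  by apply: measurableT_comp => //; exact: measurable_fun_fine.
split; first by apply: key => // x; exact: cos_max.
by apply: key => // x; exact: sin_max.
Qed.

Lemma measurable_charCS n : measurable_fun setT (fun z : R * R => nuC n z.1 z.2) /\
  measurable_fun setT (fun z : R * R => nuS n z.1 z.2).
Proof.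
have [mC mS] := measurable_char1.
elim: n => [|n [mCn mSn]].
  split.
    rewrite (_ : (fun z => _) = cst 1)//.
    by apply/funext => z; rewrite (char0 P mX1 mX2 z.1 z.2).1.
  rewrite (_ : (fun z => _) = cst 0)//.
  by apply/funext => z; rewrite (char0 P mX1 mX2 z.1 z.2).2.
split.
  rewrite (_ : (fun z => _) = (fun z : R * R => nuC n z.1 z.2 * C z.1 z.2 - nuS n z.1 z.2 * S z.1 z.2)).
    by apply: measurable_funB; apply: measurable_funM.
  by apply/funext => z; rewrite charCS.
rewrite (_ : (fun z => _) = (fun z : R * R => nuS n z.1 z.2 * C z.1 z.2 + nuC n z.1 z.2 * S z.1 z.2)).
  by apply: measurable_funD; apply: measurable_funM.
by apply/funext => z; rewrite charSS.
Qed.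

(** The real part of [fejer_hat2 z * phi_n z * exp (- i <z, w>)], where [phi_n = charC + i charS] is
    the characteristic function of the n-step law. *)
Definition smooth_freq n (w z : R * R) : R := fejer_hat2 l z *
  (nuC n z.1 z.2 * cos (z.1 * w.1 + z.2 * w.2) + nuS n z.1 z.2 * sin (z.1 * w.1 + z.2 * w.2)).

(** The law of the walk smoothed by the kernel around [w]. The factor [n] is the planar local
    scaling, [sqrt n] for each coordinate. *)
Definition smooth n (w : R * R) : R :=
  n%:R * (\int[nu n]_s fejer2 l (s.1 - w.1, s.2 - w.2))%R.

Lemma measurable_smooth_freq n w : measurable_fun setT (smooth_freq n w).
Proof.
have [mC mS] := measurable_charCS n.
apply: measurable_funM; first exact: measurable_fejer_hat2.
by apply: measurable_funD; apply: measurable_funM => //; apply: measurableT_comp => //;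
  apply: measurable_funD; apply: measurable_funM.
Qed.

Lemma charC_max n u v : `|nuC n u v| <= 1.
Proof.
rewrite -(@ler_pXn2r _ 2) ?nnegrE// expr1n real_normK ?num_real//.
have := char_sqr P mX1 mX2 n u v.
have h : C u v ^+ 2 + S u v ^+ 2 <= 1.
  have [/eqP|h] := eqVneq (u, v) (0, 0); last exact: ltW (nonlattice h).
  rewrite xpair_eqE => /andP[/eqP -> /eqP ->].
  rewrite /char1C /char1S; under eq_Rintegral do rewrite !mul0r addr0 cos0.
  under [X in _ + X ^+ 2]eq_Rintegral do rewrite !mul0r addr0 sin0.
  by rewrite !Rintegral_cst//= probability_setT mul0r mulr1 expr1n expr0n addr0.
move=> e; have : (C u v ^+ 2 + S u v ^+ 2) ^+ n <= 1.
  by rewrite exprn_ile1// addr_ge0// sqr_ge0.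
by rewrite -e; apply: le_trans; rewrite lerDl sqr_ge0.
Qed.

Lemma charS_max n u v : `|nuS n u v| <= 1.
Proof.
rewrite /charS; apply: (le_trans (le_normr_Rintegral _ _)) => //.
  by apply: integrable_sin; apply: measurable_funD; apply: measurable_funM.
rewrite -[leRHS](_ : (\int[nu n]_x cst 1 x)%R = 1); last first.
  by rewrite Rintegral_cst//= probability_setT mulr1.
apply: le_Rintegral => //.
- apply: integrable_norm; apply: integrable_sin.
  by apply: measurable_funD; apply: measurable_funM.
- by apply: (@bounded_integrable _ _ _ _ _ 1) => // x; rewrite normr1.
- by move=> x _; exact: sin_max.
Qed.

Lemma smooth_freq_le n w z : `|smooth_freq n w z| <=
  fejer_hat2 l z * (`|nuC n z.1 z.2| + `|nuS n z.1 z.2|).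
Proof.
rewrite normrM (ger0_norm (fejer_hat2_ge0 _ _)) ler_wpM2l ?fejer_hat2_ge0//.
rewrite (le_trans (ler_normD _ _))// !normrM lerD// ler_piMr//.
- exact: cos_max.
- exact: sin_max.
Qed.

Lemma integrable_smooth_freq n w : leb2.-integrable setT (EFin \o smooth_freq n w).
Proof.
apply: le_integrableR (integrableRZr 2 (integrable_fejer_hat2 l0)).
  exact: measurable_smooth_freq.
move=> z; apply: (le_trans (smooth_freq_le n w z)).
rewrite ler_wpM2l ?fejer_hat2_ge0// (_ : 2 = 1 + 1)//.
by rewrite lerD ?charC_max ?charS_max.
Qed.

(** Writing the kernel as a Fourier integral and exchanging the integrals moves everything to the
    frequency side; this is Fourier inversion for the smoothed law. *)
Lemma smoothE n w : smooth n w = n%:R * (\int[leb2]_z smooth_freq n w z)%R.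
Proof.
congr (_ * _).
pose f (q : (R * R) * (R * R)) : R := fejer_hat2 l q.2 *
  cos (q.2.1 * (q.1.1 - w.1) + q.2.2 * (q.1.2 - w.2)).
have mf : measurable_fun setT f.
  apply: measurable_funM.
    by apply: measurableT_comp => //; exact: measurable_fejer_hat2.
  apply: measurableT_comp => //; apply: measurable_funD; apply: measurable_funM.
  - exact: measurableT_comp.
  - by apply: measurable_funB => //; exact: measurableT_comp.
  - exact: measurableT_comp.
  - by apply: measurable_funB => //; exact: measurableT_comp.
have mfE : measurable_fun setT (EFin \o f) by exact/measurable_EFinP.
(* [|f|] is at most [fejer_hat2], which is integrable in frequency, and [nu n] has total mass 1. *)
have fi : (nu n \x leb2)%E.-integrable setT (EFin \o f).
  apply/integrableP; split=> //.
  have mfn : measurable_fun setT (fun q => `|(f q)%:E|%E) by exact: measurableT_comp.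
  rewrite (@fubini_tonelli1 _ _ _ _ _ (nu n) leb2 _ mfn)//.
  apply: (@le_lt_trans _ _ (\int[nu n]_s (\int[leb2]_z fejer_hat2 l z)%:E)%E).
    apply: ge0_le_integral => //.
    - by move=> s _; apply: integral_ge0.
    - apply: (@measurable_fun_fubini_tonelli_F _ _ _ _ _ leb2 (fun q => `|(f q)%:E|%E)) => //.
    - move=> s _; rewrite /fubini_F -EFin_Rintegral//; last exact: integrable_fejer_hat2.
      apply: ge0_le_integral => //.
      + have h : measurable_fun setT (fun x : R * R => `|(f (s, x))%:E|%E).
          by apply: (measurableT_comp mfn); exact: measurable_pair1.
        exact: h.
      + by apply/measurable_EFinP; exact: measurable_fejer_hat2.
      + move=> z _; rewrite lee_fin normrM (ger0_norm (fejer_hat2_ge0 _ _)).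
        by rewrite ler_piMr ?fejer_hat2_ge0 ?cos_max.
  by rewrite integral_cst//= probability_setT mule1 ltry.
rewrite /Rintegral; congr fine.
transitivity (\int[nu n]_s \int[leb2]_z (f (s, z))%:E)%E.
  apply: eq_integral => s _; rewrite fejer2_fourier// EFin_Rintegral//.
  apply: (@integrable_fejer_hat2M _ _ l0 _ 1); last by move=> z; exact: cos_max.
  rewrite /=.
  by apply: measurableT_comp => //; apply: measurable_funD; apply: measurable_funM.
apply: (etrans (Fubini fi)).
apply: eq_integral => z _.
have ic : (nu n).-integrable setT (EFin \o (fun s : R * R => cos (z.1 * s.1 + z.2 * s.2))).
  by apply: integrable_cos; apply: measurable_funD; apply: measurable_funM.
have iS : (nu n).-integrable setT (EFin \o (fun s : R * R => sin (z.1 * s.1 + z.2 * s.2))).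
  by apply: integrable_sin; apply: measurable_funD; apply: measurable_funM.
set th := z.1 * w.1 + z.2 * w.2.
transitivity (\int[nu n]_s (fejer_hat2 l z * (cos (z.1 * s.1 + z.2 * s.2) * cos th +
    sin (z.1 * s.1 + z.2 * s.2) * sin th))%:E)%E.
  apply: eq_integral => s _; rewrite /f/= -cosB; congr (_ * cos _)%:E.
  by rewrite /th; ring.
rewrite EFin_Rintegral//; last first.
  by apply: integrableRZl; apply: integrableRD; apply: integrableRZr.
rewrite RintegralZl//; last by apply: integrableRD; apply: integrableRZr.
rewrite RintegralD//; [|exact: integrableRZr|exact: integrableRZr].
by rewrite !RintegralZr.
Qed.

(** Frequencies rescaled by [n^(-1/2)]: the Jacobian absorbs the factor [n], and the central limit
    theorem applies pointwise. *)
Definition smooth_scaled n (w z : R * R) : R :=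
  smooth_freq n w ((Num.sqrt n%:R)^-1 * z.1, (Num.sqrt n%:R)^-1 * z.2).

Lemma smooth_scaledE n w : (0 < n)%N ->
  smooth n w = (\int[leb2]_z smooth_scaled n w z)%R.
Proof.
move=> n0; rewrite smoothE.
have x0 : 0 < (Num.sqrt (n%:R : R))^-1 by rewrite invr_gt0 sqrtr_gt0 ltr0n.
rewrite -(Rintegral_scale2 x0 (integrable_smooth_freq n w)) mulrA.
rewrite exprVn sqr_sqrtr ?ler0n// divff ?mul1r// pnatr_eq0 -lt0n//.
Qed.

(** Outside the support of the triangle the integrand vanishes; inside, the box estimate raised to
    the n-th power is a Gaussian in the rescaled frequency. The bound depends neither on [n] nor on
    [w], which serves both domination and uniform bounds. *)
Lemma smooth_scaled_bound : exists2 k : R, 0 < k & forall n w z, (0 < n)%N ->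
  `|smooth_scaled n w z| <= 2 * expR (- (k * (z.1 ^+ 2 + z.2 ^+ 2))).
Proof.
have [k k0 hk] := char_norm_le mX1 mX2 iN3 EX1 EX2 det_gt0 nonlattice l0.
exists k => // n w z n0.
set x := (Num.sqrt (n%:R : R))^-1.
apply: (le_trans (smooth_freq_le _ _ _)) => /=; rewrite -/x.
have [/andP[h1 h2]|h] := boolP ((`|x * z.1| <= l) && (`|x * z.2| <= l)); last first.
  by rewrite fejer_hat2_out// mul0r mulr_ge0// expR_ge0.
have [g1 g2] := hk n _ _ h1 h2.
have E : expR (- (k * ((x * z.1) ^+ 2 + (x * z.2) ^+ 2))) ^+ n =
    expR (- (k * (z.1 ^+ 2 + z.2 ^+ 2))).
  rewrite -expRM_natr; congr expR.
  have -> : - (k * ((x * z.1) ^+ 2 + (x * z.2) ^+ 2)) * n%:R =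
    - (k * (z.1 ^+ 2 + z.2 ^+ 2)) * (x ^+ 2 * n%:R) by ring.
  by rewrite /x exprVn sqr_sqrtr ?ler0n// mulVf ?mulr1// pnatr_eq0 -lt0n.
rewrite E in g1 g2.
rewrite -[leRHS]mul1r; apply: ler_pM.
- exact: fejer_hat2_ge0.
- by rewrite addr_ge0.
- exact: fejer_hat2_le1.
- by lra.
Qed.

Lemma smooth_bound : exists B : R, forall n w, (0 < n)%N -> `|smooth n w| <= B.
Proof.
have [k k0 hk] := smooth_scaled_bound.
exists (\int[leb2]_z (2 * expR (- (k * (z.1 ^+ 2 + z.2 ^+ 2)))))%R => n w n0.
rewrite smooth_scaledE//.
have ig := integrableRZl 2 (integrable_gauss2 k0).
have ms : measurable_fun setT (smooth_scaled n w).
  apply: (measurableT_comp (measurable_smooth_freq n w)).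
  by apply: measurable_fun_pair; apply: measurable_funM.
have iS : leb2.-integrable setT (EFin \o smooth_scaled n w).
  by apply: le_integrableR ig => // z; exact: hk.
apply: (le_trans (le_normr_Rintegral measurableT iS)).
apply: le_Rintegral => //; first exact: (integrable_norm iS).
by move=> z _; exact: hk.
Qed.

(** Dominated convergence. For fixed [w] both the triangle factor and the phase tend to 1 under
    rescaling, so the limit is the integral of the Gaussian alone, the same for all [w]. *)
Lemma cvg_smooth w : smooth n w @[n --> \oo] --> 2 * pi / Num.sqrt (a * c - b ^+ 2).
Proof.
have [k k0 hk] := smooth_scaled_bound.
have ig := integrableRZl 2 (integrable_gauss2 k0).
(* Shifted by one because the Gaussian bound holds only for positive [n]. *)
pose f_ n : R * R -> \bar R := EFin \o smooth_scaled n.+1 w.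
pose f : R * R -> \bar R := fun z => (expR (- (Q z.1 z.2 / 2)))%:E.
have ms n : measurable_fun setT (smooth_scaled n w).
  apply: (measurableT_comp (measurable_smooth_freq n w)).
  by apply: measurable_fun_pair; apply: measurable_funM.
have a0 : 0 < a.
  have a0' : 0 <= a by apply: Rintegral_ge0 => y _; rewrite sqr_ge0.
  rewrite lt_neqAle a0' andbT eq_sym; apply/negP => /eqP az.
  by move: det_gt0; rewrite az mul0r sub0r oppr_gt0 ltNge sqr_ge0.
have mf : measurable_fun setT f.
  apply/measurable_EFinP; apply: measurableT_comp => //; apply: measurableT_comp => //.
  apply: measurable_funM => //.
  apply: measurable_funD; first apply: measurable_funD; apply: measurable_funM => //.
  - exact: measurable_funX.
  - by apply: measurable_funM.
  - exact: measurable_funX.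
have cz (z : R * R) : smooth_scaled n w z @[n --> \oo] --> expR (- (Q z.1 z.2 / 2)).
  have xz (t : R) : (Num.sqrt (n%:R : R))^-1 * t @[n --> \oo] --> 0.
    rewrite -[X in _ --> X](mul0r t); apply: cvgMl; exact: cvg_invsqrtn.
  have cth : (Num.sqrt n%:R)^-1 * z.1 * w.1 + (Num.sqrt n%:R)^-1 * z.2 * w.2 @[n --> \oo] --> (0 : R).
    rewrite [X in _ --> X](_ : _ = 0 * w.1 + 0 * w.2); last by rewrite !mul0r addr0.
    by apply: cvgD; apply: cvgMl; exact: xz.
  rewrite [X in _ --> X](_ : _ = (1 * 1) * (expR (- (Q z.1 z.2 / 2)) * cos 0 + 0 * sin 0)); last first.
    by rewrite cos0 mul0r addr0 !mulr1 mul1r.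
  apply: cvgM.
    by apply: cvgM; apply: continuous_fejer_hat0 => //; exact: xz.
  apply: cvgD; apply: cvgM.
  - have := @cvg_charC _ _ _ _ _ _ mX1 mX2 iN3 EX1 EX2 det_gt0 z.1 z.2.
    by under eq_cvg do rewrite (mulrC z.1) (mulrC z.2).
  - exact: (continuous_cvg _ (@continuous_cos R 0) cth).
  - have := @cvg_charS _ _ _ _ _ _ mX1 mX2 iN3 EX1 EX2 det_gt0 z.1 z.2.
    by under eq_cvg do rewrite (mulrC z.1) (mulrC z.2).
  - exact: (continuous_cvg _ (@continuous_sin R 0) cth).
have czE (z : R * R) : setT z -> f_ n z @[n --> \oo] --> f z.
  by move=> _; apply: cvg_EFin; [exact: nearW|exact: cvg_comp_S (cz z)].
have [fi _ cvgI] := @dominated_convergence _ _ _ leb2 setT measurableT f_ f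
  (EFin \o (fun z : R * R => 2 * expR (- (k * (z.1 ^+ 2 + z.2 ^+ 2)))))
  (fun n => (measurable_EFinP _ _).2 (ms n.+1)) mf
  (aeW leb2 czE) ig
  (aeW leb2 (fun z n _ => hk n.+1 w z isT)).
rewrite -cvg_shiftS.
have <- : fine (\int[leb2]_z f z)%E = 2 * pi / Num.sqrt (a * c - b ^+ 2).
  by rewrite (integral_gauss2 a0 det_gt0).
rewrite (_ : (fun n => _) = (fun n => fine (\int[leb2]_z f_ n z)%E)); last first.
  by apply/funext => n; rewrite smooth_scaledE.
apply: fine_cvg; rewrite fineK ?integrable_fin_num//.
Qed.

End smoothed.

(** For a fixed smoothing level [k] the two bounds keep a gap in the limit [n -> oo]; the gap closes
    only as [k] grows. Hence a squeeze with two successive limits. *)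
Lemma squeeze_family (R : realType) (W : nat -> R) (u v : nat -> nat -> R)
    (a b : nat -> R) (t : R) :
  (forall k, \forall n \near \oo, u k n <= W n <= v k n) ->
  (forall k, u k n @[n --> \oo] --> a k) -> (forall k, v k n @[n --> \oo] --> b k) ->
  a k @[k --> \oo] --> t -> b k @[k --> \oo] --> t ->
  W n @[n --> \oo] --> t.
Proof.
move=> uWv ua vb /cvgrPdist_lt at_ /cvgrPdist_lt bt; apply/cvgrPdist_lt => e e0.
have e2 : 0 < e / 2 by rewrite divr_gt0.
have [k [ak bk]] : exists k, `|t - a k| < e / 2 /\ `|t - b k| < e / 2.
  have := filterI (at_ _ e2) (bt _ e2).
  by case=> N _ /(_ N (leqnn N)) H; exists N.
have /cvgrPdist_lt/(_ _ e2) uk := ua k; have /cvgrPdist_lt/(_ _ e2) vk := vb k.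
near=> n.
have /andP[h1 h2] : u k n <= W n <= v k n by near: n; exact: uWv.
have h3 : `|a k - u k n| < e / 2 by near: n.
have h4 : `|b k - v k n| < e / 2 by near: n.
move: ak bk h3 h4; rewrite !ltr_norml => /andP[? ?] /andP[? ?] /andP[? ?] /andP[? ?].
by apply/andP; split; lra.
Unshelve. all: by end_near. Qed.

(** * The planar local limit theorem *)

Section llt.
Context d (T : measurableType d) (R : realType) (P : probability T R).
Variables (X1 X2 : T -> R).
Hypotheses (mX1 : measurable_fun setT X1) (mX2 : measurable_fun setT X2).
Hypothesis iN3 : P.-integrable setT (EFin \o (fun y => (`|X1 y| + `|X2 y|) ^+ 3)).
Hypothesis EX1 : (\int[P]_y X1 y)%R = 0.
Hypothesis EX2 : (\int[P]_y X2 y)%R = 0.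
Let a := (\int[P]_y (X1 y ^+ 2))%R.
Let b := (\int[P]_y (X1 y * X2 y))%R.
Let c := (\int[P]_y (X2 y ^+ 2))%R.
Hypothesis det_gt0 : 0 < a * c - b ^+ 2.
Local Notation C := (char1C P X1 X2).
Local Notation S := (char1S P X1 X2).
Hypothesis nonlattice : forall u v, (u, v) != (0, 0) -> C u v ^+ 2 + S u v ^+ 2 < 1.
Local Notation nu := (sumlaw P mX1 mX2).
Local Notation mu := (@lebesgue_measure R).
Local Notation leb2 := (@plane R).
Local Notation smooth := (smooth P mX1 mX2).
Variables (h : R * R -> R) (g : R).
Hypotheses (mh : measurable_fun setT h) (h0 : forall s, 0 <= h s) (h1 : forall s, h s <= 1).
Hypothesis ih : leb2.-integrable setT (EFin \o h).
Hypothesis g0 : 0 <= g.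
Hypothesis hmono : forall s u, 0 <= u.1 -> 0 <= u.2 ->
  expR (- (g * (u.1 + u.2))) * h s <= h (s.1 + u.1, s.2 + u.2).

Let I := (\int[leb2]_w h w)%R.

Let I0 : 0 <= I.
Proof. by apply: Rintegral_ge0. Qed.

(** The target quantity is the value at the origin. Other base points [x] appear because convolving
    with the kernel averages over them. *)
Definition shifted_mean n (x : R * R) : R :=
  n%:R * (\int[nu n]_s h (s.1 - x.1, s.2 - x.2))%R.
Local Notation U := shifted_mean.

Let msub (x : R * R) : measurable_fun setT (fun s : R * R => (s.1 - x.1, s.2 - x.2)).
Proof. by apply: measurable_fun_pair; apply: measurable_funB. Qed.

Let ihs n x : (nu n).-integrable setT (EFin \o (fun s : R * R => h (s.1 - x.1, s.2 - x.2))).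
Proof.
apply: (@bounded_integrable _ _ _ _ _ 1).
  exact: (measurableT_comp mh (msub x)).
by move=> s; rewrite ger0_norm.
Qed.

Let U0 n x : 0 <= U n x.
Proof. by rewrite mulr_ge0// Rintegral_ge0. Qed.

(** Lowering the base point pushes the walk further into the quadrant, where [hmono] applies. This
    one-sided comparison stands in for continuity of [h]. *)
Lemma shifted_mean_mono n x u : 0 <= u.1 -> 0 <= u.2 ->
  expR (- (g * (u.1 + u.2))) * U n x <= U n (x.1 - u.1, x.2 - u.2).
Proof.
move=> u1 u2; rewrite mulrCA ler_wpM2l// -RintegralZl//; last exact: ihs.
apply: le_Rintegral => //.
- exact: integrableRZl (ihs n x).
- exact: ihs n (x.1 - u.1, x.2 - u.2).
move=> s _; have := hmono (s.1 - x.1, s.2 - x.2) u1 u2.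
by congr (_ <= h (_, _)) => /=; ring.
Qed.

Section kernel.
Variables (l e : R).
Hypotheses (l0 : 0 < l) (e0 : 0 < e).

(** The convolution of [h], the kernel and the n-step law, times [n]. In this form its limit follows
    from that of [smooth] by domination. *)
Definition smoothed_mean n (x : R * R) : R :=
  (\int[leb2]_w (h w * smooth l n (x.1 + w.1, x.2 + w.2)))%R.
Local Notation V := smoothed_mean.

Let K := fejer2 l.

Let mK : measurable_fun setT K.
Proof. exact: measurable_fejer2. Qed.

Let M := (\int[leb2]_z fejer_hat2 l z)%R.

Let KM y : `|K y| <= M.
Proof.
rewrite /K fejer2_fourier//.
have ik : leb2.-integrable setT
    (EFin \o (fun z => fejer_hat2 l z * cos (z.1 * y.1 + z.2 * y.2))).
  apply: (@integrable_fejer_hat2M _ _ l0 _ 1); last by move=> z; exact: cos_max.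
  apply: measurableT_comp.
    exact: continuous_measurable_fun (@continuous_cos R).
  by apply: measurable_funD; apply: measurable_funM.
apply: (le_trans (le_normr_Rintegral measurableT ik)).
apply: le_Rintegral => //; [exact: (integrable_norm ik)|exact: integrable_fejer_hat2|].
move=> z _; rewrite normrM (ger0_norm (fejer_hat2_ge0 _ _)).
by rewrite ler_piMr ?fejer_hat2_ge0 ?cos_max.
Qed.

Let iKs n x : (nu n).-integrable setT (EFin \o (fun s : R * R => K (s.1 - x.1, s.2 - x.2))).
Proof.
apply: (@bounded_integrable _ _ _ _ _ M) => //.
exact: (measurableT_comp mK (msub x)).
Qed.

Let smoothEK n x : smooth l n x = n%:R * (\int[nu n]_s K (s.1 - x.1, s.2 - x.2))%R.
Proof. by []. Qed.

Let msmooth n x : measurable_fun setT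
  (fun w : R * R => smooth l n (x.1 + w.1, x.2 + w.2)).
Proof.
apply: measurable_funM => //.
pose F (q : (R * R) * (R * R)) := (K (q.2.1 - (x.1 + q.1.1), q.2.2 - (x.2 + q.1.2)))%:E.
have mF : measurable_fun setT F.
  apply/measurable_EFinP; apply: (measurableT_comp mK); apply: measurable_fun_pair;
    apply: measurable_funB; try exact: measurableT_comp;
    by apply: measurable_funD => //; exact: measurableT_comp.
have F0 q : (0 <= F q)%E by rewrite lee_fin fejer2_ge0.
have := @measurable_fun_fubini_tonelli_F _ _ _ _ _ (nu n) F mF F0.
by move=> mFF; exact: (measurableT_comp (@fine_measurable R setT measurableT) mFF).
Qed.

Let ihsmooth n x : leb2.-integrable setT
  (EFin \o (fun w => h w * smooth l n (x.1 + w.1, x.2 + w.2))).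
Proof.
apply: le_integrableR (integrableRZr (n%:R * M) ih).
  exact: (measurable_funM mh (msmooth n x)).
move=> w; rewrite normrM (ger0_norm (h0 w)) ler_wpM2l//.
rewrite smoothEK normrM ger0_norm// ler_wpM2l//.
apply: (le_trans (le_normr_Rintegral _ _)) => //; first exact: iKs.
rewrite -[leRHS](_ : (\int[nu n]_x cst M x)%R = M); last first.
  by rewrite Rintegral_cst//= probability_setT mulr1.
apply: le_Rintegral => //.
- exact: (integrable_norm (iKs n _)).
- by apply: (@bounded_integrable _ _ _ _ _ `|M|) => // y.
Qed.

(** The same convolution with the kernel integrated last, an average of [shifted_mean] around [x].
    The limit is known for one form and the comparison with the target is made in the other. *)
Lemma smoothed_meanE n x :
  (V n x)%:E = (\int[leb2]_y (K y * U n (x.1 + y.1, x.2 + y.2))%:E)%E.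
Proof.
rewrite -EFin_Rintegral; [|exact: measurableT|exact: ihsmooth].
pose F (q : (R * R) * (R * R)) :=
  (n%:R * h q.2 * K (q.1.1 - (x.1 + q.2.1), q.1.2 - (x.2 + q.2.2)))%:E.
pose G (q : (R * R) * (R * R)) :=
  (n%:R * K q.2 * h (q.1.1 - (x.1 + q.2.1), q.1.2 - (x.2 + q.2.2)))%:E.
have mq : measurable_fun setT (fun q : (R * R) * (R * R) =>
    (q.1.1 - (x.1 + q.2.1), q.1.2 - (x.2 + q.2.2))).
  apply: measurable_fun_pair;
    apply: measurable_funB; try exact: measurableT_comp;
    by apply: measurable_funD => //; exact: measurableT_comp.
have mF : measurable_fun setT F.
  apply/measurable_EFinP; apply: measurable_funM; last exact: (measurableT_comp mK mq).
  by apply: measurable_funM => //; exact: measurableT_comp.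
have mG : measurable_fun setT G.
  apply/measurable_EFinP; apply: measurable_funM; last exact: (measurableT_comp mh mq).
  by apply: measurable_funM => //; exact: measurableT_comp.
have F0 q : (0 <= F q)%E.
  by rewrite lee_fin; apply: mulr_ge0; [exact: mulr_ge0|exact: fejer2_ge0].
have G0 q : (0 <= G q)%E.
  by rewrite lee_fin; apply: mulr_ge0 => //; apply: mulr_ge0 => //; exact: fejer2_ge0.
transitivity (\int[leb2]_w \int[nu n]_s F (s, w))%E.
  apply: eq_integral => w _; rewrite /F/= smoothEK EFin_Rintegral//.
    rewrite RintegralZl//; last exact: (iKs n (x.1 + w.1, x.2 + w.2)).
    by rewrite mulrCA mulrA.
  exact: (integrableRZl _ (iKs n (x.1 + w.1, x.2 + w.2))).
transitivity (\int[nu n]_s \int[leb2]_w F (s, w))%E.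
  by have := @fubini_tonelli _ _ _ _ _ (nu n) leb2 F mF F0.
transitivity (\int[nu n]_s \int[leb2]_w G (s, w))%E.
  (* For a fixed position [s], the substitution [y = s - x - w] exchanges the arguments of the
     kernel and of [h]. *)
  apply: eq_integral => s _.
  pose G' (y : R * R) := (n%:R * K y * h (s.1 - x.1 - y.1, s.2 - x.2 - y.2))%:E.
  have mG' : measurable_fun setT G'.
    apply/measurable_EFinP; apply: measurable_funM.
      by apply: measurable_funM.
    apply: (measurableT_comp mh); apply: measurable_fun_pair;
      by apply: measurable_funB.
  have G'0 y : (0 <= G' y)%E by rewrite lee_fin mulr_ge0// mulr_ge0// fejer2_ge0.
  transitivity (\int[leb2]_y G' y)%E; last first.
    apply: eq_integral => y _; rewrite /G' /G /=.
    by congr (_ * h (_, _))%:E; ring.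
  rewrite -(ge0_integral_sub2 (s.1 - x.1, s.2 - x.2) mG' G'0).
  apply: eq_integral => w _; rewrite /G' /F /= mulrAC; congr EFin.
  by rewrite !subKr -surjective_pairing !opprD !addrA.
transitivity (\int[leb2]_w \int[nu n]_s G (s, w))%E.
  by have := @fubini_tonelli _ _ _ _ _ (nu n) leb2 G mG G0.
apply: eq_integral => y _; rewrite /G/= EFin_Rintegral//.
  rewrite RintegralZl//; last exact: (ihs n (x.1 + y.1, x.2 + y.2)).
  by rewrite -mulrA mulrCA.
exact: (integrableRZl _ (ihs n (x.1 + y.1, x.2 + y.2))).
Qed.

Lemma cvg_smoothed_mean x :
  V n x @[n --> \oo] --> I * (2 * pi / Num.sqrt (a * c - b ^+ 2)).
Proof.
have [B hB] := smooth_bound mX1 mX2 iN3 EX1 EX2 det_gt0 nonlattice l0.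
pose f_ n : R * R -> \bar R := EFin \o (fun w => h w * smooth l n.+1 (x.1 + w.1, x.2 + w.2)).
pose f : R * R -> \bar R := fun w => (h w * (2 * pi / Num.sqrt (a * c - b ^+ 2)))%:E.
have mf_ n : measurable_fun setT (f_ n).
  by apply/measurable_EFinP; exact: (measurable_funM mh (msmooth n.+1 x)).
have mf : measurable_fun setT f by apply/measurable_EFinP; exact: measurable_funM.
have czE (w : R * R) : setT w -> f_ n w @[n --> \oo] --> f w.
  move=> _; apply: cvg_EFin; first exact: nearW.
  apply: cvgM; first exact: cvg_cst.
  apply: (@cvg_comp_S _ (fun n => smooth l n (x.1 + w.1, x.2 + w.2))).
  exact: (cvg_smooth mX1 mX2 iN3 EX1 EX2 det_gt0 nonlattice l0).
have dom (w : R * R) n : setT w -> (`|f_ n w| <= (h w * B)%:E)%E.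
  move=> _; rewrite /f_/= lee_fin normrM (ger0_norm (h0 w)) ler_wpM2l//.
  exact: hB.
have [fi _ cvgI] := @dominated_convergence _ _ _ leb2 setT measurableT f_ f
  (fun w => (h w * B)%:E) mf_ mf
  (aeW leb2 czE) (integrableRZr B ih) (aeW leb2 dom).
rewrite -cvg_shiftS.
rewrite /I -RintegralZr//.
by apply: fine_cvg; rewrite fineK ?integrable_fin_num.
Qed.

Lemma smoothed_mean_bound : exists B, forall n x, (0 < n)%N -> V n x <= B.
Proof.
have [B hB] := smooth_bound mX1 mX2 iN3 EX1 EX2 det_gt0 nonlattice l0.
exists (\int[leb2]_w (h w * B))%R => n x n0.
apply: (le_Rintegral measurableT (ihsmooth n x) (integrableRZr B ih)).
move=> w _; rewrite ler_wpM2l// (le_trans (ler_norm _))//; exact: hB.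
Qed.

Let A : set R := `[- e, e]%classic.

Definition fejer_window : R := (\int[mu]_(x in A) fejer l x)%R.
Local Notation m := fejer_window.

Let ifejer : mu.-integrable setT (EFin \o fejer l).
Proof.
apply/integrableP; split; first by apply/measurable_EFinP; exact: measurable_fejer.
under eq_integral do rewrite /= ger0_norm ?fejer_ge0//.
by rewrite integral_fejer// ltry.
Qed.

Let mA : measurable A.
Proof. exact: measurable_itv. Qed.

Let ifejerA : mu.-integrable A (EFin \o fejer l).
Proof. by apply: (@integrableS _ _ _ mu setT A) => //; exact: mA. Qed.

Let fejer_windowE : (\int[mu]_(x in A) (fejer l x)%:E = m%:E)%E.
Proof. exact: EFin_Rintegral. Qed.

Lemma fejer_window_bounds : 2 * pi - 8 / (l * e) <= m <= 2 * pi.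
Proof.
rewrite -!lee_fin -fejer_windowE.
rewrite integral_fejer_window//= -(integral_fejer l0).
apply: ge0_subset_integral => //; last by move=> x _; rewrite lee_fin fejer_ge0.
by apply/measurable_EFinP; exact: measurable_fejer.
Qed.

(** The part of the kernel on which base points move by at most [e] in each coordinate; its mass is
    the square of [fejer_window]. *)
Definition boxed_fejer2 (y : R * R) : R :=
  (fejer l y.1 * \1_A y.1) * (fejer l y.2 * \1_A y.2).
Local Notation KA := boxed_fejer2.

Let mfA : measurable_fun setT (fun x => fejer l x * \1_A x).
Proof. by apply: measurable_funM; [exact: measurable_fejer|exact: measurable_indic]. Qed.

Let fA0 x : 0 <= fejer l x * \1_A x.
Proof. by rewrite mulr_ge0// fejer_ge0. Qed.

Let mKA : measurable_fun setT KA.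
Proof. by apply: measurable_funM; apply: (measurableT_comp mfA). Qed.

Let KA0 y : 0 <= KA y.
Proof. exact: mulr_ge0. Qed.

Let KAK y : KA y <= K y.
Proof.
apply: ler_pM => //; rewrite ler_piMr ?fejer_ge0//;
  by rewrite indicE; case: (_ \in _).
Qed.

Let KA_out y : ~~ ((`|y.1| <= e) && (`|y.2| <= e)) -> KA y = 0.
Proof.
have out t : ~~ (`|t| <= e) -> \1_A t = 0 :> R.
  move=> te; rewrite indicE (_ : (t \in A) = false)//; apply/negP.
  by rewrite inE /A/= in_itv/= -ler_norml; exact/negP.
by rewrite negb_and /KA => /orP[/out ->|/out ->]; rewrite ?mulr0 ?mul0r.
Qed.

Let integral_KA : (\int[leb2]_y (KA y)%:E = (m ^+ 2)%:E)%E.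
Proof.
have E : (\int[mu]_x (fejer l x * \1_A x)%:E = m%:E)%E.
  rewrite -fejer_windowE.
  rewrite [RHS]integral_mkcond; apply: eq_integral => x _.
  by rewrite patchE indicE; case: ifP => _; rewrite ?mulr1 ?mulr0.
by have := ge0_integral_leb2M mfA mfA fA0 fA0; rewrite E -EFinM -expr2.
Qed.

Let integral_tail : (\int[leb2]_y (K y - KA y)%:E = ((2 * pi) ^+ 2 - m ^+ 2)%:E)%E.
Proof.
have iK : leb2.-integrable setT (EFin \o K).
  apply/integrableP; split; first exact/measurable_EFinP.
  under eq_integral do rewrite /= ger0_norm ?fejer2_ge0//.
  by rewrite integral_fejer2// ltry.
have iKA : leb2.-integrable setT (EFin \o KA).
  by apply: le_integrableR iK => // y; rewrite ger0_norm.
rewrite EFin_Rintegral//; last exact: integrableRB.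
rewrite RintegralB// EFinB -!EFin_Rintegral//.
by rewrite integral_KA integral_fejer2.
Qed.

Let mU n x : measurable_fun setT (fun y : R * R => U n (x.1 + y.1, x.2 + y.2)).
Proof.
apply: measurable_funM => //.
pose F (q : (R * R) * (R * R)) := (h (q.2.1 - (x.1 + q.1.1), q.2.2 - (x.2 + q.1.2)))%:E.
have mF : measurable_fun setT F.
  apply/measurable_EFinP; apply: (measurableT_comp mh); apply: measurable_fun_pair;
    apply: measurable_funB; try exact: measurableT_comp;
    by apply: measurable_funD => //; exact: measurableT_comp.
have F0 q : (0 <= F q)%E by rewrite lee_fin.
have := @measurable_fun_fubini_tonelli_F _ _ _ _ _ (nu n) F mF F0.
by move=> mFF; exact: (measurableT_comp (@fine_measurable R setT measurableT) mFF).
Qed.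

(** The kernel outside the box is discarded. For [y] in the box the base point [x - (e, e) + y] lies
    below [x] by an amount in [[0, 2 e]] per coordinate, so monotonicity costs at most
    [exp (- 4 g e)]. *)
Lemma le_smoothed_mean n x :
  m ^+ 2 * (expR (- (4 * g * e)) * U n x) <= V n (x.1 - e, x.2 - e).
Proof.
rewrite -lee_fin smoothed_meanE EFinM -integral_KA.
rewrite -ge0_integralZr//; last 3 first.
- exact/measurable_EFinP.
- by move=> y _; rewrite lee_fin.
- by rewrite lee_fin mulr_ge0// expR_ge0.
apply: ge0_le_integral => //.
- by move=> y _; rewrite -EFinM lee_fin mulr_ge0// mulr_ge0// expR_ge0.
- by apply: emeasurable_funM => //; apply/measurable_EFinP.
- by apply/measurable_EFinP; apply: measurable_funM => //; exact: (mU n (x.1 - e, x.2 - e)).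
move=> y _; rewrite -EFinM lee_fin.
have [/andP[y1 y2]|/KA_out ->] := boolP ((`|y.1| <= e) && (`|y.2| <= e)); last first.
  by rewrite mul0r mulr_ge0// fejer2_ge0.
apply: ler_pM => //; first by rewrite mulr_ge0// expR_ge0.
move: y1 y2; rewrite !ler_norml => /andP[y1 y1'] /andP[y2 y2'].
have y1e : 0 <= e - y.1 by rewrite subr_ge0.
have y2e : 0 <= e - y.2 by rewrite subr_ge0.
have := @shifted_mean_mono n x (e - y.1, e - y.2) y1e y2e.
have -> : (x.1 - (e - y.1, e - y.2).1, x.2 - (e - y.1, e - y.2).2) =
  ((x.1 - e, x.2 - e).1 + y.1, (x.1 - e, x.2 - e).2 + y.2).
  by congr (_, _) => /=; ring.
apply: le_trans; rewrite ler_wpM2r// ler_expR lerN2 /=.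
have : g * (e - y.1 + (e - y.2)) <= g * (4 * e) by rewrite ler_wpM2l//; lra.
by move=> H; apply: (le_trans H); rewrite mulrA (mulrC g).
Qed.

(** With the opposite shift the base points [(e, e) + y] dominate the origin, and monotonicity works
    in the other direction. Outside the box nothing is known but the uniform bound [B], which
    multiplies the kernel mass there. *)
Lemma smoothed_mean_le n B : (forall x, U n x <= B) ->
  V n (e, e) <= (2 * pi) ^+ 2 * (expR (4 * g * e) * U n (0, 0)) +
    B * ((2 * pi) ^+ 2 - m ^+ 2).
Proof.
move=> UB.
have B0 : 0 <= B by apply: le_trans (UB (0, 0)).
have t0 : 0 <= expR (4 * g * e) * U n (0, 0) by rewrite mulr_ge0// expR_ge0.
rewrite -lee_fin smoothed_meanE EFinD (EFinM ((2 * pi) ^+ 2)) (EFinM B).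
rewrite -integral_tail -(integral_fejer2 l0).
rewrite -ge0_integralZr//; last 2 first.
- exact/measurable_EFinP.
- by move=> y _; rewrite lee_fin fejer2_ge0.
rewrite -ge0_integralZl_EFin//; last 2 first.
- by move=> y _; rewrite lee_fin subr_ge0.
- by apply/measurable_EFinP; exact: measurable_funB.
rewrite -ge0_integralD//; last 4 first.
- by move=> y _; rewrite -EFinM lee_fin mulr_ge0// fejer2_ge0.
- by apply: emeasurable_funM => //; apply/measurable_EFinP.
- by move=> y _; rewrite -EFinM lee_fin mulr_ge0// subr_ge0.
- by apply: emeasurable_funM => //; apply/measurable_EFinP; exact: measurable_funB.
apply: ge0_le_integral => //.
- by move=> y _; rewrite lee_fin mulr_ge0// fejer2_ge0.
- by apply/measurable_EFinP; apply: measurable_funM => //; exact: (mU n (e, e)).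
- apply: emeasurable_funD.
    by apply: emeasurable_funM => //; apply/measurable_EFinP.
  by apply: emeasurable_funM => //; apply/measurable_EFinP; exact: measurable_funB.
move=> y _; rewrite -!EFinM -EFinD lee_fin.
have K0 : 0 <= K y by exact: fejer2_ge0.
have [/andP[y1 y2]|/KA_out ->] := boolP ((`|y.1| <= e) && (`|y.2| <= e)); last first.
  rewrite subr0 -[leLHS]add0r lerD//; first exact: mulr_ge0.
  by rewrite mulrC ler_wpM2r.
rewrite -[leLHS]addr0 lerD//; last by rewrite mulr_ge0// subr_ge0.
rewrite ler_wpM2l//.
move: y1 y2; rewrite !ler_norml => /andP[y1 y1'] /andP[y2 y2'].
have y1e : 0 <= e + y.1 by lra.
have y2e : 0 <= e + y.2 by lra.
have := @shifted_mean_mono n (e + y.1, e + y.2) (e + y.1, e + y.2) y1e y2e.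
rewrite /= !subrr => H.
rewrite -ler_pdivrMl ?expR_gt0// -expRN; apply: le_trans H.
rewrite ler_wpM2r// ler_expR lerN2.
have : g * (e + y.1 + (e + y.2)) <= g * (4 * e) by rewrite ler_wpM2l//; lra.
by move=> H; apply: (le_trans H); rewrite mulrA (mulrC g).
Qed.

End kernel.

(** The a priori bound needed for the part outside the box: the lower comparison with one fixed
    kernel already dominates [shifted_mean] uniformly in [n] and [x]. *)
Lemma shifted_mean_bound : exists B, forall n x, (0 < n)%N -> U n x <= B.
Proof.
(* With [l = 8] and [e = 1] the window has mass at least [2 pi - 1 > 0]. *)
have l0 : 0 < 8 :> R by []. have e0 : 0 < 1 :> R by [].
have [B hB] := smoothed_mean_bound l0.
have /andP[m1 _] := fejer_window_bounds l0 e0.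
have pi2 : 2 <= pi :> R by exact: pi_ge2.
have m0 : 0 < fejer_window 8 1 by apply: lt_le_trans m1; lra.
pose k := fejer_window 8 1 ^+ 2 * expR (- (4 * g * 1)).
have k0 : 0 < k by rewrite mulr_gt0 ?expR_gt0 ?exprn_gt0.
exists (B / k) => n x n0; rewrite ler_pdivlMr// mulrC.
apply: le_trans (hB n (x.1 - 1, x.2 - 1) n0).
by have := le_smoothed_mean 1 l0 n x; rewrite mulrA.
Qed.

(** Both comparisons divide by the kernel mass [(2 pi)^2], which turns the limit
    [I * 2 pi / sqrt det] of the smoothed means into [I] times the Gaussian density at its
    center. *)
Theorem local_limit :
  n%:R * (\int[nu n]_s h s)%R @[n --> \oo] --> I / (2 * pi * Num.sqrt (a * c - b ^+ 2)).
Proof.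
have [B hB] := shifted_mean_bound.
have pi2 : 2 <= pi :> R by exact: pi_ge2.
pose L := I * (2 * pi / Num.sqrt (a * c - b ^+ 2)).
(* The window shrinks while [8 / (l e) = 8 e] still tends to 0; starting at 3 keeps the window mass
   positive, as [2 pi - 8 / 3 > 0]. *)
pose e k : R := k.+3%:R^-1; pose l k : R := k.+3%:R ^+ 2.
have e0 k : 0 < e k by rewrite invr_gt0.
have l0 k : 0 < l k by rewrite exprn_gt0.
pose m k := fejer_window (l k) (e k).
have mb k : 2 * pi - 8 * e k <= m k <= 2 * pi.
  have := fejer_window_bounds (l0 k) (e0 k).
  by rewrite {1}/l {1}/e expr2 mulfK ?pnatr_eq0//.
have m0 k : 0 < m k.
  have /andP[lem _] := mb k; apply: lt_le_trans lem.
  have : e k <= 3^-1 by rewrite lef_pV2 ?posrE// ler_nat.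
  lra.
have ce : e k @[k --> \oo] --> (0 : R).
  have := @cvg_harmonic R; rewrite -cvg_shiftS => H.
  by have := cvg_comp_S H.
have cm : m k @[k --> \oo] --> 2 * pi.
  apply: (@squeeze_cvgr _ _ _ _ (fun k => 2 * pi - 8 * e k) (fun=> 2 * pi)).
  - by apply: nearW => k; exact: mb.
  - rewrite -[X in _ --> X]subr0 -[X in _ - X](mulr0 8).
    by apply: cvgB; [exact: cvg_cst|apply: cvgMr].
  - exact: cvg_cst.
have cE0 : 4 * g * e k @[k --> \oo] --> (0 : R).
  rewrite [X in _ --> X](_ : _ = 4 * g * 0); last by rewrite mulr0.
  exact: cvgMr.
have cE : expR (4 * g * e k) @[k --> \oo] --> (1 : R).
  have H : expR (4 * g * e k) @[k --> \oo] --> expR (0 : R).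
    exact: continuous_cvg (@continuous_expR R 0) cE0.
  by move: H; rewrite expR0.
have alg : I / (2 * pi * Num.sqrt (a * c - b ^+ 2)) =
    ((2 * pi) ^+ 2)^-1 * (I * (2 * pi / Num.sqrt (a * c - b ^+ 2))).
  have p0 : 2 * pi != 0 :> R by rewrite mulf_neq0// gt_eqF// pi_gt0.
  set x := 2 * pi in p0 *; rewrite [RHS]mulrCA; congr (_ * _).
  by rewrite invfM expr2 [in RHS]invfM -mulrA mulKf.
have cm2 : m k ^+ 2 @[k --> \oo] --> (2 * pi) ^+ 2.
  by rewrite expr2; under eq_cvg do rewrite expr2; exact: cvgM.
have q0 : (2 * pi) ^+ 2 != 0 :> R by rewrite expf_neq0// mulf_neq0// gt_eqF// pi_gt0.
apply: (@squeeze_family _ _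
  (fun k n => ((2 * pi) ^+ 2 * expR (4 * g * e k))^-1 *
     (smoothed_mean (l k) n (e k, e k) - B * ((2 * pi) ^+ 2 - m k ^+ 2)))
  (fun k n => (m k ^+ 2)^-1 * expR (4 * g * e k) * smoothed_mean (l k) n (0 - e k, 0 - e k))
  (fun k => ((2 * pi) ^+ 2 * expR (4 * g * e k))^-1 * (L - B * ((2 * pi) ^+ 2 - m k ^+ 2)))
  (fun k => (m k ^+ 2)^-1 * expR (4 * g * e k) * L)).
- move=> k; exists 1%N => // n /= n0.
  have UE : U n (0, 0) = n%:R * (\int[nu n]_s h s)%R.
    congr (_ * _); apply: eq_Rintegral => -[s1 s2] _.
    by rewrite /= !subr0.
  apply/andP; split.
    have := smoothed_mean_le (e k) (l0 k) (fun x => hB n x n0).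
    rewrite UE -/(m k) => H.
    rewrite ler_pdivrMl; first by move: H; rewrite lerBlDr [X in X + _]mulrA.
    by rewrite mulr_gt0 ?expR_gt0// exprn_gt0// mulr_gt0// pi_gt0.
  have := le_smoothed_mean (e k) (l0 k) n (0, 0).
  rewrite UE -/(m k) => H.
  rewrite -mulrA ler_pdivlMl ?exprn_gt0//.
  rewrite -ler_pdivrMl ?expR_gt0// -expRN.
  by rewrite mulrCA.
- move=> k; apply: cvgMr; apply: cvgB; last exact: cvg_cst.
  exact: cvg_smoothed_mean.
- by move=> k; apply: cvgMr; exact: cvg_smoothed_mean.
- rewrite [X in _ --> X](_ : _ = ((2 * pi) ^+ 2 * 1)^-1 * (L - B * ((2 * pi) ^+ 2 - (2 * pi) ^+ 2))); last first.
    rewrite subrr mulr0 subr0 mulr1.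
    exact: alg.
  apply: cvgM.
    apply: cvgV; first by rewrite mulr1.
    by apply: cvgM => //; exact: cvg_cst.
  apply: cvgB; first exact: cvg_cst.
  by apply: cvgMr; apply: cvgB => //; exact: cvg_cst.
- rewrite [X in _ --> X](_ : _ = ((2 * pi) ^+ 2)^-1 * 1 * L); last first.
    rewrite mulr1.
    exact: alg.
  apply: cvgM; last exact: cvg_cst.
  by apply: cvgM => //; exact: cvgV.
Qed.

End llt.

(** * Moments of exponential weights *)

Section density_probability.
Context d (T : measurableType d) (R : realType).
Variables (mu : {measure set T -> \bar R}) (g : T -> R).
Hypothesis g0 : forall x, 0 <= g x.
Hypothesis mg : measurable_fun setT g.

Definition density_prob of (\int[mu]_x (g x)%:E = 1)%E := @density _ _ _ mu g g0 mg.

Hypothesis g1 : (\int[mu]_x (g x)%:E = 1)%E.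

HB.instance Definition _ := Measure.on (density_prob g1).

Let density_prob_setT : density_prob g1 setT = 1%E.
Proof. exact: g1. Qed.

HB.instance Definition _ :=
  Measure_isProbability.Build _ _ _ (density_prob g1) density_prob_setT.

Lemma ge0_integral_density_prob (f : T -> \bar R) :
  measurable_fun setT f -> (forall x, 0 <= f x)%E ->
  (\int[density_prob g1]_x f x = \int[mu]_x (f x * (g x)%:E))%E.
Proof. exact: ge0_integral_density. Qed.

Lemma integrable_density_prob (f : T -> R) : measurable_fun setT f ->
  mu.-integrable setT (EFin \o (fun x => f x * g x)) ->
  (density_prob g1).-integrable setT (EFin \o f).
Proof. by move=> mf fi; have [] := integral_density g0 mg mf fi. Qed.

Lemma Rintegral_density_prob (f : T -> R) : measurable_fun setT f ->
  mu.-integrable setT (EFin \o (fun x => f x * g x)) ->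
  (\int[density_prob g1]_x f x = \int[mu]_x (f x * g x))%R.
Proof.
by move=> mf fi; have [_ e] := integral_density g0 mg mf fi; rewrite /Rintegral -e.
Qed.

End density_probability.

Section exponential.
Context {R : realType}.
Local Notation mu := (@lebesgue_measure R).

Lemma integral_expN (r : R) : 0 < r ->
  (\int[mu]_x (expR (- (r * x)) * \1_(`[0%R, +oo[%classic) x)%:E = (r^-1)%:E)%E.
Proof.
move=> r0.
have h : (r%:E * \int[mu]_x (expR (- (r * x)) * \1_(`[0%R, +oo[%classic) x)%:E = 1)%E.
  rewrite -(integral_exponential_pdf r0) -ge0_integralZl_EFin//.
  - apply: eq_integral => x _; rewrite -EFinM; congr EFin.
    rewrite /exponential_pdf patchE indicE; case: ifPn => _.
      by rewrite mulr1 mulNr.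
    by rewrite !mulr0.
  - apply/measurable_EFinP; apply: measurable_funM => //.
    by apply: measurableT_comp => //; apply: measurableT_comp => //; exact: measurable_funM.
  - exact: ltW.
have r1 : ((r^-1)%:E * r%:E = 1)%E by rewrite -EFinM mulVf// gt_eqF.
by rewrite -[LHS]mul1e -r1 -muleA h mule1.
Qed.

Lemma integrable_expN_norm : mu.-integrable setT (EFin \o (fun x : R => expR (- `|x|))).
Proof.
have mE : measurable_fun setT (fun x : R => expR (- `|x|)).
  by apply: measurableT_comp => //; apply: measurableT_comp.
apply/integrableP; split; first exact/measurable_EFinP.
rewrite (@ge0_integral_even _ (fun x => `|(expR (- `|x|))%:E|%E)) => //=; last 2 first.
- by apply/measurable_EFinP; apply: measurableT_comp.
- by move=> x; rewrite normrN.
apply: (@le_lt_trans _ _ (2%:E * (1^-1)%:E)%E); last by rewrite -EFinM ltry.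
rewrite -(integral_expN ltr01) lee_pmul2l//.
rewrite integral_mkcond; apply: ge0_le_integral => //.
- by move=> x _; rewrite patchE; case: ifP => // _; rewrite lee_fin.
- apply/(measurable_restrictT _ _).1 => //; apply: measurable_funTS.
  by apply/measurable_EFinP; apply: measurableT_comp.
- apply/measurable_EFinP; apply: measurable_funM => //.
  by apply: measurableT_comp => //; apply: measurableT_comp => //; exact: measurable_funM.
move=> x _; rewrite patchE; case: ifPn; last by rewrite lee_fin mulr_ge0// expR_ge0.
rewrite inE/= in_itv/= andbT => x0; rewrite lee_fin indicE mem_set ?mulr1.
  by rewrite ger0_norm ?expR_ge0// ger0_norm ?mul1r// ltW.
by rewrite /= in_itv/= ltW.
Qed.

(** This is [y <= exp y] at [y = e x / k], raised to the power [k]; the case [k = 0] is apart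
    because of the division. *)
Lemma exprn_le_expR (k : nat) (e x : R) : 0 < e -> 0 <= x ->
  x ^+ k <= (k%:R / e) ^+ k * expR (e * x).
Proof.
move=> e0 x0; case: k => [|k]; first by rewrite !expr0 mul1r -expR0 ler_expR mulr_ge0// ltW.
have k0 : 0 < k.+1%:R :> R by rewrite ltr0n.
have -> : e * x = (e * x / k.+1%:R) * k.+1%:R by rewrite mulfVK// gt_eqF.
rewrite expRM_natr -exprMn lerXn2r ?nnegrE//.
  by rewrite mulr_ge0 ?expR_ge0// divr_ge0// ltW.
have h : e * x / k.+1%:R <= expR (e * x / k.+1%:R).
  by apply: le_trans (expR_ge1Dx _); rewrite lerDr.
rewrite [leLHS](_ : _ = k.+1%:R / e * (e * x / k.+1%:R)); last first.
  by rewrite -!mulrA mulKf ?gt_eqF// mulrCA divff ?gt_eqF// mulr1.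
by rewrite ler_wpM2l// divr_ge0// ltW.
Qed.
End exponential.

Definition wt {R : realType} (p q t s x : R) : R :=
  expR (t * `|x| `^ q - s * `|x| `^ p).

(* Locked: the unifier would otherwise compare integrals by unfolding them. *)
HB.lock Definition moment {R : realType} (p q : R) (G : R -> R) (t s : R) : R :=
  (\int[@lebesgue_measure R]_x (G x * wt p q t s x))%R.

Lemma momentE (R : realType) (p q : R) (G : R -> R) (t s : R) :
  moment p q G t s = (\int[@lebesgue_measure R]_x (G x * wt p q t s x))%R.
Proof. by rewrite moment.unlock. Qed.

Lemma eq_moment (R : realType) (p q : R) (G H : R -> R) (t s : R) : G =1 H ->
  moment p q G t s = moment p q H t s.
Proof. by move=> /funext ->. Qed.

Section weight.
Context {R : realType} (p q : R).
Hypotheses (q1 : 1 <= q) (qp : q < p).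
Local Notation mu := (@lebesgue_measure R).

Local Notation wt := (wt p q).
Local Notation moment := (moment p q).

Let q0 : 0 < q. Proof. exact: lt_le_trans q1. Qed.
Let p0 : 0 < p. Proof. exact: lt_trans qp. Qed.

Lemma measurable_powR_norm r : measurable_fun setT (fun x : R => `|x| `^ r).
Proof. by apply: (measurableT_comp (measurable_powR _)). Qed.

Lemma measurable_wt t s : measurable_fun setT (wt t s).
Proof.
apply: measurableT_comp => //; apply: measurable_funB; apply: measurable_funM => //;
  exact: measurable_powR_norm.
Qed.

Lemma wt_gt0 t s x : 0 < wt t s x.
Proof. exact: expR_gt0. Qed.

(** As [q < p], beyond some [K >= 1] the term [s |x|^p] exceeds [(|t| + 1) |x|^q], and
    [|x|^q >= |x|] there because [q >= 1]. Up to [K] the exponent is bounded outright. *)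
Lemma wt_le t s : 0 < s -> exists C, forall x, wt t s x <= C * expR (- `|x|).
Proof.
move=> s0.
pose c := (`|t| + 1) / s.
have c0 : 0 < c by rewrite divr_gt0// ltr_wpDl.
pose K := Num.max 1 (c `^ (p - q)^-1).
have K1 : 1 <= K by rewrite le_max lexx.
have pq0 : 0 < p - q by rewrite subr_gt0.
have Kc : c <= K `^ (p - q).
  have -> : c = (c `^ (p - q)^-1) `^ (p - q).
    by rewrite -powRrM mulVf ?gt_eqF// powRr1// ltW.
  apply: ge0_ler_powR; rewrite ?nnegrE ?powR_ge0 ?(ltW pq0)//.
    exact: le_trans K1.
  by rewrite le_max lexx orbT.
exists (expR (`|t| * K `^ q + K)) => x.
rewrite -expRD ler_expR.
have [xK|Kx] := leP `|x| K.
  have h1 : t * `|x| `^ q <= `|t| * K `^ q.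
    rewrite (le_trans (ler_norm _))// normrM ler_wpM2l// (ger0_norm (powR_ge0 _ _)).
    by rewrite ge0_ler_powR ?nnegrE ?(ltW q0)// (le_trans _ K1).
  have h2 : 0 <= s * `|x| `^ p by rewrite mulr_ge0 ?powR_ge0// ltW.
  lra.
have x1 : 1 <= `|x| by rewrite (le_trans K1)// ltW.
have x0 : 0 < `|x| by exact: lt_le_trans x1.
have -> : `|x| `^ p = `|x| `^ q * `|x| `^ (p - q).
  have e : q + (p - q) = p by rewrite addrC subrK.
  by rewrite -powRD ?e// (gt_eqF x0) implybT.
have h1 : c <= `|x| `^ (p - q).
  apply: (le_trans Kc); rewrite ge0_ler_powR ?nnegrE ?(ltW pq0)// ?(ltW Kx)//.
  by rewrite (le_trans _ K1).
have h2 : `|t| + 1 <= s * `|x| `^ (p - q) by rewrite -ler_pdivrMl// mulrC.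
have h3 : `|x| <= `|x| `^ q by exact: le1r_powR.
have h4 : `|x| `^ q * (`|t| + 1) <= `|x| `^ q * (s * `|x| `^ (p - q)).
  by rewrite ler_wpM2l// powR_ge0.
have h5 : t * `|x| `^ q <= `|x| `^ q * `|t|.
  by rewrite mulrC ler_wpM2l ?powR_ge0// ler_norm.
have h6 : 0 <= `|t| * K `^ q by rewrite mulr_ge0 ?powR_ge0.
rewrite mulrDr mulr1 in h4.
by rewrite mulrCA; lra.
Qed.

Lemma integrable_wt t s : 0 < s -> mu.-integrable setT (EFin \o wt t s).
Proof.
move=> s0; have [C hC] := wt_le t s0.
apply: le_integrableR (integrableRZl C integrable_expN_norm).
  exact: measurable_wt.
by move=> x; rewrite ger0_norm ?hC// ltW// wt_gt0.
Qed.

(** A class of observables closed under sums and products and containing [|x|^q] and [|x|^p]. Every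
    member is integrable against every weight with [s > 0], so derivatives of moments stay in the
    class. *)
Definition poly_bounded (G : R -> R) := measurable_fun setT G /\
  exists k c, forall x, `|G x| <= c * (1 + (`|x| `^ q + `|x| `^ p)) ^+ k.

Lemma poly_bounded_cst c : poly_bounded (fun=> c).
Proof. by split=> //; exists 0, `|c| => x; rewrite expr0 mulr1. Qed.

Lemma poly_boundedq : poly_bounded (fun x => `|x| `^ q).
Proof.
split; first exact: measurable_powR_norm.
exists 1, 1 => x; rewrite expr1 mul1r ger0_norm ?powR_ge0//.
by have := powR_ge0 `|x| p; have := powR_ge0 `|x| q; lra.
Qed.

Lemma poly_boundedp : poly_bounded (fun x => `|x| `^ p).
Proof.
split; first exact: measurable_powR_norm.
exists 1, 1 => x; rewrite expr1 mul1r ger0_norm ?powR_ge0//.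
by have := powR_ge0 `|x| p; have := powR_ge0 `|x| q; lra.
Qed.

Lemma poly_boundedM G H : poly_bounded G -> poly_bounded H ->
  poly_bounded (fun x => G x * H x).
Proof.
move=> [mG [k [c hG]]] [mH [l [e hH]]]; split; first exact: measurable_funM.
exists (k + l)%N, (c * e) => x.
by rewrite normrM exprD mulrACA ler_pM.
Qed.

Lemma poly_boundedD G H : poly_bounded G -> poly_bounded H ->
  poly_bounded (fun x => G x + H x).
Proof.
move=> [mG [k [c hG]]] [mH [l [e hH]]]; split; first exact: measurable_funD.
exists (k + l)%N, (`|c| + `|e|) => x.
have y1 : 1 <= 1 + (`|x| `^ q + `|x| `^ p) by rewrite lerDl addr_ge0// powR_ge0.
set y := 1 + _ in y1 *.
have y0 : 0 <= y by exact: le_trans y1.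
rewrite (le_trans (ler_normD _ _))// mulrDl exprD lerD//.
  apply: (le_trans (hG x)); rewrite -/y mulrA.
  apply: (@le_trans _ _ (`|c| * y ^+ k)); last first.
    by rewrite ler_peMr ?exprn_ege1// mulr_ge0// exprn_ge0.
  by rewrite ler_wpM2r ?exprn_ge0// ler_norm.
apply: (le_trans (hH x)); rewrite -/y.
apply: (@le_trans _ _ (`|e| * y ^+ l)); last first.
  by rewrite mulrCA ler_peMl ?exprn_ege1// mulr_ge0// exprn_ge0.
by rewrite ler_wpM2r ?exprn_ge0// ler_norm.
Qed.

Lemma integrable_polyM t s G : 0 < s -> poly_bounded G ->
  mu.-integrable setT (EFin \o (fun x => G x * wt t s x)).
Proof.
move=> s0 [mG [k [c hG]]].
(* Half of [s] pays for the polynomial: with [y = 1 + |x|^q + |x|^p], the bound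
   [y^k <= c exp (s y / 2)] only changes the weight to parameters [(t + s / 2, s / 2)]. *)
have e0 : 0 < s / 2 by rewrite divr_gt0.
have s20 : 0 < s - s / 2 by lra.
pose C := `|c| * ((k%:R / (s / 2)) ^+ k * expR (s / 2)).
apply: le_integrableR (integrableRZl C (integrable_wt (t + s / 2) s20)).
  by apply: measurable_funM => //; exact: measurable_wt.
move=> x; rewrite normrM (ger0_norm (ltW (wt_gt0 _ _ _))).
have y0 : 0 <= 1 + (`|x| `^ q + `|x| `^ p) by rewrite !addr_ge0// powR_ge0.
have -> : C * wt (t + s / 2) (s - s / 2) x =
  `|c| * ((k%:R / (s / 2)) ^+ k * expR (s / 2 * (1 + (`|x| `^ q + `|x| `^ p)))) * wt t s x.
  rewrite /C /wt -!mulrA; congr (_ * (_ * _)); rewrite -!expRD; congr expR; ring.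
rewrite ler_wpM2r ?(ltW (wt_gt0 _ _ _))// (le_trans (hG x))//.
apply: (@le_trans _ _ (`|c| * (1 + (`|x| `^ q + `|x| `^ p)) ^+ k)).
  by rewrite ler_wpM2r ?exprn_ge0// ler_norm.
by rewrite ler_wpM2l// exprn_le_expR.
Qed.

Local Notation PB := poly_bounded.
Local Notation A x := (`|x| `^ q).
Local Notation B x := (`|x| `^ p).

Lemma momentD G H t s : 0 < s -> PB G -> PB H ->
  moment (fun x => G x + H x) t s = moment G t s + moment H t s.
Proof.
move=> s0 bG bH; rewrite !momentE -RintegralD//; try exact: integrable_polyM.
by apply: eq_Rintegral => x _; rewrite mulrDl.
Qed.

Lemma momentZ c G t s : 0 < s -> PB G ->
  moment (fun x => c * G x) t s = c * moment G t s.
Proof.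
move=> s0 bG; rewrite !momentE -RintegralZl//; last exact: integrable_polyM.
by apply: eq_Rintegral => x _; rewrite mulrA.
Qed.

Lemma moment_ge0 G t s : (forall x, 0 <= G x) -> 0 <= moment G t s.
Proof.
by rewrite momentE => G0; apply: Rintegral_ge0 => x _; rewrite mulr_ge0// ltW// wt_gt0.
Qed.

(** Differentiation under the integral along a curve [(a h, b h)], so that one statement covers the
    dilation identity and the coordinate directions. The weight with the largest [a] and the
    smallest [b] dominates. *)
Lemma is_derive_moment (G : R -> R) (a b a' b' : R -> R) (e a0 b0 c : R) :
  PB G -> 0 < e -> 0 < b0 ->
  (forall h, - e < h < e -> [/\ is_derive h 1 a (a' h), is_derive h 1 b (b' h),
     a h <= a0, b0 <= b h & `|a' h| <= c /\ `|b' h| <= c]) ->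
  is_derive (0 : R) (1 : R) (fun h => moment G (a h) (b h))
    (a' 0 * moment (fun x => G x * A x) (a 0) (b 0) -
     b' 0 * moment (fun x => G x * B x) (a 0) (b 0)).
Proof.
move=> bG e0 b00 H.
have I0 : `](- e), e[%classic (0 : R) by rewrite /= in_itv/= oppr_lt0 e0.
have bGA : PB (fun x => G x * A x) by apply: poly_boundedM => //; exact: poly_boundedq.
have bGB : PB (fun x => G x * B x) by apply: poly_boundedM => //; exact: poly_boundedp.
pose f h x := G x * wt (a h) (b h) x.
pose df h x := G x * ((a' h * A x - b' h * B x) * wt (a h) (b h) x).
have fd h x : `](- e), e[%classic h -> is_derive h 1 (f ^~ x) (df h x).
  rewrite /= in_itv/= => /H[ha hb _ _ _].
  have hw : is_derive h 1 (fun h => wt (a h) (b h) x)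
     ((a' h * A x - b' h * B x) * wt (a h) (b h) x).
    have hin : is_derive h 1 (fun h => a h * A x - b h * B x) (a' h * A x - b' h * B x).
      have := is_derive_funB (is_derive_funM ha (is_derive_cst (A x) h 1))
        (is_derive_funM hb (is_derive_cst (B x) h 1)).
      by move=> hh; apply: (is_derive_eq hh); rewrite !mulr0 !addr0.
    have := @is_derive_fun_comp _ expR (fun h => a h * A x - b h * B x) h _ _ (is_derive_expR _) hin.
    by move=> hh; apply: (is_derive_eq hh); rewrite mulrC.
  have := is_derive_funM (is_derive_cst (G x) h 1) hw.
  by move=> hh; apply: (is_derive_eq hh); rewrite mul0r add0r.
have d1f h x : `](- e), e[%classic h -> partial1of2 f h x = df h x.
  by move=> Ih; have := fd h x Ih => hd; rewrite partial1of2E derive_val.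
have bi h : `](- e), e[%classic h -> 0 < b h.
  by rewrite /= in_itv/= => /H[_ _ _ bh _]; exact: lt_le_trans bh.
have intf h : `](- e), e[%classic h -> mu.-integrable setT (EFin \o f h).
  by move=> Ih; apply: integrable_polyM => //; exact: bi.
have derf h x : `](- e), e[%classic h -> setT x -> derivable (f ^~ x) h 1.
  by move=> Ih _; have := fd h x Ih => hd; exact: ex_derive.
pose D x := c * ((`|G x| * (A x + B x)) * wt a0 b0 x).
have D0 x : 0 <= D x.
  have c0 : 0 <= c by have [_ _ _ _ [h _]] := H 0 ltac:(by rewrite oppr_lt0 e0); exact: le_trans h.
  by rewrite mulr_ge0// mulr_ge0 ?(ltW (wt_gt0 _ _ _))// mulr_ge0// addr_ge0// powR_ge0.
have bD : PB (fun x => `|G x| * (A x + B x)).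
  apply: poly_boundedM; last by apply: poly_boundedD; [exact: poly_boundedq|exact: poly_boundedp].
  have [mG [k [c1 hG]]] := bG; split; first exact: measurableT_comp.
  by exists k, c1 => x; rewrite normr_id.
have intD : mu.-integrable setT (EFin \o D).
  by apply: integrableRZl; exact: integrable_polyM.
have ubD h x : `](- e), e[%classic h -> setT x -> `|partial1of2 f h x| <= D x.
  move=> Ih _; rewrite d1f//; move: Ih; rewrite /= in_itv/= => /H[_ _ ah bh [a'c b'c]].
  rewrite /df /D !normrM (ger0_norm (ltW (wt_gt0 _ _ _))).
  rewrite -(mulrA `|G x|) [leRHS]mulrCA ler_wpM2l// mulrA.
  apply: ler_pM => //; first exact: (ltW (wt_gt0 _ _ _)).
    rewrite (le_trans (ler_normB _ _))// mulrDr !normrM !(ger0_norm (powR_ge0 _ _)).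
    by rewrite lerD// ler_wpM2r// powR_ge0.
  by rewrite ler_expR lerB// ler_wpM2r// powR_ge0.
have dv := differentiation_under_integral measurableT I0 intf derf D0 intD ubD.
have dr := derivable_under_integral measurableT I0 intf derf D0 intD ubD.
rewrite (_ : (fun h => moment G (a h) (b h)) = fun h => (\int[mu]_x f h x)%R);
  last by apply/funext => h; rewrite momentE.
apply: DeriveDef => //.
rewrite -derive1E [LHS]dv.
rewrite -[X in X - _]momentZ// -?[X in _ - X]momentZ//; try exact: bi.
have b0' := bi 0 I0.
rewrite !momentE -RintegralB//; last 2 first.
- by apply: integrable_polyM => //; apply: poly_boundedM => //; exact: poly_bounded_cst.
- by apply: integrable_polyM => //; apply: poly_boundedM => //; exact: poly_bounded_cst.
by apply: eq_Rintegral => x _; rewrite d1f// /df; ring.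
Qed.

Let is_derive_expRM k (h : R) : is_derive h (1 : R) (fun h => expR (k * h)) (k * expR (k * h)).
Proof.
have hk : is_derive h 1 (fun h : R => k * h) k.
  have := is_derive_funM (is_derive_cst k h 1) (is_derive_id h 1).
  by move=> hh; apply: (is_derive_eq hh); rewrite mul0r add0r mulr1.
have := @is_derive_fun_comp _ expR (fun h => k * h) h _ _ (is_derive_expR _) hk.
by move=> hh; apply: (is_derive_eq hh); rewrite mulrC.
Qed.

Let expR_powR (h r : R) : expR h `^ r = expR (r * h).
Proof. by rewrite /powR gt_eqF ?expR_gt0// expRK. Qed.

(** The substitution [x -> exp h * x]: the Jacobian and the degree of [G] come out as a factor, and
    the dilation acts on the two parameters of the weight. *)
Lemma moment_dilation G r t s h : 0 < s -> PB G -> (forall x, 0 <= G x) ->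
  (forall x, G (expR h * x) = expR (r * h) * G x) ->
  moment G t s = expR ((1 + r) * h) * moment G (t * expR (q * h)) (s * expR (p * h)).
Proof.
move=> s0 bG G0 Gh; have s1 : 0 < s * expR (p * h) by rewrite mulr_gt0 ?expR_gt0.
have mw u v : measurable_fun setT (fun x => G x * wt u v x).
  by apply: measurable_funM; [exact: bG.1|exact: measurable_wt].
apply: EFin_inj; rewrite !momentE -EFin_Rintegral//; last exact: integrable_polyM.
rewrite EFinM -EFin_Rintegral//; last exact: integrable_polyM.
rewrite -(@ge0_integral_affine _ (expR h) 0 _ (expR_gt0 h)); last 2 first.
- exact/measurable_EFinP.
- by move=> x; rewrite lee_fin mulr_ge0// ltW// wt_gt0.
rewrite mulrDl mul1r expRD EFinM -muleA; congr *%E.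
rewrite -ge0_integralZl_EFin ?expR_ge0//; last 2 first.
- by move=> x _; rewrite lee_fin mulr_ge0// ltW// wt_gt0.
- by apply/measurable_EFinP; exact: mw.
apply: eq_integral => x _; rewrite -EFinM addr0 Gh mulrA; congr (_ * expR _)%:E.
rewrite normrM (ger0_norm (expR_ge0 h)) !powRM ?expR_ge0// !expR_powR.
by rewrite !mulrA.
Qed.

(** The left side of the dilation identity does not depend on [h], so the derivative at [h = 0]
    vanishes. This is integration by parts against the dilation field, without differentiating
    [G]. *)
Lemma moment_homogeneous G r t s : 0 < s -> PB G -> (forall x, 0 <= G x) ->
  (forall h x, G (expR h * x) = expR (r * h) * G x) ->
  (1 + r) * moment G t s + q * t * moment (fun x => G x * A x) t s -
    p * s * moment (fun x => G x * B x) t s = 0.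
Proof.
move=> s0 bG G0 Gh.
pose a h := t * expR (q * h); pose b h := s * expR (p * h).
pose a' h := t * (q * expR (q * h)); pose b' h := s * (p * expR (p * h)).
have b00 : 0 < s * expR (- p) by rewrite mulr_gt0 ?expR_gt0.
have H (h : R) : -1 < h < 1 -> [/\ is_derive h 1 a (a' h), is_derive h 1 b (b' h),
     a h <= `|t| * expR q, s * expR (- p) <= b h &
     `|a' h| <= `|t| * (q * expR q) + s * (p * expR p) /\
     `|b' h| <= `|t| * (q * expR q) + s * (p * expR p)].
  move=> /andP[h1 h2].
  have hq : expR (q * h) <= expR q by rewrite ler_expR ler_piMr ?(ltW q0)// ltW.
  have hp : expR (p * h) <= expR p by rewrite ler_expR ler_piMr ?(ltW p0)// ltW.
  have hp' : expR (- p) <= expR (p * h).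
    by rewrite ler_expR -mulrN1 ler_wpM2l ?(ltW p0)// ltW.
  have n1 : 0 <= `|t| * (q * expR q) by rewrite !mulr_ge0 ?expR_ge0// ltW.
  have n2 : 0 <= s * (p * expR p) by rewrite !mulr_ge0 ?expR_ge0// ltW.
  split.
  - have hh := is_derive_funM (is_derive_cst t h 1) (is_derive_expRM q h).
    by apply: (is_derive_eq hh); rewrite mul0r add0r.
  - have hh := is_derive_funM (is_derive_cst s h 1) (is_derive_expRM p h).
    by apply: (is_derive_eq hh); rewrite mul0r add0r.
  - by rewrite (le_trans (ler_norm _))// normrM (ger0_norm (expR_ge0 _)) ler_wpM2l.
  - by rewrite ler_wpM2l// ltW.
  - rewrite !normrM !(ger0_norm (expR_ge0 _)) (gtr0_norm s0) (gtr0_norm q0) (gtr0_norm p0).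
    split.
      rewrite -[leLHS]addr0 lerD// ler_wpM2l// ler_wpM2l// ltW//.
    by rewrite -[leLHS]add0r lerD// ler_wpM2l ?(ltW s0)// ler_wpM2l// ltW.
have D1 := is_derive_moment bG ltr01 b00 H.
have E h : moment G (a h) (b h) = moment G t s * expR (- (1 + r) * h).
  rewrite (moment_dilation t s0 bG G0 (Gh h)) mulrAC -expRD mulNr subrr expR0 mul1r.
  by [].
have D2 := is_derive_funM (is_derive_cst (moment G t s) (0 : R) (1 : R)) (is_derive_expRM (- (1 + r)) 0).
have D3 : is_derive (0:R) (1:R) (fun h => moment G t s * expR (- (1 + r) * h))
   (a' 0 * moment (fun x => G x * A x) (a 0) (b 0) -
     b' 0 * moment (fun x => G x * B x) (a 0) (b 0)).
  by move: D1; rewrite (_ : (fun h => moment G (a h) (b h)) =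
    (fun h => moment G t s * expR (- (1 + r) * h))); [|exact/funext].
have := @derive_val _ _ _ _ _ _ _ D3; have := @derive_val _ _ _ _ _ _ _ D2.
rewrite /a /b /a' /b' /= !mulr0 expR0 !mulr1 add0r => -> h.
by lra.
Qed.

End weight.

(** * Positivity of integrals and the Gamma normalization *)

Section positivity.
Context {R : realType}.
Local Notation mu := (@lebesgue_measure R).

Lemma Rintegral_gt0 (f : R -> R) (x0 : R) : (forall x, 0 <= f x) ->
  mu.-integrable setT (EFin \o f) -> {for x0, continuous f} -> 0 < f x0 ->
  0 < (\int[mu]_x f x)%R.
Proof.
move=> f0 fi /cvgrPdist_lt cf fx0.
have e0 : 0 < f x0 / 2 by rewrite divr_gt0.
have [e /= e1 He] := cf _ e0.
pose I : set R := `[x0 - e / 2, x0 + e / 2]%classic.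
have mI : measurable I by exact: measurable_itv.
have mf : measurable_fun setT (EFin \o f) by case/integrableP: fi.
rewrite -lte_fin -EFin_Rintegral//.
apply: (@lt_le_trans _ _ (\int[mu]_(x in I) (f x0 / 2)%:E)%E).
  have mIE : mu I = e%:E.
    rewrite /I lebesgue_measure_itv/= lte_fin ifT; last by lra.
    by rewrite -EFinB; congr EFin; lra.
  rewrite (_ : (\int[mu]_(x in I) (f x0 / 2)%:E)%E = ((f x0 / 2)%:E * mu I)%E); last first.
    exact: integral_cst.
  by rewrite mIE -EFinM lte_fin mulr_gt0.
apply: (@le_trans _ _ (\int[mu]_(x in I) (f x)%:E)%E); last first.
  by apply: ge0_subset_integral => // x _; rewrite lee_fin.
apply: ge0_le_integral => //.
- by move=> x _; rewrite lee_fin ltW.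
- by apply: measurable_funTS.
move=> x; rewrite /I/= in_itv/= => /andP[h1 h2]; rewrite lee_fin.
have /He : ball x0 e x by rewrite /ball/= ltr_distlC; apply/andP; split; lra.
by rewrite ltr_distlC => /andP[h3 h4]; lra.
Qed.

Lemma continuous_expR_at (f : R -> R) x : {for x, continuous f} ->
  {for x, continuous (fun y => expR (f y))}.
Proof. by move=> cf; apply: continuous_comp => //; exact: continuous_expR. Qed.

Lemma continuous_powR_norm (r : R) (x : R) : 0 < x ->
  {for x, continuous (fun y : R => `|y| `^ r)}.
Proof.
move=> x0; apply: (@continuous_comp _ _ _ (fun y : R => `|y|) (fun y : R => y `^ r)).
  exact: norm_continuous.
have dv : derivable (fun y : R => y `^ r) `|x| 1.
  by apply: derivable_powR; rewrite in_itv/= andbT normr_gt0 gt_eqF.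
by apply/differentiable_continuous; exact/derivable1_diffP.
Qed.

End positivity.

Section gamma_normalization.
Context {R : realType} (p : R).
Hypothesis p0 : 0 < p.
Local Notation mu := (@lebesgue_measure R).
Local Open Scope ereal_scope.

(** Layer-cake integrand. Integrating out the second variable gives [exp (- |x|^p / p)]; integrating
    out the first gives [exp (- t)] times the length [(p t)^(1/p)]. Tonelli then replaces a change
    of variables. *)
Let K (z : R * R) : \bar R :=
  (\1_(`]0%R, +oo[%classic) z.1 * ((`|z.1| `^ p / p <= z.2)%R%:R * expR (- z.2)))%:E.

Let mpow : measurable_fun setT (fun x : R => (`|x| `^ p / p)%R).
Proof. by apply: measurable_funM => //; exact: measurable_powR_norm. Qed.

Let mK : measurable_fun setT K.
Proof.
apply/measurable_EFinP; apply: measurable_funM.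
  by apply: measurableT_comp => //; exact: measurable_indic.
apply: measurable_funM; last by apply: measurableT_comp => //; exact: measurableT_comp.
have mb : measurable_fun setT (fun z : R * R => (`|z.1| `^ p / p <= z.2)%R).
  apply: measurable_fun_ler; last exact: measurable_snd.
  exact: (measurableT_comp mpow (@measurable_fst _ _ _ _)).
rewrite (_ : (fun z => _) = (fun z : R * R => if (`|z.1| `^ p / p <= z.2)%R then 1%R else 0%R)).
  by apply: measurable_fun_ifT.
by apply/funext => z; case: ifP.
Qed.

Let K0 z : 0 <= K z.
Proof. by rewrite lee_fin mulr_ge0// mulr_ge0// expR_ge0. Qed.

Let inner1 (x : R) : \int[mu]_t K (x, t) =
  (\1_(`]0%R, +oo[%classic) x * expR (- (`|x| `^ p / p)))%:E.
Proof.
set c := (`|x| `^ p / p)%R.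
have mk : measurable_fun setT (fun t => K (x, t)).
  by apply: (measurableT_comp mK); exact: measurable_pair1.
rewrite -(@ge0_integral_affine _ 1%R c (fun t => K (x, t)))// mul1e.
transitivity (\int[mu]_t ((\1_(`]0%R, +oo[%classic) x * expR (- c))%:E *
    (expR (- (1 * t)) * \1_(`[0%R, +oo[%classic) t)%:E)).
  apply: eq_integral => t _; rewrite -EFinM /K/= !mul1r -/c lerDr opprD expRD.
  have -> : \1_(`[0%R, +oo[%classic) t = (0 <= t)%R%:R :> R.
    by rewrite indicE mem_setE in_itv/= andbT.
  by congr EFin; ring.
rewrite ge0_integralZl_EFin//.
- by rewrite integral_expN// invr1 mule1.
- apply/measurable_EFinP; apply: measurable_funM => //.
  by apply: measurableT_comp => //; apply: measurableT_comp => //; exact: measurable_funM.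
Qed.

Let inner2 (t : R) : \int[mu]_x K (x, t) =
  (\1_(`]0%R, +oo[%classic) t * ((p * t) `^ p^-1 * expR (- t)))%:E.
Proof.
have pinv : (0 < p^-1)%R by rewrite invr_gt0.
have [t0|t0] := ltP 0%R t; last first.
  rewrite indicE mem_setE in_itv/= andbT ltNge t0 mul0r.
  apply: integral0_eq => x _; rewrite /K/=; congr EFin.
  rewrite indicE mem_setE in_itv/= andbT.
  have [x0|] := ltP 0%R x; last by rewrite mul0r.
  rewrite (_ : (_ <= t)%R = false) ?mul0r ?mulr0//; apply/negbTE; rewrite -ltNge.
  by rewrite (le_lt_trans t0)// divr_gt0// powR_gt0// normr_gt0 gt_eqF.
rewrite indicE mem_setE in_itv/= andbT t0 mul1r.
set c := ((p * t) `^ p^-1)%R.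
have c0 : (0 < c)%R by rewrite powR_gt0// mulr_gt0.
transitivity (\int[mu]_x (expR (- t) * \1_(`]0%R, c]%classic) x)%:E).
  apply: eq_integral => x _; rewrite /K/=; congr EFin.
  rewrite !indicE !mem_setE !in_itv/= andbT mulrA mulrC; congr (_ * _)%R.
  have [x0|] := ltP 0%R x; last by rewrite mul0r.
  rewrite mul1r ger0_norm ?(ltW x0)//; congr (_%:R).
  rewrite ler_pdivrMr// (mulrC t).
  have e : (p * t = c `^ p)%R by rewrite /c -powRrM mulVf ?gt_eqF// powRr1// mulr_ge0// ltW.
  rewrite e; congr nat_of_bool; apply/idP/idP => h; last first.
    by apply: ge0_ler_powR; rewrite ?nnegrE ?(ltW p0) ?(ltW x0) ?(ltW c0).
  rewrite /= leNgt; apply/negP => cx; move: h; rewrite leNgt => /negP; apply.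
  by apply: gt0_ltr_powR; rewrite ?nnegrE ?(ltW x0) ?(ltW c0).
rewrite (@ge0_integralZl_EFin _ _ _ mu setT measurableT (fun x => (\1_(`]0%R, c]%classic) x)%:E))//.
- have mI : measurable (`]0%R, c]%classic : set R) by exact: measurable_itv.
  rewrite integral_indic// setIT.
  have mIE : mu `]0%R, c]%classic = c%:E.
    by rewrite lebesgue_measure_itv/= lte_fin c0 -EFinB subr0.
  transitivity ((expR (- t))%:E * c%:E); first by congr *%E; exact: mIE.
  by rewrite -EFinM mulrC.
- by apply/measurable_EFinP; apply: measurable_indic; exact: measurable_itv.
Qed.

Lemma integral_expR_powR : (1 < p)%R ->
  (\int[mu]_x (expR (- (`|x| `^ p / p)))%:E = (2 * p `^ p^-1 * Gamma (1 + p^-1))%:E).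
Proof.
move=> p1.
have mE : measurable_fun setT (fun x : R => expR (- (`|x| `^ p / p))).
  by apply: measurableT_comp => //; exact: measurableT_comp.
have iE : mu.-integrable setT (EFin \o (fun x : R => expR (- (`|x| `^ p / p)))).
  have s0 : (0 < p^-1)%R by rewrite invr_gt0.
  have := integrable_wt (lexx 1%R) p1 0 s0.
  by apply: eq_integrable => // x _; rewrite /= /wt mul0r add0r mulrC.
have mI : measurable (`]0%R, +oo[%classic : set R) by exact: measurable_itv.
have half : \int[mu]_(x in `]0%R, +oo[) (expR (- (`|x| `^ p / p)))%:E =
    (p `^ p^-1)%:E * \int[mu]_(t in `]0%R, +oo[) (t `^ (1 + p^-1 - 1) * expR (- t))%:E.
  transitivity (\int[mu]_x \int[mu]_t K (x, t)).
    rewrite integral_mkcond; apply: eq_integral => x _; rewrite inner1 patchE indicE.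
    by case: ifPn => _; rewrite ?mul1r ?mul0r.
  rewrite (_ : \int[mu]_x \int[mu]_t K (x, t) = \int[mu]_t \int[mu]_x K (x, t)); last first.
    by have := @fubini_tonelli _ _ _ _ _ mu mu K mK K0.
  rewrite -ge0_integralZl_EFin//; last 3 first.
  - by move=> t _; rewrite lee_fin mulr_ge0 ?expR_ge0 ?powR_ge0.
  - apply/measurable_EFinP; apply: measurable_funTS; apply: measurable_funM.
      exact: measurable_powR.
    by apply: measurableT_comp => //; exact: measurableT_comp.
  - exact: powR_ge0.
  rewrite [RHS]integral_mkcond; apply: eq_integral => t _; rewrite inner2 patchE indicE.
  case: ifPn => [|_]; last by rewrite mul0r.
  rewrite inE/= in_itv/= andbT => t0; rewrite mul1r -EFinM; congr EFin.
  by rewrite powRM ?(ltW p0) ?(ltW t0)// mulrA addrC addKr.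
have even := @ge0_integral_even _ (fun x : R => (expR (- (`|x| `^ p / p)))%:E).
rewrite even; last 3 first.
- exact/measurable_EFinP.
- by move=> x; rewrite lee_fin expR_ge0.
- by move=> x; rewrite normrN.
rewrite half -(mulrA 2%R) EFinM; congr *%E; rewrite EFinM; congr *%E.
(* [Gamma] is read through [fine], which sends an infinite integral to 0. Finiteness follows from
   [half], whose left side is finite. *)
rewrite /Gamma /Rintegral fineK// ge0_fin_numE; last first.
  by apply: integral_ge0 => t _; rewrite lee_fin mulr_ge0 ?expR_ge0 ?powR_ge0.
have : (p `^ p^-1)%:E * \int[mu]_(t in `]0%R, +oo[) (t `^ (1 + p^-1 - 1) * expR (- t))%:E < +oo.
  rewrite -half; apply: le_lt_trans (_ : \int[mu]_x (expR (- (`|x| `^ p / p)))%:E < _).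
    by apply: ge0_subset_integral => //; exact/measurable_EFinP.
  by rewrite EFin_Rintegral// ltry.
case: (\int[mu]_(t in _) _) => [r| |] //; first by move=> _; rewrite ltry.
by rewrite gt0_muley// lte_fin powR_gt0.
Qed.

End gamma_normalization.

(** * Gibbs measures and the Legendre transform *)

Section gibbs.
Context {R : realType} (p q : R).
Hypotheses (q1 : 1 <= q) (qp : q < p).
Local Notation mu := (@lebesgue_measure R).
Local Notation PB := (poly_bounded p q).
Local Notation wt := (wt p q).
Local Notation moment := (moment p q).
Local Notation A x := (`|x| `^ q).
Local Notation B x := (`|x| `^ p).

Let q0 : 0 < q. Proof. exact: lt_le_trans q1. Qed.
Let p0 : 0 < p. Proof. exact: lt_trans qp. Qed.

Definition partition t s := moment (fun=> 1) t s.

Lemma continuous_wt t s x : 0 < x -> {for x, continuous (wt t s)}.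
Proof.
move=> x0; apply: continuous_expR_at; apply: continuousB; apply: continuousM;
  try exact: cst_continuous; exact: continuous_powR_norm.
Qed.

Lemma partition_gt0 t s : 0 < s -> 0 < partition t s.
Proof.
move=> s0; rewrite /partition momentE; apply: (@Rintegral_gt0 _ _ 1).
- by move=> x; rewrite mul1r ltW// wt_gt0.
- by apply: integrable_polyM => //; exact: poly_bounded_cst.
- apply: continuousM; first exact: cst_continuous.
  exact: continuous_wt.
- by rewrite mul1r wt_gt0.
Qed.

Variables t s : R.
Hypothesis s0 : 0 < s.
Local Notation Z := (partition t s).
Let Z0 : 0 < Z. Proof. exact: partition_gt0. Qed.

Definition gibbs_pdf x := wt t s x / Z.

Lemma gibbs_pdf_ge0 x : 0 <= gibbs_pdf x.
Proof. by rewrite divr_ge0// ltW// wt_gt0. Qed.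

Lemma measurable_gibbs_pdf : measurable_fun setT gibbs_pdf.
Proof. by apply: measurable_funM => //; exact: measurable_wt. Qed.

Lemma integral_gibbs_pdf : (\int[mu]_x (gibbs_pdf x)%:E = 1)%E.
Proof.
rewrite EFin_Rintegral//; last first.
  by apply: integrableRZr; exact: integrable_wt.
rewrite RintegralZr//; last exact: integrable_wt.
rewrite (_ : (\int[mu]_x wt t s x)%R = Z); first by rewrite divff// gt_eqF.
by rewrite /partition momentE; apply: eq_Rintegral => x _; rewrite mul1r.
Qed.

Definition gibbs : probability (measurableTypeR R) R :=
  @density_prob _ (measurableTypeR R) R mu gibbs_pdf gibbs_pdf_ge0
    measurable_gibbs_pdf integral_gibbs_pdf.

Lemma integrable_gibbs G : PB G -> gibbs.-integrable setT (EFin \o G).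
Proof.
move=> bG; apply: integrable_density_prob; first exact: bG.1.
have := integrableRZr Z^-1 (integrable_polyM q1 qp t s0 bG).
by apply: eq_integrable => // x _; rewrite /= mulrA.
Qed.

Lemma Rintegral_gibbs G : PB G -> (\int[gibbs]_x G x = moment G t s / Z)%R.
Proof.
move=> bG; rewrite Rintegral_density_prob; last 2 first.
- exact: bG.1.
- have := integrableRZr Z^-1 (integrable_polyM q1 qp t s0 bG).
  by apply: eq_integrable => // x _; rewrite /= mulrA.
rewrite momentE -RintegralZr//; last exact: integrable_polyM.
by apply: eq_Rintegral => x _; rewrite /gibbs_pdf mulrA.
Qed.

(** A characteristic function of modulus 1 would make [exp (i th)] almost surely constant. As the
    weight is positive, [th] would have zero derivative along the whole positive axis, impossible
    for a combination of two different powers. *)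
Lemma gibbs_nonlattice (m u v : R) : (u, v) != (0, 0) ->
  char1C gibbs (fun x => A x - m) (fun x => 1 - B x) u v ^+ 2 +
  char1S gibbs (fun x => A x - m) (fun x => 1 - B x) u v ^+ 2 < 1.
Proof.
move=> uv0.
pose th (x : R) := u * (A x - m) + v * (1 - B x).
have mth : measurable_fun setT th.
  apply: measurable_funD; apply: measurable_funM => //; apply: measurable_funB => //;
    exact: measurable_powR_norm.
set C := char1C _ _ _ _ _; set S := char1S _ _ _ _ _.
pose f x := (cos (th x) - C) ^+ 2 + (sin (th x) - S) ^+ 2.
have f0 x : 0 <= f x by rewrite addr_ge0// sqr_ge0.
have mcos : measurable_fun setT (fun x => cos (th x)).
  by apply: measurableT_comp => //; exact: continuous_measurable_fun (@continuous_cos R).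
have msin : measurable_fun setT (fun x => sin (th x)).
  by apply: measurableT_comp => //; exact: continuous_measurable_fun (@continuous_sin R).
have ic : gibbs.-integrable setT (EFin \o (fun x => cos (th x))).
  by apply: (@bounded_integrable _ _ _ _ _ 1) => // x; exact: cos_max.
have iS : gibbs.-integrable setT (EFin \o (fun x => sin (th x))).
  by apply: (@bounded_integrable _ _ _ _ _ 1) => // x; exact: sin_max.
have i1 : gibbs.-integrable setT (EFin \o (fun=> 1 + C ^+ 2 + S ^+ 2)).
  by apply: (@bounded_integrable _ _ _ _ _ `|1 + C ^+ 2 + S ^+ 2|).
have fE x : f x = 1 + C ^+ 2 + S ^+ 2 - (2 * C * cos (th x) + 2 * S * sin (th x)).
  by rewrite /f; have := cos2Dsin2 (th x); lra.
have i2 : gibbs.-integrable setT (EFin \o (fun x => 2 * C * cos (th x) + 2 * S * sin (th x))).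
  by apply: integrableRD; apply: integrableRZl.
(* The variance of [exp (i th)] as a complex variable. *)
have If : (\int[gibbs]_x f x = 1 - (C ^+ 2 + S ^+ 2))%R.
  under eq_Rintegral do rewrite fE.
  rewrite RintegralB// [X in _ - X]RintegralD//; [|exact: integrableRZl|exact: integrableRZl].
  rewrite !RintegralZl// Rintegral_cst//= probability_setT mulr1.
  rewrite -/C -/S.
  rewrite (_ : (\int[gibbs]_x cos (th x))%R = C)// (_ : (\int[gibbs]_x sin (th x))%R = S)//.
  by ring.
rewrite -subr_gt0 -If.
have mf : measurable_fun setT f.
  by apply: measurable_funD; apply: measurable_funX; exact: measurable_funB.
have fM x : `|f x| <= 1 + C ^+ 2 + S ^+ 2 + (2 * `|C| + 2 * `|S|).
  rewrite fE (le_trans (ler_normB _ _))// lerD//.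
    by rewrite ger0_norm// !addr_ge0// sqr_ge0.
  rewrite (le_trans (ler_normD _ _))// !normrM !(ger0_norm (ler0n _ 2)) lerD//.
    by rewrite ler_piMr// ?mulr_ge0// cos_max.
  by rewrite ler_piMr// ?mulr_ge0// sin_max.
have bf : PB f by split=> //; eexists 0%N, _ => x; rewrite expr0 mulr1; exact: fM.
rewrite Rintegral_gibbs// divr_gt0// momentE.
(* One point with [f > 0] suffices, by continuity. Otherwise [cos th] and [sin th] are constant
   along [x = exp h], and their derivatives together force the derivative of [th] to vanish. *)
have [x0 x00 fx0] : exists2 x0, 0 < x0 & 0 < f x0.
  apply: contrapT => nf.
  have fx0 (h : R) : f (expR h) = 0.
    apply/eqP; rewrite eq_le f0 andbT leNgt; apply/negP => fh.
    by apply: nf; exists (expR h) => //; exact: expR_gt0.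
  have CS h : cos (th (expR h)) = C /\ sin (th (expR h)) = S.
    have /eqP := fx0 h; rewrite paddr_eq0 ?sqr_ge0// !sqrf_eq0 !subr_eq0.
    by move=> /andP[/eqP -> /eqP ->].
  pose ph h := u * (expR (q * h) - m) + v * (1 - expR (p * h)).
  have thE h : th (expR h) = ph h.
    by rewrite /th /ph ger0_norm ?expR_ge0// /powR gt_eqF ?expR_gt0// expRK.
  pose ph' h := u * (q * expR (q * h)) - v * (p * expR (p * h)).
  have dexp k (h : R) : is_derive h (1 : R) (fun h => expR (k * h)) (k * expR (k * h)).
    have hk : is_derive h 1 (fun h : R => k * h) k.
      have := is_derive_funM (is_derive_cst k h 1) (is_derive_id h 1).
      by move=> hh; apply: (is_derive_eq hh); rewrite mul0r add0r mulr1.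
    have := @is_derive_fun_comp _ expR (fun h => k * h) h _ _ (is_derive_expR _) hk.
    by move=> hh; apply: (is_derive_eq hh); rewrite mulrC.
  have dph (h : R) : is_derive h (1 : R) ph (ph' h).
    have d1 := is_derive_funM (is_derive_cst u h 1)
      (is_derive_funB (dexp q h) (is_derive_cst m h 1)).
    have d2 := is_derive_funM (is_derive_cst v h 1)
      (is_derive_funB (is_derive_cst (1:R) h 1) (dexp p h)).
    have := is_derive_funD d1 d2.
    by move=> hh; apply: (is_derive_eq hh); rewrite /ph' /cst /=; ring.
  have ph0 h : ph' h = 0.
    have dc := @is_derive_fun_comp _ cos ph h _ _ (is_derive_cos _) (dph h).
    have ds := @is_derive_fun_comp _ sin ph h _ _ (is_derive_sin _) (dph h).
    have ec : (fun y => cos (ph y)) = cst C.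
      by apply/funext => y; rewrite -thE (CS y).1.
    have es : (fun y => sin (ph y)) = cst S.
      by apply/funext => y; rewrite -thE (CS y).2.
    rewrite ec in dc; rewrite es in ds.
    have e1 := @derive_val _ _ _ _ _ _ _ dc; have e2 := @derive_val _ _ _ _ _ _ _ ds.
    rewrite derive_cst in e1; rewrite derive_cst in e2.
    have := cos2Dsin2 (ph h) => cs.
    transitivity (cos (ph h) * (cos (ph h) * ph' h) - sin (ph h) * (- sin (ph h) * ph' h)).
      transitivity ((cos (ph h) ^+ 2 + sin (ph h) ^+ 2) * ph' h); last by ring.
      by rewrite cs mul1r.
    by rewrite -e1 -e2 !mulr0 subrr.
  (* Two points give [u q = v p] and [u q exp q = v p exp p], so [u = v = 0] since [q < p]. *)
  have e0 := ph0 0; have e1 := ph0 1.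
  rewrite /ph' !mulr0 expR0 !mulr1 in e0.
  rewrite /ph' !mulr1 in e1.
  have qep : expR q < expR p by rewrite ltr_expR.
  have v0 : v = 0.
    have : v * p * (expR q - expR p) = 0.
      have uq : u * q = v * p by lra.
      by rewrite mulrBr -{1}uq; lra.
    move=> /eqP; rewrite !mulf_eq0 (gt_eqF p0) orbF subr_eq0 (lt_eqF qep) orbF.
    by move=> /eqP.
  have u0 : u = 0.
    move: e0; rewrite v0 mul0r subr0 => /eqP; rewrite mulf_eq0 (gt_eqF q0) orbF.
    by move=> /eqP.
  by move: uv0; rewrite u0 v0 eqxx.
apply: (@Rintegral_gt0 _ _ x0).
- by move=> x; rewrite mulr_ge0// ltW// wt_gt0.
- exact: integrable_polyM.
- apply: continuousM; last exact: continuous_wt.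
  have cth : {for x0, continuous th}.
    by apply: continuousD; apply: continuousM; try exact: cst_continuous;
      apply: continuousB; try exact: cst_continuous; exact: continuous_powR_norm.
  rewrite (_ : f = fun x => (cos (th x) - C) * (cos (th x) - C) +
    (sin (th x) - S) * (sin (th x) - S)); last by apply/funext => x; rewrite /f !expr2.
  apply: continuousD.
    by apply: continuousM; apply: continuousB; try exact: cst_continuous;
      apply: continuous_comp => //; exact: continuous_cos.
  by apply: continuousM; apply: continuousB; try exact: cst_continuous;
    apply: continuous_comp => //; exact: continuous_sin.
- by rewrite mulr_gt0// wt_gt0.
Qed.

End gibbs.

(** * Gradient, Hessian and conjugate of [Lambda_p] *)

Section line_derivative.
Context {R : realType}.

Lemma derive_line (V : normedModType R) (F : V -> R) (a v : V) (l : R) :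
  is_derive (0 : R) (1 : R) (fun h => F (h *: v + a)) l -> 'D_v F a = l.
Proof.
move=> dF; have := @derive_val _ _ _ _ _ _ _ dF; rewrite /derive.
set f := (fun h => _); set g := (fun h : R => _ *: (F (h *: v + a) - F a)).
suff -> : f = g by [].
by apply/funext => h; rewrite /f /g /= scale0r add0r addr0 [h *: 1]mulr1.
Qed.

Lemma det22 (M : 'M[R]_2) : \det M =
  M ord0 ord0 * M (lift ord0 ord0) (lift ord0 ord0) -
  M ord0 (lift ord0 ord0) * M (lift ord0 ord0) ord0.
Proof.
rewrite (expand_det_row _ ord0) !big_ord_recl big_ord0 addr0.
rewrite /cofactor !det_mx11 !mxE /= expr0 mul1r expr1 mulN1r mulrN.
congr (_ * M _ _ - _ * M _ _); exact/val_inj.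
Qed.

Lemma invmx22 (M : 'M[R]_2) : \det M != 0 ->
  [/\ invmx M ord0 ord0 = M (lift ord0 ord0) (lift ord0 ord0) / \det M,
      invmx M ord0 (lift ord0 ord0) = - M ord0 (lift ord0 ord0) / \det M &
      invmx M (lift ord0 ord0) (lift ord0 ord0) = M ord0 ord0 / \det M].
Proof.
move=> d0; have uM : M \in unitmx by rewrite unitmxE unitfE.
rewrite /invmx uM !mxE /cofactor !det_mx11 !mxE /= !expr0 !mul1r expr1.
have l0 : lift (lift ord0 ord0 : 'I_2) (0 : 'I_1) = ord0 by exact/val_inj.
have l1 : lift (ord0 : 'I_2) (0 : 'I_1) = lift ord0 ord0 by exact/val_inj.
rewrite !l0 !l1 mulN1r (_ : (bump 0 0 + bump 0 0)%N = 2)// sqrrN expr1n mul1r.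
by split; rewrite mulrC.
Qed.

End line_derivative.

Section legendre.
Context {R : realType} (p q : R).
Hypotheses (q1 : 1 <= q) (qp : q < p).
Local Notation mu := (@lebesgue_measure R).
Local Notation PB := (poly_bounded p q).
Local Notation wt := (wt p q).
Local Notation moment := (moment p q).
Local Notation Z := (partition p q).
Local Notation A := (fun x : R => `|x| `^ q).
Local Notation B := (fun x : R => `|x| `^ p).
Local Notation i0 := (ord0 : 'I_2).
Local Notation i1 := (lift ord0 ord0 : 'I_2).

Let q0 : 0 < q. Proof. exact: lt_le_trans q1. Qed.
Let p0 : 0 < p. Proof. exact: lt_trans qp. Qed.
Let pinv : 0 < p^-1. Proof. by rewrite invr_gt0. Qed.

(** The reference density is the Gibbs density at [(t, s) = (0, 1/p)]. From here on the Gamma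
    constant appears only as a partition function. *)
Lemma f_pE (x : R) : f_p p x = wt 0 p^-1 x / Z 0 p^-1.
Proof.
rewrite /f_p mulrC; congr (_ / _).
  by rewrite /wt mul0r add0r (mulrC p^-1).
apply: EFin_inj; rewrite -integral_expR_powR//; last exact: le_lt_trans qp.
rewrite /partition momentE -EFin_Rintegral//; last first.
  by apply: integrable_polyM => //; exact: poly_bounded_cst.
by apply: eq_integral => y _; rewrite mul1r /wt mul0r add0r (mulrC p^-1).
Qed.

Lemma M_pE : M_p p q = moment A 0 p^-1 / Z 0 p^-1.
Proof.
rewrite /M_p momentE -RintegralZr//; last exact: integrable_polyM (poly_boundedq _ _).
by apply: eq_Rintegral => x _; rewrite f_pE mulrA.
Qed.

Let wtM (u v x : R) : expR (u * A x + v * B x) * f_p p x = wt u (p^-1 - v) x / Z 0 p^-1.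
Proof. by rewrite f_pE mulrA /wt -expRD; congr (expR _ / _); ring. Qed.

Lemma Lambda_pE (tau : 'rV[R]_2) : D_p p tau ->
  Lambda_p p q tau = (ln (Z (c1 tau) (p^-1 - c2 tau) / Z 0 p^-1))%:E.
Proof.
rewrite /D_p /= -subr_gt0 => s0.
rewrite /Lambda_p; under eq_integral do rewrite wtM.
rewrite EFin_Rintegral//; last by apply: integrableRZr; exact: integrable_wt.
rewrite /= RintegralZr//; last exact: integrable_wt.
by congr (ln (_ / _))%:E; rewrite /partition momentE; apply: eq_Rintegral => x _; rewrite mul1r.
Qed.

Definition coord (i : 'I_2) : R -> R := if i == i0 then A else B.

Lemma poly_bounded_coord i : PB (coord i).
Proof. by rewrite /coord; case: ifP => _; [exact: poly_boundedq|exact: poly_boundedp]. Qed.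

Lemma is_derive_moment_line G i (tau : 'rV[R]_2) : PB G -> D_p p tau ->
  is_derive (0 : R) (1 : R) (fun h => moment G (c1 (h *: delta_mx ord0 i + tau))
      (p^-1 - c2 (h *: delta_mx ord0 i + tau)))
    (moment (fun x => G x * coord i x) (c1 tau) (p^-1 - c2 tau)).
Proof.
rewrite /D_p /= -subr_gt0 => bG s0.
(* Selectors of the coordinate that moves. The second enters with a minus sign because
   [s = 1/p - tau_2]. *)
pose u : R := (i == i0)%:R; pose v : R := (i == i1)%:R.
pose a h := u * h + c1 tau; pose b h := (p^-1 - c2 tau) - v * h.
have E : (fun h => moment G (c1 (h *: delta_mx ord0 i + tau))
      (p^-1 - c2 (h *: delta_mx ord0 i + tau))) = (fun h => moment G (a h) (b h)).
  apply/funext => h.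
  have -> : c1 (h *: delta_mx ord0 i + tau) = a h.
    by rewrite /c1 mxE mxE mxE eqxx /= mulrC (eq_sym i0).
  have -> : p^-1 - c2 (h *: delta_mx ord0 i + tau) = b h.
    by rewrite /b /c2 mxE mxE mxE eqxx /= (eq_sym i1) -/v -/(c2 tau) mulrC opprD addrA addrAC.
  by [].
rewrite E.
have u01 : 0 <= u <= 1 by rewrite /u; case: (_ == _); rewrite ?lexx ?ler01.
have v01 : 0 <= v <= 1 by rewrite /v; case: (_ == _); rewrite ?lexx ?ler01.
have e0 : 0 < (p^-1 - c2 tau) / 2 by rewrite divr_gt0.
have H (h : R) : - ((p^-1 - c2 tau) / 2) < h < (p^-1 - c2 tau) / 2 ->
   [/\ is_derive h 1 a (cst u h), is_derive h 1 b (cst (- v) h),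
     a h <= (p^-1 - c2 tau) / 2 + c1 tau, (p^-1 - c2 tau) / 2 <= b h &
     `|cst u h| <= 1 /\ `|cst (- v) h| <= 1].
  move=> /andP[h1 h2]; split.
  - have := is_derive_funD (is_derive_funM (is_derive_cst u h 1) (is_derive_id h 1))
      (is_derive_cst (c1 tau) h 1).
    by move=> hh; apply: (is_derive_eq hh); rewrite mul0r add0r mulr1 addr0.
  - have := is_derive_funB (is_derive_cst (p^-1 - c2 tau) h 1)
      (is_derive_funM (is_derive_cst v h 1) (is_derive_id h 1)).
    by move=> hh; apply: (is_derive_eq hh); rewrite mul0r !add0r mulr1.
  - rewrite /a lerD2r; case/andP: u01 => u0 u1.
    apply: (@le_trans _ _ (u * ((p^-1 - c2 tau) / 2))); first by rewrite ler_wpM2l// ltW.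
    by rewrite ler_piMl// ltW.
  - have vh : v * h <= (p^-1 - c2 tau) / 2.
      case/andP: v01 => v0 v1.
      apply: (@le_trans _ _ (v * ((p^-1 - c2 tau) / 2))); first by rewrite ler_wpM2l// ltW.
      by rewrite ler_piMl// ltW.
    by rewrite /b; lra.
  - by rewrite /= normrN !ger0_norm; case/andP: u01; case/andP: v01.
have D := is_derive_moment q1 qp bG e0 e0 H.
apply: (is_derive_eq D).
have -> : a 0 = c1 tau by rewrite /a mulr0 add0r.
have -> : b 0 = p^-1 - c2 tau by rewrite /b mulr0 subr0.
rewrite /coord /= /u /v; have [->|] := eqVneq i i0.
  by rewrite mul1r /= oppr0 mul0r subr0.
case: (unliftP i0 i) => [j ->|->]; last by rewrite eqxx.
by rewrite (ord1 j) eqxx mul0r mulN1r opprK add0r.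
Qed.

(** The partition formula for [LamR] holds on [D_p] only; since this set is open along coordinate
    lines, derivatives may be taken from the formula. *)
Lemma near_D_p i (tau : 'rV[R]_2) : D_p p tau ->
  \forall h \near (0 : R), D_p p (h *: delta_mx ord0 i + tau).
Proof.
rewrite /D_p /= => s0.
have e0 : 0 < p^-1 - c2 tau by rewrite subr_gt0.
exists (p^-1 - c2 tau) => //= h /=; rewrite sub0r normrN => hs.
rewrite /c2 mxE mxE -/(c2 tau) -ltrBrDr.
apply: le_lt_trans hs; apply: (le_trans (ler_norm _)); rewrite normrM.
rewrite mxE /=; case: (_ == _); rewrite ?normr1 ?normr0 ?mulr1 ?mulr0//.
Qed.

Definition meanD (i : 'I_2) (tau : 'rV[R]_2) : R :=
  moment (coord i) (c1 tau) (p^-1 - c2 tau) / Z (c1 tau) (p^-1 - c2 tau).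

Lemma partial_LamR i (tau : 'rV[R]_2) : D_p p tau ->
  partial i (LamR p q) tau = meanD i tau.
Proof.
move=> tD; apply: derive_line.
have s0 : 0 < p^-1 - c2 tau by rewrite subr_gt0.
have Z0 : 0 < Z (c1 tau) (p^-1 - c2 tau) by exact: partition_gt0.
pose F h := ln (Z (c1 (h *: delta_mx ord0 i + tau)) (p^-1 - c2 (h *: delta_mx ord0 i + tau)))
   - ln (Z 0 p^-1).
apply: (@near_eq_is_derive _ _ _ F).
  near=> h.
  have hD : D_p p (h *: delta_mx ord0 i + tau) by near: h; exact: near_D_p.
  rewrite /LamR Lambda_pE//= ln_div ?posrE ?partition_gt0//.
  by rewrite subr_gt0.
have dZ := is_derive_moment_line i (poly_bounded_cst p q 1) tD.
have Z0' : 0 < Z (c1 (0 *: delta_mx ord0 i + tau)) (p^-1 - c2 (0 *: delta_mx ord0 i + tau)).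
  by rewrite scale0r add0r.
have dl := @is_derive_fun_comp _ (@ln R) (fun h => moment (fun=> 1)
  (c1 (h *: delta_mx ord0 i + tau)) (p^-1 - c2 (h *: delta_mx ord0 i + tau)))
  0 _ _ (is_derive1_ln Z0') dZ.
have := is_derive_funB dl (is_derive_cst (ln (Z 0 p^-1)) (0:R) (1:R)).
move=> hh; apply: (is_derive_eq hh); rewrite subr0 scale0r add0r /meanD mulrC.
by congr (_ / _); apply: eq_moment => x; rewrite mul1r.
Unshelve. all: by end_near. Qed.

Lemma hessianE i j (tau : 'rV[R]_2) : D_p p tau ->
  hessian (LamR p q) tau i j =
  moment (fun x => coord j x * coord i x) (c1 tau) (p^-1 - c2 tau) /
     Z (c1 tau) (p^-1 - c2 tau) - meanD i tau * meanD j tau.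
Proof.
move=> tD; rewrite mxE; apply: derive_line.
apply: (@near_eq_is_derive R R R (fun h : R => meanD j (h *: delta_mx ord0 i + tau))).
  near=> h.
  have hD : D_p p (h *: delta_mx ord0 i + tau) by near: h; exact: near_D_p.
  by rewrite partial_LamR.
have s0 : 0 < p^-1 - c2 tau by rewrite subr_gt0.
have Z0 : 0 < Z (c1 tau) (p^-1 - c2 tau) by exact: partition_gt0.
have dM := is_derive_moment_line i (poly_bounded_coord j) tD.
have dZ := is_derive_moment_line i (poly_bounded_cst p q 1) tD.
have Z0' : moment (fun=> 1) (c1 (0 *: delta_mx ord0 i + tau)) (p^-1 - c2 (0 *: delta_mx ord0 i + tau)) != 0.
  by rewrite scale0r add0r gt_eqF.
have := is_derive_funM dM (@is_derive_funV _ (fun h => moment (fun=> 1)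
  (c1 (h *: delta_mx ord0 i + tau)) (p^-1 - c2 (h *: delta_mx ord0 i + tau))) 0 _ Z0' dZ).
move=> hh; apply: (is_derive_eq hh); rewrite scale0r add0r.
have -> : moment (fun x => 1 * coord i x) (c1 tau) (p^-1 - c2 tau) =
    moment (coord i) (c1 tau) (p^-1 - c2 tau).
  by apply: eq_moment => x; rewrite mul1r.
rewrite /meanD -/(Z (c1 tau) (p^-1 - c2 tau)).
set z := Z _ _ in Z0 *.
by field; rewrite gt_eqF.
Unshelve. all: by end_near. Qed.

Section at_tau.
Variable tau : 'rV[R]_2.
Hypothesis tD : D_p p tau.
Let t := c1 tau.
Let s := p^-1 - c2 tau.
Local Notation EG G := (moment G t s / Z t s).
Let s0 : 0 < s. Proof. by rewrite subr_gt0. Qed.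
Let Z0 : 0 < Z t s. Proof. exact: partition_gt0. Qed.

Lemma homogeneous_mean G r : PB G -> (forall x, 0 <= G x) ->
  (forall h x, G (expR h * x) = expR (r * h) * G x) ->
  (1 + r) * EG G + q * t * EG (fun x => G x * A x) - p * s * EG (fun x => G x * B x) = 0.
Proof.
move=> bG G0 Gh; have := moment_homogeneous q1 qp t s0 bG G0 Gh.
move/(congr1 (fun x => x / Z t s)); rewrite mul0r => <-.
by rewrite !mulrDl !mulrA mulNr.
Qed.

Let powR_expRM r (h x : R) : `|expR h * x| `^ r = expR (r * h) * `|x| `^ r.
Proof.
rewrite normrM ger0_norm ?expR_ge0// powRM ?expR_ge0//; congr (_ * _).
by rewrite /powR gt_eqF ?expR_gt0// expRK.
Qed.

Lemma homogeneous_mean1 : 1 + q * t * EG A - p * s * EG B = 0.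
Proof.
have := @homogeneous_mean (fun=> 1) 0 (poly_bounded_cst p q 1) (fun=> ler01).
rewrite addr0 mul1r (_ : moment (fun=> 1) t s = Z t s)// divff ?gt_eqF//.
have -> : moment (fun x => 1 * A x) t s = moment A t s.
  by apply: eq_moment => x; rewrite mul1r.
have -> : moment (fun x => 1 * B x) t s = moment B t s.
  by apply: eq_moment => x; rewrite mul1r.
by apply => h x; rewrite mul0r expR0 mulr1.
Qed.

Lemma homogeneous_meanq :
  (1 + q) * EG A + q * t * EG (fun x => A x * A x) - p * s * EG (fun x => A x * B x) = 0.
Proof.
by apply: homogeneous_mean => [|x|h x]; [exact: poly_boundedq|exact: powR_ge0|exact: powR_expRM].
Qed.

Lemma homogeneous_meanp :
  (1 + p) * EG B + q * t * EG (fun x => B x * A x) - p * s * EG (fun x => B x * B x) = 0.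
Proof.
by apply: homogeneous_mean => [|x|h x]; [exact: poly_boundedp|exact: powR_ge0|exact: powR_expRM].
Qed.

(* Jensen's inequality in tangent form, from [expR x >= expR u * (1 + x - u)]. *)
Lemma Lambda_p_tangent (sig : 'rV[R]_2) :
  (((c1 sig - t) * EG A + (c2 sig - c2 tau) * EG B + ln (Z t s / Z 0 p^-1))%:E
   <= Lambda_p p q sig)%E.
Proof.
set u := (c1 sig - t) * EG A + (c2 sig - c2 tau) * EG B.
have N0 : 0 < Z 0 p^-1 by exact: partition_gt0.
have Zn0 : Z t s != 0 by exact: lt0r_neq0.
rewrite /Lambda_p.
pose F y := expR (c1 sig * A y + c2 sig * B y) * f_p p y.
rewrite -/(F _) -[X in if X == _ then _ else _]/(\int[mu]_y (F y)%:E)%E.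
have mF : measurable_fun setT F.
  rewrite (_ : F = fun y => wt (c1 sig) (p^-1 - c2 sig) y / Z 0 p^-1); last first.
    by apply/funext => y; rewrite /F wtM.
  by apply: measurable_funM => //; exact: measurable_wt.
have F0 y : 0 <= F y.
  by rewrite /F wtM; apply: divr_ge0; apply: ltW; [exact: wt_gt0|exact: N0].
case: ifPn => [_|Fin]; first by rewrite leey.
have iF : mu.-integrable setT (EFin \o F).
  apply/integrableP; split; first exact/measurable_EFinP.
  under eq_integral do rewrite /= ger0_norm//.
  by rewrite lt_neqAle Fin leey.
rewrite [X in ln (fine X)](_ : _ = (\int[mu]_y F y)%R%:E); last exact: EFin_Rintegral.
rewrite /= lee_fin -(expRK u).
pose g y := (1 - u + ((c1 sig - t) * A y + (c2 sig - c2 tau) * B y)).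
have bc c : PB (fun=> c) by exact: poly_bounded_cst.
have b1 c : PB (fun x => c * A x) by apply: poly_boundedM; [exact: bc|exact: poly_boundedq].
have b2 c : PB (fun x => c * B x) by apply: poly_boundedM; [exact: bc|exact: poly_boundedp].
have b12 : PB (fun y => (c1 sig - t) * A y + (c2 sig - c2 tau) * B y).
  exact: poly_boundedD.
have bg : PB g by exact: poly_boundedD.
(* [u] is the Gibbs mean of the linear form, so the first-order term of the tangent averages to
   zero. *)
have Eg : moment g t s = Z t s.
  have eA : moment (fun y => (c1 sig - t) * A y) t s = (c1 sig - t) * moment A t s.
    by apply: momentZ => //; exact: poly_boundedq.
  have eB : moment (fun y => (c2 sig - c2 tau) * B y) t s =
      (c2 sig - c2 tau) * moment B t s.
    by apply: momentZ => //; exact: poly_boundedp.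
  have e1 : moment (fun=> 1 - u) t s = (1 - u) * Z t s.
    rewrite -[RHS](@momentZ _ _ _ q1 qp)//.
    by apply: eq_moment => x; rewrite mulr1.
  have -> : moment g t s = (1 - u) * Z t s +
      ((c1 sig - t) * moment A t s + (c2 sig - c2 tau) * moment B t s).
    rewrite -e1 -eA -eB -(momentD q1 qp t s0 (b1 _) (b2 _)).
    exact: (momentD q1 qp t s0 (bc _) b12).
  have uE : u * Z t s = (c1 sig - t) * moment A t s + (c2 sig - c2 tau) * moment B t s.
    by rewrite /u; field.
  by rewrite -uE; ring.
have key : expR u * (Z t s / Z 0 p^-1) <= (\int[mu]_y F y)%R.
  rewrite -{1}Eg momentE mulrA -RintegralZl//; last exact: integrable_polyM.
  rewrite -RintegralZr//; last by apply: integrableRZl; exact: integrable_polyM.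
  apply: le_Rintegral => //.
    by apply: integrableRZr; apply: integrableRZl; exact: integrable_polyM.
  move=> y _; rewrite /F wtM ler_wpM2r ?invr_ge0 ?(ltW N0)//.
  have -> : wt (c1 sig) (p^-1 - c2 sig) y =
     expR u * (expR ((c1 sig - t) * A y + (c2 sig - c2 tau) * B y - u) * wt t s y).
    by rewrite /wt -!expRD; congr expR; rewrite /s; ring.
  rewrite ler_wpM2l ?expR_ge0// ler_wpM2r ?(ltW (wt_gt0 _ _ _ _ _))//.
  apply: le_trans (expR_ge1Dx _); rewrite /g; lra.
have ZN : 0 < Z t s / Z 0 p^-1 by exact: divr_gt0.
have eZ : 0 < expR u * (Z t s / Z 0 p^-1) by exact: mulr_gt0 (expR_gt0 u) ZN.
have pE : expR u \is Num.pos by rewrite posrE expR_gt0.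
have pZ : Z t s / Z 0 p^-1 \is Num.pos by rewrite posrE.
rewrite -(lnM pE pZ) ler_ln ?posrE//.
exact: lt_le_trans eZ key.
Qed.

End at_tau.

Section saddle.
Variables (z : R) (tau : 'rV[R]_2).
Hypothesis tD : D_p p tau.
Hypothesis tz : grad (LamR p q) tau = zstar q z.
Let t := c1 tau.
Let s := p^-1 - c2 tau.
Local Notation EG G := (moment G t s / Z t s).
Let s0 : 0 < s. Proof. by rewrite subr_gt0. Qed.
Let Z0 : 0 < Z t s. Proof. exact: partition_gt0. Qed.
Local Notation zq := (z `^ q).

Lemma saddle_mean : EG A = zq /\ EG B = 1.
Proof.
have h i : meanD i tau = zstar q z ord0 i by rewrite -tz mxE partial_LamR.
have := h i0; have := h i1; rewrite !mxE /= /meanD -/t -/s /coord /=.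
by move=> -> ->.
Qed.

Lemma saddle_scaling : 1 + q * t * zq - p * s = 0.
Proof.
by have := homogeneous_mean1 tD; have [-> ->] := saddle_mean; rewrite mulr1.
Qed.

(** Since the Gibbs means at [tau] are [(z^q, 1)], the tangent inequality bounds every competitor by
    the value at [tau], where the supremum is attained. *)
Lemma LambdaStarE : LambdaStar p q (zstar q z) =
  (zq * t + c2 tau - ln (Z t s / Z 0 p^-1))%:E.
Proof.
have z1 : c1 (zstar q z) = zq by rewrite /c1 mxE.
have z2 : c2 (zstar q z) = 1 by rewrite /c2 mxE.
apply/eqP; rewrite eq_le; apply/andP; split.
  apply: ge_ereal_sup => _ [sig _ <-].
  have := Lambda_p_tangent tD sig; have [-> ->] := saddle_mean.
  rewrite z1 z2 !mulr1 mul1r -/t -/s.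
  case: (Lambda_p p q sig) => [r| |]; rewrite ?lee_fin//=.
    by move=> h; lra.
  by move=> _; rewrite addeNy leNye.
apply: ereal_sup_ubound; exists tau => //.
by rewrite Lambda_pE// z1 z2 mul1r -EFinB.
Qed.

(** Monotonicity of the gradient. The tangent inequalities at [tau] and at 0, each evaluated at the
    other point, add up to [t (z^q - M_p) >= 0]; the second coordinates cancel because [|x|^p] has
    mean 1 in both cases. If [t = 0], the scaling relation gives [s = 1/p], hence [z^q = M_p], which
    is excluded. *)
Lemma tilt_gt0 : m_pq p q < z -> 0 < t.
Proof.
move=> mz.
have m0 : 0 <= M_p p q.
  by rewrite M_pE divr_ge0 ?(ltW (partition_gt0 q1 qp _ _))// moment_ge0// => x; exact: powR_ge0.
have Mz : M_p p q < zq.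
  have -> : M_p p q = m_pq p q `^ q by rewrite /m_pq -powRrM mulVf ?gt_eqF// powRr1.
  have m0' : 0 <= m_pq p q by exact: powR_ge0.
  by apply: gt0_ltr_powR; rewrite ?nnegrE// ltW// (le_lt_trans m0').
have [eA eB] := saddle_mean.
pose o : 'rV[R]_2 := 0.
have o1 : c1 o = 0 by rewrite /c1 mxE.
have o2 : c2 o = 0 by rewrite /c2 mxE.
have oD : D_p p o by rewrite /D_p /= o2.
have eB0 : moment B 0 p^-1 / Z 0 p^-1 = 1.
  have := homogeneous_mean1 oD; rewrite o1 o2 subr0 mulr0 mul0r addr0.
  by rewrite mulfV ?gt_eqF// mul1r => /eqP; rewrite subr_eq0 => /eqP.
have h1 := Lambda_p_tangent tD o.
have h2 := Lambda_p_tangent oD tau.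
rewrite o1 o2 !subr0 -M_pE eB0 (Lambda_pE tD) lee_fin -/t -/s in h2.
rewrite (Lambda_pE oD) o1 o2 subr0 -/t -/s eA eB lee_fin in h1.
have N0 : 0 < Z 0 p^-1 by exact: partition_gt0.
rewrite divff ?gt_eqF// ln1 in h1 h2.
have tz0 : 0 <= t * (zq - M_p p q) by rewrite mulrBr; lra.
rewrite lt_neqAle; apply/andP; split; last first.
  by move: tz0; rewrite pmulr_lge0// subr_gt0.
apply/negP => /eqP t0.
have := saddle_scaling; rewrite -t0 mulr0 mul0r addr0 => /eqP; rewrite subr_eq0 => /eqP ps.
have sE : s = p^-1 by rewrite -[LHS](mulKf (lt0r_neq0 p0)) -ps mulr1.
have : M_p p q = zq by rewrite M_pE -eA -t0 sE.
by move: Mz => /[swap] ->; rewrite ltxx.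
Qed.

Hypothesis s_gt0 : 0 < s.
Local Notation P := (gibbs q1 qp t s_gt0).
Local Notation X1 := (fun x : R => A x - zq).
Local Notation X2 := (fun x : R => 1 - B x).
Local Notation H := (hessian (LamR p q) tau).

Lemma poly_boundedX1 : PB X1.
Proof. by apply: poly_boundedD; [exact: poly_boundedq|exact: poly_bounded_cst]. Qed.

Lemma poly_boundedX2 : PB X2.
Proof.
apply: poly_boundedD; first exact: poly_bounded_cst.
have := poly_boundedM (poly_bounded_cst p q (-1)) (poly_boundedp p q).
by rewrite (_ : (fun x => -1 * _) = (fun x : R => - B x))//; apply/funext => x; rewrite mulN1r.
Qed.

Lemma integrable_saddle3 : P.-integrable setT (EFin \o (fun y => (`|X1 y| + `|X2 y|) ^+ 3)).
Proof.
apply: integrable_gibbs.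
have b : PB (fun y => `|X1 y| + `|X2 y|).
  have ab G : PB G -> PB (fun y => `|G y|).
    move=> [mG [k [c hG]]]; split; first exact: measurableT_comp.
    by exists k, c => x; rewrite normr_id.
  by apply: poly_boundedD; apply: ab; [exact: poly_boundedX1|exact: poly_boundedX2].
have := poly_boundedM (poly_boundedM b b) b.
by rewrite (_ : (fun x => _ * _ * _) = (fun y => (`|X1 y| + `|X2 y|) ^+ 3))//;
  apply/funext => y; rewrite exprSr expr2.
Qed.

Let EP G : PB G -> (\int[P]_x G x)%R = EG G.
Proof. exact: Rintegral_gibbs. Qed.

Let iP G : PB G -> P.-integrable setT (EFin \o G).
Proof. exact: integrable_gibbs. Qed.

Let bA : PB A. Proof. exact: poly_boundedq. Qed.
Let bB : PB B. Proof. exact: poly_boundedp. Qed.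
Let bC c : PB (fun=> c). Proof. exact: poly_bounded_cst. Qed.
Let bAA : PB (fun x => A x * A x). Proof. exact: poly_boundedM. Qed.
Let bAB : PB (fun x => A x * B x). Proof. exact: poly_boundedM. Qed.
Let bBB : PB (fun x => B x * B x). Proof. exact: poly_boundedM. Qed.

Let EA : (\int[P]_x A x)%R = zq.
Proof. by rewrite EP//; have [->] := saddle_mean. Qed.

Let EB : (\int[P]_x B x)%R = 1.
Proof. by rewrite EP//; have [_ ->] := saddle_mean. Qed.

Let E1 c : (\int[P]_x c)%R = c.
Proof. by rewrite Rintegral_cst//= probability_setT mulr1. Qed.

Let iC (c : R) : P.-integrable setT (EFin \o (fun=> c)). Proof. exact: iP. Qed.

Lemma saddle_centered : (\int[P]_x X1 x)%R = 0 /\ (\int[P]_x X2 x)%R = 0.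
Proof.
rewrite (RintegralB measurableT (iP bA) (iC _)) (RintegralB measurableT (iC _) (iP bB)).
by rewrite EA EB !E1 !subrr.
Qed.

Let HE : [/\ H i0 i0 = EG (fun x => A x * A x) - zq ^+ 2,
   H i0 i1 = EG (fun x => A x * B x) - zq, H i1 i0 = EG (fun x => A x * B x) - zq &
   H i1 i1 = EG (fun x => B x * B x) - 1].
Proof.
have [eA eB] := saddle_mean.
rewrite !hessianE// /meanD /coord /= -/t -/s eA eB !mulr1 mul1r -expr2; split=> //.
by congr (_ / _ - _); apply: eq_moment => x; rewrite mulrC.
Qed.

Let cov (c1 c2 c3 c4 : R) (G K : R -> R) : PB G -> PB K ->
  (\int[P]_x ((c1 * G x + c2) * (c3 * K x + c4)))%R =
  c1 * c3 * EG (fun x => G x * K x) + c1 * c4 * EG G + c2 * c3 * EG K + c2 * c4.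
Proof.
move=> bG bK; have bGK : PB (fun x => G x * K x) by exact: poly_boundedM.
rewrite -!EP//.
have i1 := integrableRZl (c1 * c3) (iP bGK).
have i2 := integrableRZl (c1 * c4) (iP bG).
have i3 := integrableRZl (c2 * c3) (iP bK).
have i12 := integrableRD i1 i2; have i123 := integrableRD i12 i3.
transitivity (\int[P]_x (c1 * c3 * (G x * K x) + c1 * c4 * G x + c2 * c3 * K x + c2 * c4))%R.
  by apply: eq_Rintegral => x _; ring.
rewrite (RintegralD measurableT i123 (iC _)) (RintegralD measurableT i12 i3).
by rewrite (RintegralD measurableT i1 i2) E1 !RintegralZl//; exact: iP.
Qed.

Lemma saddle_covariance : [/\ (\int[P]_x X1 x ^+ 2)%R = H i0 i0,
  (\int[P]_x (X1 x * X2 x))%R = - H i0 i1 & (\int[P]_x X2 x ^+ 2)%R = H i1 i1].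
Proof.
have [h00 h01 _ h11] := HE; have [eA eB] := saddle_mean.
rewrite h00 h01 h11; split.
- transitivity (\int[P]_x ((1 * A x + - zq) * (1 * A x + - zq)))%R.
    by apply: eq_Rintegral => x _; rewrite mul1r expr2.
  by rewrite cov// eA; ring.
- transitivity (\int[P]_x ((1 * A x + - zq) * (-1 * B x + 1)))%R.
    by apply: eq_Rintegral => x _; rewrite mul1r; congr (_ * _); ring.
  by rewrite cov// eA eB; ring.
- transitivity (\int[P]_x ((-1 * B x + 1) * (-1 * B x + 1)))%R.
    by apply: eq_Rintegral => x _; rewrite expr2; congr (_ * _); ring.
  by rewrite cov// eB; ring.
Qed.

Lemma det_hessianE : \det H = H i0 i0 * H i1 i1 - H i0 i1 ^+ 2.
Proof. by have [_ h01 h10 _] := HE; rewrite det22 h10 -h01 expr2. Qed.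

(** The relations [l1] and [l2] give the inverse Hessian at [(q z^q, p)] as [(- q t, p s)]. The
    quadratic form in the bracket and its correction term then sum to
    [(p s - q t z^q) / p = 1/p]. *)
Lemma gamma_zE : 0 < \det H -> 0 < t ->
  gamma_z p q z tau = t * s * Num.sqrt (p * \det H).
Proof.
move=> D0 t0.
have [h00 h01 h10 h11] := HE; have [eA eB] := saddle_mean.
have e0 := saddle_scaling.
have eq1 := homogeneous_meanq tD; have ep := homogeneous_meanp tD.
rewrite -/t -/s eA in eq1; rewrite -/t -/s eB in ep.
have eBA : moment (fun x => B x * A x) t s = moment (fun x => A x * B x) t s.
  by apply: eq_moment => x; rewrite mulrC.
rewrite eBA in ep.
(* The dilation identity for [|x|^q], centered by subtracting [z^q] times the one for the constant
   1; [l2] does the same for [|x|^p]. *)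
have l1 : q * t * H i0 i0 - p * s * H i0 i1 = - (q * zq).
  rewrite h00 h01; set u := EG _ in eq1 *; set v := EG _ in eq1 *.
  transitivity (((1 + q) * zq + q * t * u - p * s * v) -
    zq * (1 + q * t * zq - p * s) - q * zq); first by ring.
  by rewrite eq1 e0; ring.
have l2 : q * t * H i0 i1 - p * s * H i1 i1 = - p.
  rewrite h01 h11; set u := EG _ in ep *; set v := EG _ in ep *.
  transitivity (((1 + p) * 1 + q * t * u - p * s * v) -
    (1 + q * t * zq - p * s) - p); first by ring.
  by rewrite ep e0; ring.
have Dn0 : \det H != 0 by rewrite gt_eqF.
have DE := det_hessianE.
rewrite /gamma_z -/t; have [-> -> ->] := invmx22 Dn0.
have pn0 : p != 0 by rewrite gt_eqF.
have -> : (\det H) * t ^+ 2 * (q * zq * t + 1) ^+ 2 *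
  (zq ^+ 2 * q ^+ 2 / p ^+ 2 * (H i1 i1 / \det H) + 2 * zq * q / p * (- H i0 i1 / \det H) +
   H i0 i0 / \det H + t * (zq * q * (q - p) / p ^+ 2)) = (t * s) ^+ 2 * (p * \det H).
  have ps : q * zq * t + 1 = p * s by lra.
  rewrite ps.
  have br : zq ^+ 2 * q ^+ 2 / p ^+ 2 * (H i1 i1 / \det H) + 2 * zq * q / p * (- H i0 i1 / \det H) +
      H i0 i0 / \det H + t * (zq * q * (q - p) / p ^+ 2) = p^-1.
    (* Cramer's rule for the system formed by [l1] and [l2]. *)
    have k1 : q * zq * H i1 i1 - p * H i0 i1 = - (q * t) * \det H.
      have -> : q * zq = - (q * t * H i0 i0 - p * s * H i0 i1) by rewrite l1 opprK.
      have -> : p * H i0 i1 = - (q * t * H i0 i1 - p * s * H i1 i1) * H i0 i1 by rewrite l2 opprK.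
      by rewrite DE; ring.
    have k2 : p * H i0 i0 - q * zq * H i0 i1 = p * s * \det H.
      have -> : q * zq = - (q * t * H i0 i0 - p * s * H i0 i1) by rewrite l1 opprK.
      have -> : p * H i0 i0 = - (q * t * H i0 i1 - p * s * H i1 i1) * H i0 i0 by rewrite l2 opprK.
      by rewrite DE; ring.
    transitivity ((q * zq * ((q * zq * H i1 i1 - p * H i0 i1) / \det H) +
      p * ((p * H i0 i0 - q * zq * H i0 i1) / \det H) + t * (zq * q * (q - p))) / p ^+ 2).
      by field; rewrite Dn0 pn0.
    rewrite k1 k2 !mulfK//.
    transitivity ((p * s - q * zq * t) / p); first by field; rewrite pn0.
    have -> : p * s - q * zq * t = 1 by lra.
    by rewrite mul1r.
  by rewrite br; field; rewrite pn0.
by rewrite sqrtrM ?sqr_ge0// sqrtr_sqr ger0_norm// mulr_ge0// ltW.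
Qed.

End saddle.

End legendre.

(** * Exponentially weighted quadrants *)

Section half_exponential.
Context {R : realType}.
Local Notation mu := (@lebesgue_measure R).

(* [`[0, +oo[] or [`]0, +oo[], according to whether [b] is true or false. *)
Definition half_line (b : bool) : set R := [set` Interval (BSide b 0) +oo%O].

Lemma mem_half_line b x : (x \in half_line b) = (if b then 0 <= x else 0 < x).
Proof. by rewrite mem_setE in_itv/= andbT; case: b. Qed.

(** What the change of measure leaves of the indicator of a half-line. The norm event is strict and
    uses the open half-line, the ball the closed one. *)
Definition half_exp (b : bool) (k x : R) : R := expR (- (k * x)) * \1_(half_line b) x.

Lemma half_exp_ge0 b k x : 0 <= half_exp b k x.
Proof. by rewrite mulr_ge0// expR_ge0. Qed.

Lemma half_exp_le1 b k x : 0 < k -> half_exp b k x <= 1.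
Proof.
move=> k0; rewrite /half_exp indicE mem_half_line.
have [x0|x0] := leP 0 x.
  by rewrite mulr_ile1 ?expR_ge0//; [rewrite -expR0 ler_expR oppr_le0 mulr_ge0// ltW|case: (if _ then _ else _)].
by rewrite (lt_gtF x0); case: b; rewrite mulr0.
Qed.

Lemma measurable_half_exp b k : measurable_fun setT (half_exp b k).
Proof.
apply: measurable_funM; last by apply: measurable_indic; exact: measurable_itv.
by apply: measurableT_comp => //; apply: measurableT_comp => //; exact: measurable_funM.
Qed.

Lemma integral_half_exp b k : 0 < k -> (\int[mu]_x (half_exp b k x)%:E = (k^-1)%:E)%E.
Proof.
move=> k0; rewrite -integral_expN//.
have mE (D : set R) : measurable_fun D (fun x => (expR (- (k * x)))%:E).
  apply/measurable_EFinP; apply: measurable_funTS.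
  by apply: measurableT_comp => //; apply: measurableT_comp => //; exact: measurable_funM.
have E b' : (\int[mu]_x (half_exp b' k x)%:E =
    \int[mu]_(x in half_line b') (expR (- (k * x)))%:E)%E.
  rewrite [RHS]integral_mkcond; apply: eq_integral => x _.
  by rewrite patchE /half_exp indicE; case: ifP => _; rewrite ?mulr1 ?mulr0.
case: b; first by [].
rewrite E (_ : (\int[mu]_x _)%E = \int[mu]_x (half_exp true k x)%:E)%E// E.
exact: integral_itv_obnd_cbnd.
Qed.

Lemma half_exp_mono b k g x u : 0 < k -> k <= g -> 0 <= u ->
  expR (- (g * u)) * half_exp b k x <= half_exp b k (x + u).
Proof.
move=> k0 kg u0; rewrite /half_exp !indicE !mem_half_line.
have [bx|_] := boolP (if b then 0 <= x else 0 < x); last by rewrite !mulr0 mulr_ge0// expR_ge0.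
have -> : (if b then 0 <= x + u else 0 < x + u) = true.
  by case: b bx => bx; [rewrite addr_ge0|rewrite ltr_wpDr].
rewrite !mulr1 -expRD ler_expR mulrDr.
have : k * u <= g * u by rewrite ler_wpM2r.
lra.
Qed.

End half_exponential.

Section nonlattice_covariance.
Context d (T : measurableType d) (R : realType) (P : probability T R).
Variables (X1 X2 : T -> R).
Hypotheses (mX1 : measurable_fun setT X1) (mX2 : measurable_fun setT X2).
Hypothesis iN3 : P.-integrable setT (EFin \o (fun y => (`|X1 y| + `|X2 y|) ^+ 3)).
Hypothesis EX1 : (\int[P]_y X1 y)%R = 0.
Hypothesis EX2 : (\int[P]_y X2 y)%R = 0.
Let a := (\int[P]_y (X1 y ^+ 2))%R.
Let b := (\int[P]_y (X1 y * X2 y))%R.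
Let c := (\int[P]_y (X2 y ^+ 2))%R.
Local Notation C := (char1C P X1 X2).
Local Notation S := (char1S P X1 X2).
Hypothesis nonlattice : forall u v, (u, v) != (0, 0) -> C u v ^+ 2 + S u v ^+ 2 < 1.

(** A degenerate direction would give [C >= 1] through [cos y >= 1 - y^2 / 2], against [nonlattice].
    So the covariance needs no separate nondegeneracy assumption. *)
Lemma covform_gt0 u v : (u, v) != (0, 0) -> 0 < covform P X1 X2 u v.
Proof.
move=> uv0; rewrite ltNge; apply/negP => Q0.
have := nonlattice uv0; rewrite ltNge => /negP; apply.
suff C1 : 1 <= C u v.
  by rewrite -[leLHS]addr0 lerD ?sqr_ge0// -(expr1n _ 2) lerXn2r ?nnegrE// (le_trans ler01).
have mlin : measurable_fun setT (fun y => u * X1 y + v * X2 y).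
  by apply: measurable_funD; apply: measurable_funM.
have i2 : P.-integrable setT (EFin \o (fun y => (u * X1 y + v * X2 y) ^+ 2)).
  exact: integrable_lin2.
have i1 : P.-integrable setT (EFin \o (fun=> 1 : R)).
  by apply: (@bounded_integrable _ _ _ _ _ 1) => // x; rewrite normr1.
apply: (@le_trans _ _ (1 - covform P X1 X2 u v / 2)); first by lra.
rewrite -(Rintegral_lin2 mX1 mX2 iN3) -RintegralZr//.
rewrite -[X in X - _ <= _](_ : (\int[P]_y 1)%R = 1); last first.
  by rewrite Rintegral_cst//= probability_setT mulr1.
rewrite -RintegralB//; last exact: integrableRZr.
apply: le_Rintegral => //.
- by apply: integrableRB => //; exact: integrableRZr.
- exact: integrable_cos.
move=> y _; have := cos_ge_quad (normr_ge0 (u * X1 y + v * X2 y)).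
by rewrite cos_norm real_normK ?num_real//; lra.
Qed.

Lemma covariance_det_gt0 : 0 < a * c - b ^+ 2.
Proof.
have a0 : 0 < a.
  have : 0 < covform P X1 X2 1 0 by apply: covform_gt0; rewrite xpair_eqE oner_eq0.
  by rewrite /covform -/a; lra.
(* The form at [(- b, a)] is [a] times the determinant. *)
have : 0 < covform P X1 X2 (- b) a by apply: covform_gt0; rewrite xpair_eqE (gt_eqF a0) andbF.
have -> : covform P X1 X2 (- b) a = a * (a * c - b ^+ 2).
  by rewrite /covform -/a -/b -/c; ring.
by rewrite pmulr_rgt0.
Qed.

Local Notation nu := (sumlaw P mX1 mX2).

Lemma local_limit_half_exp (b1 b2 : bool) (k1 k2 : R) : 0 < k1 -> 0 < k2 ->
  n%:R * (\int[nu n]_s (half_exp b1 k1 s.1 * half_exp b2 k2 s.2))%R @[n --> \oo] -->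
  (k1 * k2)^-1 / (2 * pi * Num.sqrt (a * c - b ^+ 2)).
Proof.
move=> k10 k20.
pose h (s : R * R) := half_exp b1 k1 s.1 * half_exp b2 k2 s.2.
have mh : measurable_fun setT h.
  by apply: measurable_funM; apply: measurableT_comp => //; exact: measurable_half_exp.
have h0 s : 0 <= h s by rewrite mulr_ge0// half_exp_ge0.
have h1 s : h s <= 1 by rewrite mulr_ile1// ?half_exp_ge0// half_exp_le1.
have Ih : (\int[@plane R]_s (h s)%:E = ((k1 * k2)^-1)%:E)%E.
  rewrite (ge0_integral_leb2M (measurable_half_exp b1 k1) (measurable_half_exp b2 k2)
    (half_exp_ge0 b1 k1) (half_exp_ge0 b2 k2)).
  by rewrite !integral_half_exp// -EFinM -invfM.
have ih : (@plane R).-integrable setT (EFin \o h).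
  apply/integrableP; split; first exact/measurable_EFinP.
  by under eq_integral do rewrite /= ger0_norm//; rewrite Ih ltry.
have g0 : 0 <= k1 + k2 by rewrite addr_ge0// ltW.
have hm (s u : R * R) : 0 <= u.1 -> 0 <= u.2 ->
    expR (- ((k1 + k2) * (u.1 + u.2))) * h s <= h (s.1 + u.1, s.2 + u.2).
  move=> u1 u2; rewrite mulrDr opprD expRD mulrACA.
  apply: ler_pM; rewrite ?mulr_ge0 ?expR_ge0 ?half_exp_ge0//.
    by apply: half_exp_mono => //; rewrite lerDl ltW.
  by apply: half_exp_mono => //; rewrite lerDr ltW.
have <- : (\int[@plane R]_s h s)%R = (k1 * k2)^-1 by rewrite /Rintegral Ih.
exact: (local_limit mX1 mX2 iN3 EX1 EX2 covariance_det_gt0 nonlattice mh h0 h1 ih g0 hm).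
Qed.

End nonlattice_covariance.

(** * One-dimensional walks by doubling *)

Section product_law.
Context d (T : measurableType d) (R : realType) (P : probability T R).
Local Notation P2 := (P \x P)%E.

Lemma ge0_integral_prodM (f g : T -> \bar R) :
  measurable_fun setT f -> measurable_fun setT g ->
  (forall x, 0 <= f x)%E -> (forall x, 0 <= g x)%E ->
  (\int[P2]_y (f y.1 * g y.2) = (\int[P]_y f y) * (\int[P]_y g y))%E.
Proof.
move=> mf mg f0 g0.
have mF : measurable_fun setT (fun y : T * T => (f y.1 * g y.2)%E).
  by apply: emeasurable_funM; exact: measurableT_comp.
have F0 (y : T * T) : (0 <= f y.1 * g y.2)%E by rewrite mule_ge0.
rewrite (@fubini_tonelli1 _ _ _ _ _ P P _ mF F0) /fubini_F/=.
under eq_integral do rewrite ge0_integralZl//.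
by rewrite ge0_integralZr// integral_ge0.
Qed.

Lemma integrable_prodM (f g : T -> R) :
  P.-integrable setT (EFin \o f) -> P.-integrable setT (EFin \o g) ->
  P2.-integrable setT (EFin \o (fun y : T * T => f y.1 * g y.2)).
Proof.
move=> fi gi.
have mf : measurable_fun setT (EFin \o f) by case/integrableP: fi.
have mg : measurable_fun setT (EFin \o g) by case/integrableP: gi.
apply/integrableP; split.
  have := @emeasurable_funM _ _ _ setT (fun y : T * T => (f y.1)%:E) (fun y => (g y.2)%:E).
  by apply; [exact: (measurableT_comp mf)|exact: (measurableT_comp mg)].
have -> : (\int[P2]_y `|(EFin \o (fun y : T * T => (f y.1 * g y.2)%R)) y| =
    (\int[P]_y `|(f y)%:E|) * (\int[P]_y `|(g y)%:E|))%E.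
  rewrite -(@ge0_integral_prodM (fun y => `|(f y)%:E|%E) (fun y => `|(g y)%:E|%E))//.
  - by apply: eq_integral => y _; rewrite /= normrM.
  - exact: measurableT_comp.
  - exact: measurableT_comp.
have f1 := (integrableP _ _ _ fi).2; have g1 := (integrableP _ _ _ gi).2.
by apply: lte_mul_pinfty => //; [exact: integral_ge0|rewrite ge0_fin_numE// integral_ge0].
Qed.

Lemma Rintegral_prodM (f g : T -> R) :
  P.-integrable setT (EFin \o f) -> P.-integrable setT (EFin \o g) ->
  (\int[P2]_y (f y.1 * g y.2) = (\int[P]_y f y) * (\int[P]_y g y))%R.
Proof.
move=> fi gi; have fgi := integrable_prodM fi gi.
rewrite [LHS]/Rintegral -(@integral12_prod_meas1 _ _ _ _ _ P P _ fgi) /fubini_F /=.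
under eq_integral => x _.
  rewrite EFin_Rintegral//; last exact: integrableRZl.
  rewrite RintegralZl//.
  over.
by rewrite -[LHS]/(\int[P]_x (f x * (\int[P]_y g y)))%R RintegralZr.
Qed.

Variable X : T -> R.
Hypothesis mX : measurable_fun setT X.
Local Notation Y1 := (fun y : T * T => X y.1).
Local Notation Y2 := (fun y : T * T => X y.2).

Lemma measurable_prod1 : measurable_fun setT Y1.
Proof. exact: measurableT_comp. Qed.

Lemma measurable_prod2 : measurable_fun setT Y2.
Proof. exact: measurableT_comp. Qed.

(** The coordinates of the walk with steps [(X y.1, X y.2)] are independent copies of the walk with
    steps [X]. The latter is encoded as the diagonal walk [(X, X)], read through its first
    coordinate, so that [sumlaw] serves for both. *)
Lemma ge0_integral_sumlaw_prod n (f g : R -> \bar R) :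
  measurable_fun setT f -> measurable_fun setT g ->
  (forall x, 0 <= f x)%E -> (forall x, 0 <= g x)%E ->
  (\int[sumlaw P2 measurable_prod1 measurable_prod2 n]_s (f s.1 * g s.2) =
   (\int[sumlaw P mX mX n]_s f s.1) * (\int[sumlaw P mX mX n]_s g s.1))%E.
Proof.
elim: n f g => [|n IH] f g mf mg f0 g0.
  have mF : measurable_fun setT (fun s : R * R => (f s.1 * g s.2)%E).
    by apply: emeasurable_funM; exact: measurableT_comp.
  have mf1 : measurable_fun setT (fun s : R * R => f s.1) by exact: measurableT_comp.
  have mg1 : measurable_fun setT (fun s : R * R => g s.1) by exact: measurableT_comp.
  by rewrite (ge0_integral_sumlaw0 _ _ _ mF) (ge0_integral_sumlaw0 _ _ _ mf1)
    (ge0_integral_sumlaw0 _ _ _ mg1).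
have mF : measurable_fun setT (fun s : R * R => (f s.1 * g s.2)%E).
  by apply: emeasurable_funM; exact: measurableT_comp.
have mf1 : measurable_fun setT (fun s : R * R => f s.1) by exact: measurableT_comp.
have mg1 : measurable_fun setT (fun s : R * R => g s.1) by exact: measurableT_comp.
have maddX (h : R -> \bar R) : measurable_fun setT h -> (forall x, 0 <= h x)%E ->
    measurable_fun setT (fun y => \int[sumlaw P mX mX n]_s h (s.1 + X y)%R)%E.
  move=> mh h0; pose F (q : T * (R * R)) := h (q.2.1 + X q.1)%R.
  have mFq : measurable_fun setT F.
    apply: (measurableT_comp mh); apply: measurable_funD; last exact: measurableT_comp.
    by apply: measurableT_comp.
  by apply: (@measurable_fun_fubini_tonelli_F _ _ _ _ _ (sumlaw P mX mX n) F) => // q; exact: h0.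
have shift (h : R -> \bar R) (y : T) : measurable_fun setT h ->
    measurable_fun setT (fun x : R => h (x + X y)%R).
  by move=> mh; apply: (measurableT_comp mh); exact: measurable_funD.
rewrite ge0_integral_sumlawS; [|exact: mF|by move=> s; rewrite mule_ge0].
rewrite ge0_integral_sumlawS// [in RHS]ge0_integral_sumlawS//=.
under eq_integral do rewrite (IH _ _ (shift f _ mf) (shift g _ mg))//.
rewrite [RHS](_ : _ = (\int[P]_y \int[sumlaw P mX mX n]_s f (s.1 + X y)%R) *
  (\int[P]_y \int[sumlaw P mX mX n]_s g (s.1 + X y)%R))%E//.
rewrite -(ge0_integral_prodM (maddX f mf f0) (maddX g mg g0))// => y; exact: integral_ge0.
Qed.

Hypothesis iX3 : P.-integrable setT (EFin \o (fun y => `|X y| ^+ 3)).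
Hypothesis EX : (\int[P]_y X y)%R = 0.
Local Notation C u := (\int[P]_y cos (u * X y))%R.
Local Notation S u := (\int[P]_y sin (u * X y))%R.
Hypothesis nonlattice : forall u, u != 0 -> C u ^+ 2 + S u ^+ 2 < 1.

(** The planar limit for the doubled walk. Its covariance is [sigma^2] times the identity, so the
    square root of the determinant is the variance [sigma^2] itself. *)
Lemma local_limit_half_exp1 (b : bool) (k : R) : 0 < k ->
  n%:R * (\int[sumlaw P mX mX n]_s half_exp b k s.1)%R ^+ 2 @[n --> \oo] -->
  (k ^+ 2)^-1 / (2 * pi * (\int[P]_y (X y) ^+ 2)%R).
Proof.
move=> k0.
have i1 : P.-integrable setT (EFin \o (fun=> 1 : R)).
  by apply: (@bounded_integrable _ _ _ _ _ 1) => // x; rewrite normr1.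
have E1 : (\int[P]_y 1)%R = 1 :> R by rewrite Rintegral_cst//= probability_setT mulr1.
have iNX : P.-integrable setT (EFin \o (fun y => (`|X y| + `|0 : R|) ^+ 3)).
  by have := iX3; apply: eq_integrable => // y _; rewrite /= normr0 addr0.
have iX : P.-integrable setT (EFin \o X).
  by apply: (integrable_X1 mX iNX).
have iX2 : P.-integrable setT (EFin \o (fun y => X y ^+ 2)).
  by apply: (integrable_X11 mX iNX).
have fstE (f : T -> R) : P.-integrable setT (EFin \o f) ->
    P2.-integrable setT (EFin \o (fun y => f y.1)) /\
    (\int[P2]_y f y.1 = \int[P]_y f y)%R.
  move=> fi; split.
    by have := integrable_prodM fi i1; apply: eq_integrable => // y _; rewrite /= mulr1.
  rewrite -[RHS]mulr1 -E1 -(Rintegral_prodM fi i1).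
  by apply: eq_Rintegral => y _; rewrite mulr1.
have sndE (f : T -> R) : P.-integrable setT (EFin \o f) ->
    P2.-integrable setT (EFin \o (fun y => f y.2)) /\
    (\int[P2]_y f y.2 = \int[P]_y f y)%R.
  move=> fi; split.
    by have := integrable_prodM i1 fi; apply: eq_integrable => // y _; rewrite /= mul1r.
  rewrite -[RHS]mul1r -E1 -(Rintegral_prodM i1 fi).
  by apply: eq_Rintegral => y _; rewrite mul1r.
have iN3 : P2.-integrable setT (EFin \o (fun y => (`|Y1 y| + `|Y2 y|) ^+ 3)).
  apply: le_integrableR (integrableRZl 8 (integrableRD (fstE _ iX3).1 (sndE _ iX3).1)).
    by apply: measurable_funX; apply: measurable_funD; apply: measurableT_comp;
      [|exact: measurable_prod1| |exact: measurable_prod2].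
  move=> y; rewrite normrX (ger0_norm (addr_ge0 _ _))//.
  have x0 := normr_ge0 (X y.1); have x1 := normr_ge0 (X y.2).
  set u := `|X y.1| in x0 *; set v := `|X y.2| in x1 *.
  have [uv|/ltW vu] := leP u v.
    have h : (u + v) ^+ 3 <= (2 * v) ^+ 3 by rewrite lerXn2r ?nnegrE; lra.
    by apply: (le_trans h); rewrite exprMn -[leLHS]add0r mulrDr lerD ?mulr_ge0 ?exprn_ge0//; lra.
  have h : (u + v) ^+ 3 <= (2 * u) ^+ 3 by rewrite lerXn2r ?nnegrE; lra.
  by apply: (le_trans h); rewrite exprMn -[leLHS]addr0 mulrDr lerD ?mulr_ge0 ?exprn_ge0//; lra.
have EY1 : (\int[P2]_y Y1 y)%R = 0 by rewrite (fstE _ iX).2.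
have EY2 : (\int[P2]_y Y2 y)%R = 0 by rewrite (sndE _ iX).2.
have E11 : (\int[P2]_y Y1 y ^+ 2)%R = (\int[P]_y X y ^+ 2)%R by rewrite (fstE _ iX2).2.
have E22 : (\int[P2]_y Y2 y ^+ 2)%R = (\int[P]_y X y ^+ 2)%R by rewrite (sndE _ iX2).2.
have E12 : (\int[P2]_y (Y1 y * Y2 y))%R = 0 by rewrite Rintegral_prodM// EX mul0r.
have ic u : P.-integrable setT (EFin \o (fun y => cos (u * X y))).
  by apply: integrable_cos; exact: measurable_funM.
have iS u : P.-integrable setT (EFin \o (fun y => sin (u * X y))).
  by apply: integrable_sin; exact: measurable_funM.
have CE u v : char1C P2 Y1 Y2 u v = C u * C v - S u * S v.
  rewrite /char1C -!Rintegral_prodM// -RintegralB//; last 2 first.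
  - exact: (integrable_prodM (ic u) (ic v)).
  - exact: (integrable_prodM (iS u) (iS v)).
  by apply: eq_Rintegral => y _; rewrite cosD.
have SE u v : char1S P2 Y1 Y2 u v = S u * C v + C u * S v.
  rewrite /char1S -!Rintegral_prodM// -RintegralD//; last 2 first.
  - exact: (integrable_prodM (iS u) (ic v)).
  - exact: (integrable_prodM (ic u) (iS v)).
  by apply: eq_Rintegral => y _; rewrite sinD.
have nl2 u v : (u, v) != (0, 0) -> char1C P2 Y1 Y2 u v ^+ 2 + char1S P2 Y1 Y2 u v ^+ 2 < 1.
  move=> uv0; rewrite CE SE.
  (* The squared modulus factors. If one frequency is 0 its factor is 1, and the other frequency is
     then nonzero. *)
  have -> : (C u * C v - S u * S v) ^+ 2 + (S u * C v + C u * S v) ^+ 2 =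
    (C u ^+ 2 + S u ^+ 2) * (C v ^+ 2 + S v ^+ 2) by ring.
  have CS0 : C 0 ^+ 2 + S 0 ^+ 2 = 1.
    have -> : C 0 = 1 by rewrite -[RHS]E1; apply: eq_Rintegral => y _; rewrite mul0r cos0.
    have -> : S 0 = 0.
      rewrite -[RHS](mul0r (\int[P]_y 1)%R) -RintegralZl//.
      by apply: eq_Rintegral => y _; rewrite !mul0r sin0.
    by rewrite expr1n expr0n addr0.
  have [u0|u0] := eqVneq u 0; last first.
    have [v0|v0] := eqVneq v 0; first by rewrite v0 CS0 mulr1 nonlattice.
    by rewrite mulr_ilt1 ?addr_ge0 ?sqr_ge0// nonlattice.
  rewrite u0 CS0 mul1r nonlattice//.
  by move: uv0; rewrite u0 xpair_eqE eqxx.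
have L := local_limit_half_exp measurable_prod1 measurable_prod2 iN3 EY1 EY2 nl2 b b k0 k0.
rewrite E11 E22 E12 expr0n subr0 -expr2 sqrtr_sqr ger0_norm in L; last first.
  by apply: Rintegral_ge0 => y _; exact: sqr_ge0.
rewrite (_ : (fun n => _) = (fun n => n%:R * (\int[sumlaw P2 measurable_prod1 measurable_prod2 n]_s
  (half_exp b k s.1 * half_exp b k s.2))%R))//.
apply/funext => n; congr (_ * _).
have mh : measurable_fun setT (fun x => (half_exp b k x)%:E).
  by apply/measurable_EFinP; exact: measurable_half_exp.
have h0 x : (0 <= (half_exp b k x)%:E)%E by rewrite lee_fin half_exp_ge0.
have := @ge0_integral_sumlaw_prod n _ _ mh mh h0 h0.
move=> E; rewrite /Rintegral.
transitivity (fine (\int[sumlaw P mX mX n]_s (half_exp b k s.1)%:E *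
   \int[sumlaw P mX mX n]_s (half_exp b k s.1)%:E)%E); last by congr fine; exact: esym E.
rewrite expr2 fineM//; rewrite ge0_fin_numE ?integral_ge0//.
all: apply: le_lt_trans (_ : \int[sumlaw P mX mX n]_s 1%:E < _)%E; last by rewrite integral_cst//= probability_setT mul1e ltry.
all: apply: ge0_le_integral => //; first by apply: (measurableT_comp mh).
all: by move=> s _; rewrite lee_fin half_exp_le1.
Qed.

End product_law.

(** * Tails of the uniform distribution on the ball *)

Section iterated_integral.
Context {R : realType} (P : probability (measurableTypeR R) R).
Variables (X1 X2 : R -> R) (k a b l : R).
Hypotheses (mX1 : measurable_fun setT (X1 : measurableTypeR R -> R)).
Hypotheses (mX2 : measurable_fun setT (X2 : measurableTypeR R -> R)).
Hypothesis l0 : 0 < l.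
Local Notation mu := (@lebesgue_measure R).
Hypothesis untilt : forall F : R -> \bar R, measurable_fun setT F -> (forall x, 0 <= F x)%E ->
  (\int[P]_x (F x * (expR (k + a * X1 x + b * X2 x))%:E) = \int[mu]_x F x)%E.
Local Notation nu := (sumlaw P mX1 mX2).

Let tilt n (s : R * R) : \bar R := (expR (n%:R * k + a * s.1 + b * s.2))%:E.

Let mtilt n : measurable_fun setT (tilt n).
Proof.
apply/measurable_EFinP; apply: measurableT_comp => //.
by apply: measurable_funD; [apply: measurable_funD => //|]; exact: measurable_funM.
Qed.

Let tilt0 n s : (0 <= tilt n s)%E.
Proof. by rewrite lee_fin expR_ge0. Qed.

(** Each coordinate is scaled by [l] and rewritten from Lebesgue measure to [P] by [untilt]. The
    density factors multiply to an exponential that depends only on [n] and the two sums. The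
    induction matches the first coordinate of [iint] with the last step of the walk. *)
Lemma iint_sumlaw n (G : R * R -> \bar R) : measurable_fun setT G ->
  (forall s, 0 <= G s)%E ->
  ((l ^+ n)%:E * iint (fun x : n.-tuple R =>
      G (\sum_(i < n) X1 (l * tnth x i), \sum_(i < n) X2 (l * tnth x i))%R) =
   \int[nu n]_s (G s * (expR (n%:R * k + a * s.1 + b * s.2))%:E))%E.
Proof.
elim: n G => [|n IH] G mG G0.
  have mF : measurable_fun setT (fun s => (G s * tilt 0 s)%E).
    by apply: emeasurable_funM.
  rewrite (ge0_integral_sumlaw0 P mX1 mX2 mF).
  by rewrite /tilt /= !mul0r !mulr0 !addr0 expR0 mule1 !big_ord0 expr0 mul1e.
pose Gy (y : R) (s : R * R) := G (s.1 + X1 y, s.2 + X2 y).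
have mGy y : measurable_fun setT (Gy y).
  by apply: (measurableT_comp mG); apply: measurable_fun_pair; exact: measurable_funD.
have Gy0 y s : (0 <= Gy y s)%E by exact: G0.
pose Psi y : \bar R := (\int[nu n]_s (Gy y s * tilt n s))%E.
have Psi0 y : (0 <= Psi y)%E by apply: integral_ge0 => s _; rewrite mule_ge0.
have mPsi : measurable_fun setT Psi.
  pose F (q : measurableTypeR R * (R * R)) := (Gy q.1 q.2 * tilt n q.2)%E.
  have mF : measurable_fun setT F.
    apply: emeasurable_funM; last exact: (measurableT_comp (mtilt n)).
    have s1 : measurable_fun setT (fun q : measurableTypeR R * (R * R) => q.2.1).
      by apply: (measurableT_comp measurable_fst); exact: measurable_snd.
    have s2 : measurable_fun setT (fun q : measurableTypeR R * (R * R) => q.2.2).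
      by apply: (measurableT_comp measurable_snd); exact: measurable_snd.
    have x1 : measurable_fun setT (fun q : measurableTypeR R * (R * R) => X1 q.1).
      by apply: (measurableT_comp mX1); exact: measurable_fst.
    have x2 : measurable_fun setT (fun q : measurableTypeR R * (R * R) => X2 q.1).
      by apply: (measurableT_comp mX2); exact: measurable_fst.
    apply: (measurableT_comp mG); apply: measurable_fun_pair; exact: measurable_funD.
  by apply: (@measurable_fun_fubini_tonelli_F _ _ _ _ _ (nu n) F) => // q; rewrite mule_ge0.
have ln0 : 0 < l ^+ n by rewrite exprn_gt0.
have inner x : iint (fun t : n.-tuple R => G
    (\sum_(i < n.+1) X1 (l * tnth [tuple of x :: t] i),
     \sum_(i < n.+1) X2 (l * tnth [tuple of x :: t] i))%R) =
    (((l ^+ n)^-1)%:E * Psi (l * x)%R)%E.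
  rewrite /Psi -(IH (Gy (l * x))) => [|//|//].
  rewrite muleA -EFinM mulVf ?gt_eqF// mul1e; congr iint; apply/funext => t.
  rewrite /Gy !big_ord_recl /= !tnth0; congr (G (_, _)); rewrite addrC; congr (_ + _);
    by apply: eq_bigr => i _; rewrite tnthS.
rewrite /=; under eq_integral do rewrite inner.
rewrite ge0_integralZl_EFin//; last 2 first.
- by apply: (measurableT_comp mPsi); exact: measurable_funM.
- by rewrite invr_ge0 ltW.
rewrite muleA -EFinM exprSr -mulrA mulrCA divff ?gt_eqF// mulr1.
have -> : (l%:E * \int[mu]_x Psi (l * x)%R = \int[mu]_x Psi x)%E.
  rewrite -(@ge0_integral_affine _ l 0 Psi l0 mPsi Psi0).
  by under [in RHS]eq_integral do rewrite addr0.
rewrite -untilt//.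
have mGt : measurable_fun setT (fun s => (G s * tilt n.+1 s)%E) by exact: emeasurable_funM.
have Gt0 s : (0 <= G s * tilt n.+1 s)%E by rewrite mule_ge0.
rewrite (ge0_integral_sumlawS P mX1 mX2 n mGt Gt0).
apply: eq_integral => y _.
rewrite /Psi muleC -ge0_integralZl_EFin ?expR_ge0//; last 2 first.
- by move=> s _; rewrite mule_ge0.
- exact: emeasurable_funM.
apply: eq_integral => s _; rewrite muleCA; congr (_ * _)%E.
rewrite /tilt -EFinM -expRD; congr (expR _)%:E => /=.
by rewrite -natr1; ring.
Qed.

Lemma fine_vol_sumlaw n (E : set (n.-tuple R)) (G : R * R -> R) :
  measurable_fun setT G -> (forall s, 0 <= G s) ->
  (nu n).-integrable setT (EFin \o (fun s => G s * expR (a * s.1 + b * s.2))) ->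
  (forall x, \1_E x = G (\sum_(i < n) X1 (l * tnth x i), \sum_(i < n) X2 (l * tnth x i))) ->
  fine (vol E) = (l ^+ n)^-1 *
    (expR (n%:R * k) * (\int[nu n]_s (G s * expR (a * s.1 + b * s.2)))%R).
Proof.
move=> mG G0 iG EG; have ln0 : 0 < l ^+ n by rewrite exprn_gt0.
have mGE : measurable_fun setT (EFin \o G) by exact/measurable_EFinP.
have := @iint_sumlaw n _ mGE (fun s => G0 s).
rewrite (_ : iint _ = vol E); last by rewrite /vol; congr iint; apply/funext => x; rewrite EG.
rewrite (_ : (\int[nu n]_s _)%E =
    (expR (n%:R * k) * (\int[nu n]_s (G s * expR (a * s.1 + b * s.2)))%R)%:E); last first.
  rewrite -RintegralZl// -EFin_Rintegral//; last exact: integrableRZl.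
  apply: eq_integral => s _; rewrite -EFinM -addrA expRD; congr EFin; ring.
(* No case of infinite volume has to be excluded: [fine] sends it to 0 before and after scaling by a
   positive real. *)
move=> h; rewrite [X in _ = _ * X](_ : _ = fine ((l ^+ n)%:E * vol E)%E); last by rewrite h.
case: (vol E) => [r| |] /=.
- by rewrite mulKf// gt_eqF.
- by rewrite gt0_muley ?lte_fin// mulr0.
- by rewrite gt0_muleNy ?lte_fin// mulr0.
Qed.

End iterated_integral.

Section powR_order.
Context {R : realType}.

Lemma powR_leE (r x y : R) : 0 < r -> 0 <= x -> 0 <= y -> (x `^ r <= y `^ r) = (x <= y).
Proof.
move=> r0 x0 y0; apply/idP/idP => h; last by apply: ge0_ler_powR; rewrite ?nnegrE ?(ltW r0).
rewrite leNgt; apply/negP => yx; move: h; rewrite leNgt => /negP; apply.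
by apply: gt0_ltr_powR; rewrite ?nnegrE.
Qed.

Lemma powR_ltE (r x y : R) : 0 < r -> 0 <= x -> 0 <= y -> (x `^ r < y `^ r) = (x < y).
Proof. by move=> r0 x0 y0; rewrite !ltNge powR_leE. Qed.

End powR_order.

Section ball.
Context {R : realType} (p q z : R).
Hypotheses (q0 : 0 < q) (p0 : 0 < p) (z0 : 0 <= z).
Variable n : nat.
Hypothesis n0 : (0 < n)%N.
Local Notation l := ((n%:R : R) `^ p^-1).

Let nR : 0 < n%:R :> R. Proof. by rewrite ltr0n. Qed.

Lemma scale_gt0 : 0 < l.
Proof. exact: powR_gt0. Qed.

Lemma sum_powR_scale (r : R) (x : n.-tuple R) :
  \sum_(i < n) `|l * tnth x i| `^ r = l `^ r * \sum_(i < n) `|tnth x i| `^ r.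
Proof.
rewrite mulr_sumr; apply: eq_bigr => i _.
by rewrite normrM (gtr0_norm scale_gt0) powRM// powR_ge0.
Qed.

Let sum0 (r : R) (x : n.-tuple R) : 0 <= \sum_(i < n) `|tnth x i| `^ r.
Proof. by apply: sumr_ge0 => i _; exact: powR_ge0. Qed.

(** With [l = n^(1/p)] one has [l^p = n], so the unit ball becomes a sign condition on a sum of [n]
    terms; [norm_scaled] gives the same form to the tail event. *)
Lemma lball_scaled (x : n.-tuple R) :
  (lnorm p x <= 1) = (0 <= \sum_(i < n) (1 - `|l * tnth x i| `^ p)).
Proof.
rewrite sumrB sumr_const card_ord sum_powR_scale subr_ge0.
rewrite -powRrM mulVf ?gt_eqF// powRr1 ?ler0n// ger_pMr//.
by rewrite /lnorm -[X in _ <= X](_ : 1 `^ p^-1 = 1) ?powR_leE ?invr_gt0// powR1.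
Qed.

Lemma norm_scaled (x : n.-tuple R) :
  (z < n%:R `^ (p^-1 - q^-1) * lnorm q x) =
  (0 < \sum_(i < n) (`|l * tnth x i| `^ q - z `^ q)).
Proof.
have qn0 : q != 0 by rewrite gt_eqF.
have lE : lnorm q x `^ q = \sum_(i < n) `|tnth x i| `^ q.
  by rewrite /lnorm -powRrM (mulVf qn0) powRr1.
have nE : (n%:R `^ (p^-1 - q^-1)) `^ q = l `^ q / n%:R :> R.
  rewrite -!powRrM mulrBl (mulVf qn0) powRB; last by rewrite (gt_eqF nR) implybT.
  by rewrite powRr1// ler0n.
rewrite sumrB sumr_const card_ord sum_powR_scale subr_gt0.
have y0 : 0 <= n%:R `^ (p^-1 - q^-1) * lnorm q x by rewrite mulr_ge0// powR_ge0.
rewrite -(powR_ltE q0 z0 y0) (powRM _ (powR_ge0 _ _) (powR_ge0 _ _)) lE nE.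
by rewrite mulrAC ltr_pdivlMr// mulr_natr.
Qed.

End ball.

Section volumes.
Context {R : realType} (p q : R).
Hypotheses (q1 : 1 <= q) (qp : q < p).
Local Notation mu := (@lebesgue_measure R).
Let q0 : 0 < q. Proof. exact: lt_le_trans q1. Qed.
Let p0 : 0 < p. Proof. exact: lt_trans qp. Qed.

Lemma gibbs_untilt t s (s0 : 0 < s) (phi : R -> R) (F : R -> \bar R) :
  measurable_fun setT phi -> (forall x, expR (phi x) * gibbs_pdf p q t s x = 1) ->
  measurable_fun setT F -> (forall x, 0 <= F x)%E ->
  (\int[gibbs q1 qp t s0]_x (F x * (expR (phi x))%:E) = \int[mu]_x F x)%E.
Proof.
move=> mphi hphi mF F0.
have mE : measurable_fun setT (fun x => (F x * (expR (phi x))%:E)%E).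
  by apply: emeasurable_funM => //; apply/measurable_EFinP; exact: measurableT_comp.
rewrite ge0_integral_density_prob//; last by move=> x; rewrite mule_ge0// lee_fin expR_ge0.
by apply: eq_integral => x _; rewrite -muleA -EFinM hphi mule1.
Qed.

Lemma measurable_center_powR (r c : R) : measurable_fun setT (fun x : R => `|x| `^ r - c).
Proof. by apply: measurable_funB => //; exact: measurable_powR_norm. Qed.

Lemma measurable_powR_center (r c : R) : measurable_fun setT (fun x : R => c - `|x| `^ r).
Proof. by apply: measurable_funB => //; exact: measurable_powR_norm. Qed.

Lemma integrable_half_expM d (T : measurableType d) (Q : probability T R)
    (f g : T -> R) b1 b2 k1 k2 : 0 < k1 -> 0 < k2 ->
  measurable_fun setT f -> measurable_fun setT g ->
  Q.-integrable setT (EFin \o (fun x => half_exp b1 k1 (f x) * half_exp b2 k2 (g x))).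
Proof.
move=> k10 k20 mf mg; apply: (@bounded_integrable _ _ _ _ _ 1).
  by apply: measurable_funM; apply: measurableT_comp => //; exact: measurable_half_exp.
move=> x; rewrite ger0_norm ?mulr_ge0 ?half_exp_ge0//.
by rewrite mulr_ile1 ?half_exp_ge0 ?half_exp_le1.
Qed.

(** Volume as an expectation along the centered walk. The factor [exp (- t u_1 - s u_2)] from the
    change of measure meets the indicator of the quadrant and forms the two [half_exp] weights. *)
Lemma fine_vol_tail (t s z : R) (s0 : 0 < s) n : 0 < t -> 0 <= z -> (0 < n)%N ->
  fine (vol ([set x : n.-tuple R | z < n%:R `^ (p^-1 - q^-1) * lnorm q x] `&` @lball R n p)) =
  ((n%:R `^ p^-1) ^+ n)^-1 * (expR (n%:R * (ln (partition p q t s) - t * z `^ q + s)) *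
    (\int[sumlaw (gibbs q1 qp t s0) (measurable_center_powR q (z `^ q))
       (measurable_powR_center p 1) n]_u (half_exp false t u.1 * half_exp true s u.2))%R).
Proof.
move=> t0 z0 n0; set Z := partition p q t s.
have Z0 : 0 < Z by exact: partition_gt0.
pose G (u : R * R) : R := \1_(half_line false) u.1 * \1_(half_line true) u.2.
have mG : measurable_fun setT G.
  by apply: measurable_funM; apply: measurableT_comp => //; apply: measurable_indic;
    exact: measurable_itv.
have G0 u : 0 <= G u by rewrite mulr_ge0.
have GE u : G u * expR (- t * u.1 + - s * u.2) = half_exp false t u.1 * half_exp true s u.2.
  by rewrite expRD /G /half_exp -!mulNr; ring.
(* The inverse Gibbs density [Z exp (- t |x|^q + s |x|^p)] has exponent [k - t X1 - s X2] with
   [k = ln Z - t z^q + s]. *)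
rewrite (@fine_vol_sumlaw _ (gibbs q1 qp t s0) _ _ (ln Z - t * z `^ q + s) (- t) (- s)
  (n%:R `^ p^-1) (measurable_center_powR q (z `^ q)) (measurable_powR_center p 1)
  (scale_gt0 p n0) _ n _ G mG G0).
- by congr (_ * (_ * _)); apply: eq_Rintegral => u _; exact: GE.
- move=> F mF F0; apply: gibbs_untilt => //.
    apply: measurable_funD; first apply: measurable_funD => //; apply: measurable_funM => //.
      exact: measurable_center_powR.
    exact: measurable_powR_center.
  move=> x; rewrite /gibbs_pdf /wt -/Z mulrA -expRD.
  rewrite (_ : _ + _ = ln Z); last by ring.
  by rewrite lnK ?posrE// divff// gt_eqF.
- have := @integrable_half_expM _ _ (sumlaw (gibbs q1 qp t s0) (measurable_center_powR q (z `^ q))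
    (measurable_powR_center p 1) n) _ _ false true t s t0 s0 measurable_fst measurable_snd.
  by apply: eq_integrable => // u _; rewrite /= GE.
move=> x; rewrite /G /= !indicE !mem_half_line -norm_scaled// -lball_scaled//.
by rewrite in_setI /lball !mem_setE -natrM mulnb.
Qed.

(** The same computation under the law of [f_p], with rate [1/p] and with both coordinates of the
    walk equal; only the first is used. *)
Lemma fine_vol_ball n (pinv : 0 < p^-1) : (0 < n)%N ->
  fine (vol (@lball R n p)) =
  ((n%:R `^ p^-1) ^+ n)^-1 * (expR (n%:R * (ln (partition p q 0 p^-1) + p^-1)) *
    (\int[sumlaw (gibbs q1 qp 0 pinv)
       (measurable_powR_center p 1) (measurable_powR_center p 1) n]_u
       half_exp true p^-1 u.1)%R).
Proof.
move=> n0; set Z := partition p q 0 p^-1.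
have Z0 : 0 < Z by exact: partition_gt0.
pose G (u : R * R) : R := \1_(half_line true) u.1.
have mG : measurable_fun setT G.
  by apply: measurableT_comp => //; apply: measurable_indic; exact: measurable_itv.
have G0 u : 0 <= G u by [].
have GE u : G u * expR (- p^-1 * u.1 + 0 * u.2) = half_exp true p^-1 u.1.
  by rewrite /G /half_exp mul0r addr0 mulNr mulrC.
rewrite (@fine_vol_sumlaw _ (gibbs q1 qp 0 pinv) _ _ (ln Z + p^-1) (- p^-1) 0
  (n%:R `^ p^-1) (measurable_powR_center p 1) (measurable_powR_center p 1)
  (scale_gt0 p n0) _ n _ G mG G0).
- by congr (_ * (_ * _)); apply: eq_Rintegral => u _; exact: GE.
- move=> F mF F0; apply: gibbs_untilt => //.
    apply: measurable_funD; first apply: measurable_funD => //; apply: measurable_funM => //;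
      exact: measurable_powR_center.
  move=> x; rewrite /gibbs_pdf /wt -/Z mulrA -expRD.
  rewrite (_ : _ + _ = ln Z); last by ring.
  by rewrite lnK ?posrE// divff// gt_eqF.
- apply: (@bounded_integrable _ _ _ _ _ 1).
    rewrite (_ : (fun u => _) = (fun u : R * R => half_exp true p^-1 u.1)); last exact/funext.
    by apply: measurableT_comp => //; exact: measurable_half_exp.
  by move=> u; rewrite GE ger0_norm ?half_exp_ge0// half_exp_le1.
move=> x; rewrite /G /= !indicE !mem_half_line -lball_scaled//.
by rewrite /lball mem_setE.
Qed.

End volumes.

(** * Assembling the asymptotics *)

Section asymptotics.
Context {R : realType} (p q z : R) (tau : 'rV[R]_2).
Hypotheses (q1 : 1 <= q) (qp : q < p).
Hypothesis mz : m_pq p q < z.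
Hypothesis tD : D_p p tau.
Hypothesis tz : grad (LamR p q) tau = zstar q z.
Let t := c1 tau.
Let s := p^-1 - c2 tau.
Let q0 : 0 < q. Proof. exact: lt_le_trans q1. Qed.
Let p0 : 0 < p. Proof. exact: lt_trans qp. Qed.
Let pinv : 0 < p^-1. Proof. by rewrite invr_gt0. Qed.
Let s0 : 0 < s. Proof. by rewrite subr_gt0. Qed.
Let t0 : 0 < t. Proof. exact: (tilt_gt0 q1 qp tD tz mz). Qed.
Let z0 : 0 <= z. Proof. by apply: le_trans (ltW mz); exact: powR_ge0. Qed.
Local Notation H := (hessian (LamR p q) tau).
Local Notation i1 := (lift ord0 ord0 : 'I_2).

Let W n := (\int[sumlaw (gibbs q1 qp t s0) (measurable_center_powR q (z `^ q))
       (measurable_powR_center p 1) n]_u (half_exp false t u.1 * half_exp true s u.2))%R.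
Let V n := (\int[sumlaw (gibbs q1 qp 0 pinv)
       (measurable_powR_center p 1) (measurable_powR_center p 1) n]_u
       half_exp true p^-1 u.1)%R.

(** The second step coordinate is [1 - |y|^p], so the mixed covariance is minus the Hessian entry;
    the sign disappears in the determinant, whose positivity comes from the nonlattice property. *)
Lemma numerator_limit : 0 < \det H /\
  n%:R * W n @[n --> \oo] --> (t * s)^-1 / (2 * pi * Num.sqrt (\det H)).
Proof.
have [E1 E2] := saddle_centered q1 qp tD tz s0.
have [C1 C2 C3] := saddle_covariance q1 qp tD tz s0.
have i3 := integrable_saddle3 q1 qp z s0.
have nl := gibbs_nonlattice q1 qp t s0 (z `^ q).
have DE : \det H = H ord0 ord0 * H i1 i1 - (- H ord0 i1) ^+ 2.
  by rewrite (det_hessianE q1 qp tD tz) sqrrN.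
rewrite DE -C1 -C2 -C3; split.
  exact: (@covariance_det_gt0 _ (measurableTypeR R) R (gibbs q1 qp t s0) _ _
    (measurable_center_powR q (z `^ q)) (measurable_powR_center p 1) i3 nl).
exact: (@local_limit_half_exp _ (measurableTypeR R) R (gibbs q1 qp t s0) _ _
  (measurable_center_powR q (z `^ q)) (measurable_powR_center p 1)
  i3 E1 E2 nl false true _ _ t0 s0).
Qed.

(** Under [f_p] the variable [|x|^p] has mean 1 and variance [p], by the dilation identities at
    [tau = 0]. With rate [1/p] the limit is [p^2 / (2 pi p)]. *)
Lemma denominator_limit : n%:R * V n ^+ 2 @[n --> \oo] --> p / (2 * pi).
Proof.
pose X (x : measurableTypeR R) : R := 1 - `|x| `^ p.
pose P := gibbs q1 qp 0 pinv.
pose mX : measurable_fun setT X := measurable_powR_center p 1.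
have Z0 := partition_gt0 q1 qp 0 pinv.
have bB : poly_bounded p q (fun x => `|x| `^ p) by exact: poly_boundedp.
have b1 c : poly_bounded p q (fun=> c) by exact: poly_bounded_cst.
have bX : poly_bounded p q X by exact: poly_boundedX2.
have bX3 : poly_bounded p q (fun x => `|X x| ^+ 3).
  have [mXX [k [c hX]]] := poly_boundedM (poly_boundedM bX bX) bX.
  split; first by apply: measurable_funX; exact: (measurableT_comp _ mX).
  exists k, c => x; apply: le_trans (hX x).
  by rewrite -normrX normr_id exprSr expr2.
have iB := integrable_gibbs q1 qp 0 pinv bB.
pose o : 'rV[R]_2 := 0.
have o1 : c1 o = 0 by rewrite /c1 mxE.
have o2 : c2 o = 0 by rewrite /c2 mxE.
have oD : D_p p o by rewrite /D_p /= o2.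
have h1 := homogeneous_mean1 q1 qp oD; have h2 := homogeneous_meanp q1 qp oD.
rewrite o1 o2 subr0 mulr0 mul0r addr0 divff ?gt_eqF// mul1r in h1 h2.
have eB : moment p q (fun x => `|x| `^ p) 0 p^-1 / partition p q 0 p^-1 = 1 by lra.
rewrite eB in h2.
have EX : (\int[P]_x X x)%R = 0.
  rewrite RintegralB//; last exact: integrable_gibbs (b1 1).
  rewrite Rintegral_cst//= probability_setT mulr1 (Rintegral_gibbs q1 qp 0 pinv bB) eB.
  by rewrite subrr.
have EX2 : (\int[P]_x X x ^+ 2)%R = p.
  have bBB := poly_boundedM bB bB.
  have iBB := integrable_gibbs q1 qp 0 pinv bBB.
  transitivity (\int[P]_x ((`|x| `^ p * `|x| `^ p) - (2 * `|x| `^ p - 1)))%R.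
    by apply: eq_Rintegral => x _; rewrite /X; ring.
  have i2 := integrableRZl 2 iB.
  have i1' := integrable_gibbs q1 qp 0 pinv (b1 1).
  rewrite (RintegralB measurableT iBB (integrableRB i2 i1')).
  rewrite (RintegralB measurableT i2 i1') RintegralZl//.
  rewrite Rintegral_cst//= probability_setT mulr1.
  rewrite (Rintegral_gibbs q1 qp 0 pinv bB) eB (Rintegral_gibbs q1 qp 0 pinv bBB).
  by lra.
have nl (u : R) : u != 0 ->
    (\int[P]_y cos (u * X y))%R ^+ 2 + (\int[P]_y sin (u * X y))%R ^+ 2 < 1.
  move=> u0; have uv : (0 : R, u) != (0, 0) by rewrite xpair_eqE (negbTE u0) andbF.
  have := gibbs_nonlattice q1 qp 0 pinv 0 uv.
  have -> : char1C P (fun x => `|x| `^ q - 0) (fun x => 1 - `|x| `^ p) 0 u =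
      (\int[P]_y cos (u * X y))%R.
    by apply: eq_Rintegral => y _; rewrite mul0r add0r.
  have -> : char1S P (fun x => `|x| `^ q - 0) (fun x => 1 - `|x| `^ p) 0 u =
      (\int[P]_y sin (u * X y))%R.
    by apply: eq_Rintegral => y _; rewrite mul0r add0r.
  by [].
have i3 := integrable_gibbs q1 qp 0 pinv bX3.
have := @local_limit_half_exp1 _ (measurableTypeR R) R P X mX i3 EX nl true _ pinv.
have e : (p^-1 ^+ 2)^-1 / (2 * pi * p) = p / (2 * pi).
  have pn0 : p != 0 by rewrite gt_eqF.
  by rewrite exprVn invrK expr2 invfM mulrA mulrAC mulfK.
rewrite EX2 e; exact.
Qed.

Lemma unif_tail n : (0 < n)%N ->
  @Unif R n p [set x : n.-tuple R | z < n%:R `^ (p^-1 - q^-1) * lnorm q x] =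
  expR (- (n%:R * fine (LambdaStar p q (zstar q z)))) * (W n / V n).
Proof.
move=> n0; have Z0 := partition_gt0 q1 qp t s0; have N0 := partition_gt0 q1 qp 0 pinv.
have l0 := scale_gt0 p n0.
have num := fine_vol_tail q1 qp s0 t0 z0 n0.
have den := fine_vol_ball q1 qp pinv n0.
rewrite /Unif num den.
rewrite (LambdaStarE q1 qp tD tz) /= ln_div ?posrE// -/t -/s.
(* The powers of [n] cancel in the ratio. The difference of the exponents per step is minus
   [LambdaStar], because [s - 1/p = - tau_2]. *)
have l1 : ((n%:R : R) `^ p^-1) ^+ n != 0 by rewrite expf_neq0// gt_eqF.
rewrite -mulf_div divff ?invr_eq0// mul1r -mulf_div -expRN -expRD.
by congr (expR _ * _); rewrite /s; ring.
Qed.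

Lemma unif_tail_asymptotics : exists e : nat -> R, e @ \oo --> 0 /\
    \forall n \near \oo,
      @Unif R n p [set x : n.-tuple R | z < n%:R `^ (p^-1 - q^-1) * lnorm q x]
      = (Num.sqrt (2 * pi * n%:R) * gamma_z p q z tau)^-1
        * expR (- (n%:R * fine (LambdaStar p q (zstar q z))))
        * (1 + e n).
Proof.
have [D0 cW] := numerator_limit; have cV := denominator_limit.
have gE : gamma_z p q z tau = t * s * Num.sqrt (p * \det H).
  by apply: gamma_zE.
have pD0 : 0 < Num.sqrt (p * \det H) by rewrite sqrtr_gt0 mulr_gt0.
set g := gamma_z p q z tau in gE *.
have g0 : 0 < g by rewrite gE !mulr_gt0.
pose f n := Num.sqrt (2 * pi * n%:R) * g * (W n / V n).
exists (fun n => f n - 1); split; last first.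
  exists 1%N => // n /= n0; rewrite unif_tail// addrC subrK /f.
  have a0 : Num.sqrt (2 * pi * n%:R) * g != 0.
    by rewrite mulf_neq0 ?gt_eqF// sqrtr_gt0 !mulr_gt0// ?pi_gt0// ltr0n.
  by rewrite [RHS]mulrACA (mulVf a0) mul1r.
have pi2 : 0 < 2 * pi :> R by rewrite mulr_gt0// pi_gt0.
have V0 n : 0 <= V n by apply: Rintegral_ge0 => u _; exact: half_exp_ge0.
(* Rewrites [sqrt n * W / V] as [n W / sqrt (n V^2)], the combination of the two known limits;
   nonnegativity of [V] recovers it from its square. *)
have fE n : (0 < n)%N ->
    f n = Num.sqrt (2 * pi) * g * (n%:R * W n / Num.sqrt (n%:R * V n ^+ 2)).
  move=> n0; rewrite /f (sqrtrM _ (ltW pi2)) (sqrtrM (V n ^+ 2) (ler0n R n)).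
  rewrite sqrtr_sqr (ger0_norm (V0 n)).
  have r0 : Num.sqrt (n%:R : R) != 0 by rewrite gt_eqF// sqrtr_gt0 ltr0n.
  have nE : (n%:R : R) = Num.sqrt n%:R * Num.sqrt n%:R by rewrite -expr2 sqr_sqrtr.
  rewrite [X in _ = _ * (X * _ / _)]nE invfM.
  transitivity (Num.sqrt (2 * pi) * g * (Num.sqrt n%:R * (W n * (V n)^-1))).
    by move: (W n) (V n) => w v; ring.
  congr (_ * _); rewrite -!mulrA; congr (_ * _).
  by rewrite [RHS]mulrCA [X in _ = _ * X]mulrA (divff r0) mul1r.
have cf : f n @[n --> \oo] --> Num.sqrt (2 * pi) * g *
    ((t * s)^-1 / (2 * pi * Num.sqrt (\det H)) / Num.sqrt (p / (2 * pi))).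
  apply: (cvg_trans _ (_ : (fun n => Num.sqrt (2 * pi) * g *
     (n%:R * W n / Num.sqrt (n%:R * V n ^+ 2))) @ \oo --> _)).
    by apply: near_eq_cvg; exists 1%N => // n /= n0; rewrite fE.
  apply: cvgMr; apply: cvgM => //; apply: cvgV.
    by rewrite gt_eqF// sqrtr_gt0 divr_gt0// mulr_gt0// pi_gt0.
  by apply: continuous_cvg => //; exact: sqrt_continuous.
have <- : 1 - 1 = 0 :> R by rewrite subrr.
apply: cvgB; last exact: cvg_cst.
rewrite [X in _ --> X](_ : _ = Num.sqrt (2 * pi) * g *
    ((t * s)^-1 / (2 * pi * Num.sqrt (\det H)) / Num.sqrt (p / (2 * pi))))//.
have r0 : Num.sqrt (2 * pi) != 0 :> R by rewrite gt_eqF// sqrtr_gt0.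
have r1 : Num.sqrt p != 0 by rewrite gt_eqF// sqrtr_gt0.
have r2 : Num.sqrt (\det H) != 0 by rewrite gt_eqF// sqrtr_gt0.
rewrite gE (sqrtrM _ (ltW p0)) (sqrtrM _ (ltW p0)) sqrtrV ?(ltW pi2)//.
have -> : 2 * pi * Num.sqrt (\det H) = Num.sqrt (2 * pi) ^+ 2 * Num.sqrt (\det H).
  by rewrite sqr_sqrtr ?ltW.
have t1 : t != 0 by rewrite gt_eqF.
have s1 : s != 0 by rewrite gt_eqF.
by field; rewrite r0 r1 r2 t1 s1.
Qed.

End asymptotics.

Theorem theorem3p2 (R : realType) (p q z : R) (tau : 'rV[R]_2) :
  1 <= q -> q < p ->
  m_pq p q < z ->
  (* zstar q z in J_p, with tau = tau(zstar q z) the (unique) solution *)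
  D_p p tau -> grad (LamR p q) tau = zstar q z ->
  exists e : nat -> R, e @ \oo --> 0 /\
    \forall n \near \oo,
      @Unif R n p [set x : n.-tuple R | z < n%:R `^ (p^-1 - q^-1) * lnorm q x]
      = (Num.sqrt (2 * pi * n%:R) * gamma_z p q z tau)^-1
        * expR (- (n%:R * fine (LambdaStar p q (zstar q z))))
        * (1 + e n).
Proof.
move=> q1 qp mz tD tz.
exact: (unif_tail_asymptotics q1 qp mz tD tz).
Qed.
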